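(* The invariant decomposition formula for the simple group $PSL(2,13)$ of order $1092$ is given as follows: $$\left[\frac{\eta^2(z)}{\eta^2(13z)}\right]^5=\frac{\Phi_{12}(a_1(z),a_2(z),a_3(z),a_4(z),a_5(z),a_6(z))}{(a_1(z)a_2(z)a_3(z)a_4(z)a_5(z)a_6(z))^2},$$ where $\Phi_{12}(z_1,\dots,z_6)$ is an invariant of degree $12$ associated to $PSL(2,13)$, and $(z_1z_2z_3z_4z_5z_6)^2$ is invariant under the action of the image of a Borel subgroup of $PSL(2,13)$ (i.e. a maximal subgroup of order $78$ of $PSL(2,13)$).
   Context: Let $q=e^{2\pi i z}$, $z$ in the upper half-plane, and $\eta(z)=q^{1/24}\prod_{n\ge1}(1-q^n)$. The theta constants for $\Gamma(13)$ are $a_1(z)=q^{121/104}\sum_{n\in\mathbb{Z}}(-1)^nq^{\frac12(13n^2+11n)}$, $a_2(z)=q^{49/104}\sum_{n}(-1)^nq^{\frac12(13n^2+7n)}$, $a_3(z)=q^{25/104}\sum_{n}(-1)^nq^{\frac12(13n^2+5n)}$, $a_4(z)=-q^{9/104}\sum_{n}(-1)^nq^{\frac12(13n^2+3n)}$, $a_5(z)=q^{81/104}\sum_{n}(-1)^nq^{\frac12(13n^2+9n)}$, $a_6(z)=q^{1/104}\sum_{n}(-1)^nq^{\frac12(13n^2+n)}$. Define the senary cubic forms $\mathbb{D}_0=z_1z_2z_3$, $\mathbb{D}_\infty=z_4z_5z_6$, $\mathbb{D}_1=2z_2z_3^2+z_2^2z_6-z_4^2z_5+z_1z_5z_6$,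 $\mathbb{D}_2=-z_6^3+z_2^2z_4-2z_2z_5^2+z_1z_4z_5+3z_3z_5z_6$, $\mathbb{D}_3=2z_1z_2^2+z_1^2z_5-z_4z_6^2+z_3z_4z_5$, $\mathbb{D}_4=-z_2^2z_3+z_1z_6^2-2z_4^2z_6-z_1z_3z_5$, $\mathbb{D}_5=-z_4^3+z_3^2z_5-2z_3z_6^2+z_2z_5z_6+3z_1z_4z_6$, $\mathbb{D}_6=-z_5^3+z_1^2z_6-2z_1z_4^2+z_3z_4z_6+3z_2z_4z_5$, $\mathbb{D}_7=-z_2^3+z_3z_4^2-z_1z_3z_6-3z_1z_2z_5+2z_1^2z_4$, $\mathbb{D}_8=-z_1^3+z_2z_6^2-z_2z_3z_5-3z_1z_3z_4+2z_3^2z_6$, $\mathbb{D}_9=2z_1^2z_3+z_3^2z_4-z_5^2z_6+z_2z_4z_6$, $\mathbb{D}_{10}=-z_1z_3^2+z_2z_4^2-2z_4z_5^2-z_1z_2z_6$, $\mathbb{D}_{11}=-z_3^3+z_1z_5^2-z_1z_2z_4-3z_2z_3z_6+2z_2^2z_5$, $\mathbb{D}_{12}=-z_1^2z_2+z_3z_5^2-2z_5z_6^2-z_2z_3z_4$, and the senary sextic forms $\mathbb{G}_0=\mathbb{D}_0^2+\mathbb{D}_\infty^2$, $\mathbb{G}_1=-\mathbb{D}_7^2+2\mathbb{D}_0\mathbb{D}_1+10\mathbb{D}_\infty\mathbb{D}_1+2\mathbb{D}_2\mathbb{D}_{12}-2\mathbb{D}_3\mathbb{D}_{11}-4\mathbb{D}_4\mathbb{D}_{10}-2\mathbb{D}_9\mathbb{D}_5$,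 $\mathbb{G}_2=-2\mathbb{D}_1^2-4\mathbb{D}_0\mathbb{D}_2+6\mathbb{D}_\infty\mathbb{D}_2-2\mathbb{D}_4\mathbb{D}_{11}+2\mathbb{D}_5\mathbb{D}_{10}-2\mathbb{D}_6\mathbb{D}_9-2\mathbb{D}_7\mathbb{D}_8$, $\mathbb{G}_3=-\mathbb{D}_8^2+2\mathbb{D}_0\mathbb{D}_3+10\mathbb{D}_\infty\mathbb{D}_3+2\mathbb{D}_6\mathbb{D}_{10}-2\mathbb{D}_9\mathbb{D}_7-4\mathbb{D}_{12}\mathbb{D}_4-2\mathbb{D}_1\mathbb{D}_2$, $\mathbb{G}_4=-\mathbb{D}_2^2+10\mathbb{D}_0\mathbb{D}_4-2\mathbb{D}_\infty\mathbb{D}_4+2\mathbb{D}_5\mathbb{D}_{12}-2\mathbb{D}_9\mathbb{D}_8-4\mathbb{D}_1\mathbb{D}_3-2\mathbb{D}_{10}\mathbb{D}_7$, $\mathbb{G}_5=-2\mathbb{D}_9^2-4\mathbb{D}_0\mathbb{D}_5+6\mathbb{D}_\infty\mathbb{D}_5-2\mathbb{D}_{10}\mathbb{D}_8+2\mathbb{D}_6\mathbb{D}_{12}-2\mathbb{D}_2\mathbb{D}_3-2\mathbb{D}_{11}\mathbb{D}_7$, $\mathbb{G}_6=-2\mathbb{D}_3^2-4\mathbb{D}_0\mathbb{D}_6+6\mathbb{D}_\infty\mathbb{D}_6-2\mathbb{D}_{12}\mathbb{D}_7+2\mathbb{D}_2\mathbb{D}_4-2\mathbb{D}_5\mathbb{D}_1-2\mathbb{D}_8\mathbb{D}_{11}$,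 $\mathbb{G}_7=-2\mathbb{D}_{10}^2+6\mathbb{D}_0\mathbb{D}_7+4\mathbb{D}_\infty\mathbb{D}_7-2\mathbb{D}_1\mathbb{D}_6-2\mathbb{D}_2\mathbb{D}_5-2\mathbb{D}_8\mathbb{D}_{12}-2\mathbb{D}_9\mathbb{D}_{11}$, $\mathbb{G}_8=-2\mathbb{D}_4^2+6\mathbb{D}_0\mathbb{D}_8+4\mathbb{D}_\infty\mathbb{D}_8-2\mathbb{D}_3\mathbb{D}_5-2\mathbb{D}_6\mathbb{D}_2-2\mathbb{D}_{11}\mathbb{D}_{10}-2\mathbb{D}_1\mathbb{D}_7$, $\mathbb{G}_9=-\mathbb{D}_{11}^2+2\mathbb{D}_0\mathbb{D}_9+10\mathbb{D}_\infty\mathbb{D}_9+2\mathbb{D}_5\mathbb{D}_4-2\mathbb{D}_1\mathbb{D}_8-4\mathbb{D}_{10}\mathbb{D}_{12}-2\mathbb{D}_3\mathbb{D}_6$, $\mathbb{G}_{10}=-\mathbb{D}_5^2+10\mathbb{D}_0\mathbb{D}_{10}-2\mathbb{D}_\infty\mathbb{D}_{10}+2\mathbb{D}_6\mathbb{D}_4-2\mathbb{D}_3\mathbb{D}_7-4\mathbb{D}_9\mathbb{D}_1-2\mathbb{D}_{12}\mathbb{D}_{11}$, $\mathbb{G}_{11}=-2\mathbb{D}_{12}^2+6\mathbb{D}_0\mathbb{D}_{11}+4\mathbb{D}_\infty\mathbb{D}_{11}-2\mathbb{D}_9\mathbb{D}_2-2\mathbb{D}_5\mathbb{D}_6-2\mathbb{D}_7\mathbb{D}_4-2\mathbb{D}_3\mathbb{D}_8$,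 $\mathbb{G}_{12}=-\mathbb{D}_6^2+10\mathbb{D}_0\mathbb{D}_{12}-2\mathbb{D}_\infty\mathbb{D}_{12}+2\mathbb{D}_2\mathbb{D}_{10}-2\mathbb{D}_1\mathbb{D}_{11}-4\mathbb{D}_3\mathbb{D}_9-2\mathbb{D}_4\mathbb{D}_8$. Finally $\Phi_{12}(z_1,\dots,z_6):=-\frac{1}{26}\left(7\cdot13^2\mathbb{G}_0^2+\mathbb{G}_1\mathbb{G}_{12}+\mathbb{G}_2\mathbb{G}_{11}+\cdots+\mathbb{G}_6\mathbb{G}_7\right)$. The group $PSL(2,13)$ acts on $\mathbb{P}^5$ via a six-dimensional representation generated by the matrices $S,T$ of Proposition 2.5 (with $\zeta=e^{2\pi i/13}$, $T=\mathrm{diag}(\zeta^7,\zeta^{11},\zeta^8,\zeta^6,\zeta^2,\zeta^5)$). *)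

(* Defs.v *)
From mathcomp Require Import all_boot all_order all_algebra all_fingroup.
From mathcomp Require Import all_solvable.
From mathcomp Require mpoly.

Set Implicit Arguments.
Unset Strict Implicit.
Unset Printing Implicit Defensive.

Import GRing.Theory Num.Theory.

Local Open Scope ring_scope.

(* The notations of mpoly clash with those of mathcomp-analysis, hence a module
   that is closed before the latter is imported. *)
Module Forms.
Import mpoly.

Section Forms.
Variable K : fieldType.

Definition z1 : {mpoly K[6]} := 'X_(@Ordinal 6 0 isT).
Definition z2 : {mpoly K[6]} := 'X_(@Ordinal 6 1 isT).
Definition z3 : {mpoly K[6]} := 'X_(@Ordinal 6 2 isT).
Definition z4 : {mpoly K[6]} := 'X_(@Ordinal 6 3 isT).
Definition z5 : {mpoly K[6]} := 'X_(@Ordinal 6 4 isT).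
Definition z6 : {mpoly K[6]} := 'X_(@Ordinal 6 5 isT).

Definition D0 := z1 * z2 * z3.
Definition Doo := z4 * z5 * z6.
Definition D1 := 2 * z2 * z3 ^+ 2 + z2 ^+ 2 * z6 - z4 ^+ 2 * z5 + z1 * z5 * z6.
Definition D2 :=
  - z6 ^+ 3 + z2 ^+ 2 * z4 - 2 * z2 * z5 ^+ 2 + z1 * z4 * z5 + 3 * z3 * z5 * z6.
Definition D3 := 2 * z1 * z2 ^+ 2 + z1 ^+ 2 * z5 - z4 * z6 ^+ 2 + z3 * z4 * z5.
Definition D4 :=
  - (z2 ^+ 2 * z3) + z1 * z6 ^+ 2 - 2 * z4 ^+ 2 * z6 - z1 * z3 * z5.
Definition D5 :=
  - z4 ^+ 3 + z3 ^+ 2 * z5 - 2 * z3 * z6 ^+ 2 + z2 * z5 * z6 + 3 * z1 * z4 * z6.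
Definition D6 :=
  - z5 ^+ 3 + z1 ^+ 2 * z6 - 2 * z1 * z4 ^+ 2 + z3 * z4 * z6 + 3 * z2 * z4 * z5.
Definition D7 :=
  - z2 ^+ 3 + z3 * z4 ^+ 2 - z1 * z3 * z6 - 3 * z1 * z2 * z5 + 2 * z1 ^+ 2 * z4.
Definition D8 :=
  - z1 ^+ 3 + z2 * z6 ^+ 2 - z2 * z3 * z5 - 3 * z1 * z3 * z4 + 2 * z3 ^+ 2 * z6.
Definition D9 := 2 * z1 ^+ 2 * z3 + z3 ^+ 2 * z4 - z5 ^+ 2 * z6 + z2 * z4 * z6.
Definition D10 :=
  - (z1 * z3 ^+ 2) + z2 * z4 ^+ 2 - 2 * z4 * z5 ^+ 2 - z1 * z2 * z6.
Definition D11 :=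
  - z3 ^+ 3 + z1 * z5 ^+ 2 - z1 * z2 * z4 - 3 * z2 * z3 * z6 + 2 * z2 ^+ 2 * z5.
Definition D12 :=
  - (z1 ^+ 2 * z2) + z3 * z5 ^+ 2 - 2 * z5 * z6 ^+ 2 - z2 * z3 * z4.

Definition G0 := D0 ^+ 2 + Doo ^+ 2.
Definition G1 := - D7 ^+ 2 + 2 * D0 * D1 + 10 * Doo * D1 + 2 * D2 * D12
  - 2 * D3 * D11 - 4 * D4 * D10 - 2 * D9 * D5.
Definition G2 := - (2 * D1 ^+ 2) - 4 * D0 * D2 + 6 * Doo * D2 - 2 * D4 * D11
  + 2 * D5 * D10 - 2 * D6 * D9 - 2 * D7 * D8.
Definition G3 := - D8 ^+ 2 + 2 * D0 * D3 + 10 * Doo * D3 + 2 * D6 * D10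
  - 2 * D9 * D7 - 4 * D12 * D4 - 2 * D1 * D2.
Definition G4 := - D2 ^+ 2 + 10 * D0 * D4 - 2 * Doo * D4 + 2 * D5 * D12
  - 2 * D9 * D8 - 4 * D1 * D3 - 2 * D10 * D7.
Definition G5 := - (2 * D9 ^+ 2) - 4 * D0 * D5 + 6 * Doo * D5 - 2 * D10 * D8
  + 2 * D6 * D12 - 2 * D2 * D3 - 2 * D11 * D7.
Definition G6 := - (2 * D3 ^+ 2) - 4 * D0 * D6 + 6 * Doo * D6 - 2 * D12 * D7
  + 2 * D2 * D4 - 2 * D5 * D1 - 2 * D8 * D11.
Definition G7 := - (2 * D10 ^+ 2) + 6 * D0 * D7 + 4 * Doo * D7 - 2 * D1 * D6
  - 2 * D2 * D5 - 2 * D8 * D12 - 2 * D9 * D11.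
Definition G8 := - (2 * D4 ^+ 2) + 6 * D0 * D8 + 4 * Doo * D8 - 2 * D3 * D5
  - 2 * D6 * D2 - 2 * D11 * D10 - 2 * D1 * D7.
Definition G9 := - D11 ^+ 2 + 2 * D0 * D9 + 10 * Doo * D9 + 2 * D5 * D4
  - 2 * D1 * D8 - 4 * D10 * D12 - 2 * D3 * D6.
Definition G10 := - D5 ^+ 2 + 10 * D0 * D10 - 2 * Doo * D10 + 2 * D6 * D4
  - 2 * D3 * D7 - 4 * D9 * D1 - 2 * D12 * D11.
Definition G11 := - (2 * D12 ^+ 2) + 6 * D0 * D11 + 4 * Doo * D11 - 2 * D9 * D2
  - 2 * D5 * D6 - 2 * D7 * D4 - 2 * D3 * D8.
Definition G12 := - D6 ^+ 2 + 10 * D0 * D12 - 2 * Doo * D12 + 2 * D2 * D10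
  - 2 * D1 * D11 - 4 * D3 * D9 - 2 * D4 * D8.

Definition Phi12 : {mpoly K[6]} := (- (1 / 26)) *:
  (7 * 13 ^+ 2 * G0 ^+ 2 + G1 * G12 + G2 * G11 + G3 * G10 + G4 * G9 + G5 * G8
   + G6 * G7).

Definition coord_prod_sq : {mpoly K[6]} :=
  (z1 * z2 * z3 * z4 * z5 * z6) ^+ 2.

Definition eval (v : 'I_6 -> K) (p : {mpoly K[6]}) : K := p.@[v].

Definition homogeneous (d : nat) (p : {mpoly K[6]}) : bool := p \is d.-homog.

(* p(M z), for the action z |-> M z of matrices on column vectors. *)
Definition subst_mx (M : 'M[K]_6) (p : {mpoly K[6]}) : {mpoly K[6]} :=
  p \mPo [tuple \sum_(j < 6) M i j *: 'X_j | i < 6].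

Definition invariant_under (M : 'M[K]_6) (p : {mpoly K[6]}) : Prop :=
  subst_mx M p = p.

End Forms.
End Forms.

Definition mx_of_rows (A : nmodType) (n : nat) (rows : seq (seq A)) : 'M[A]_n :=
  \matrix_(i, j) (nth [::] rows i)`_j.

Definition SL2_13 : {set {'GL_2(13)}} := [set g | \det (GLval g) == 1].

Lemma SL2_13_group_set : group_set SL2_13.
Proof.
apply/group_setP; split=> [|g h]; first by rewrite inE GL_1E det1.
by rewrite !inE GL_MxE det_mulmx => /eqP-> /eqP->; rewrite mulr1.
Qed.
Canonical SL2_13_group := Group SL2_13_group_set.

Definition PSL2_13 := (SL2_13 / 'Z(SL2_13))%g.
Canonical PSL2_13_group := [group of PSL2_13].

(* The stabiliser of the point at infinity of the projective line over 'F_13. *)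
Definition borel_SL2_13 : {set {'GL_2(13)}} :=
  [set g in SL2_13 | GLval g (1 : 'I_2) (0 : 'I_2) == 0].
Definition borel := (borel_SL2_13 / 'Z(SL2_13))%g.

Definition sl2_s_mx : 'M['F_13]_2 := mx_of_rows 2 [:: [:: 0; -1]; [:: 1; 0]].
Definition sl2_t_mx : 'M['F_13]_2 := mx_of_rows 2 [:: [:: 1; 1]; [:: 0; 1]].

Lemma sl2_s_unit : sl2_s_mx \is a GRing.unit.
Proof.
suff /mulmx1_unit[] : sl2_s_mx *m (- sl2_s_mx) = 1%:M by [].
by apply/matrixP=> [[[|[|//]] ?] [[|[|//]] ?]];
  rewrite !mxE !big_ord_recr big_ord0 /= !mxE; apply/eqP.
Qed.

Lemma sl2_t_unit : sl2_t_mx \is a GRing.unit.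
Proof.
suff /mulmx1_unit[] :
  sl2_t_mx *m mx_of_rows 2 [:: [:: 1; -1]; [:: 0; 1]] = 1%:M by [].
by apply/matrixP=> [[[|[|//]] ?] [[|[|//]] ?]];
  rewrite !mxE !big_ord_recr big_ord0 /= !mxE; apply/eqP.
Qed.

Definition sl2_s : {'GL_2(13)} := FinRing.unit _ sl2_s_unit.
Definition sl2_t : {'GL_2(13)} := FinRing.unit _ sl2_t_unit.

From mathcomp Require Import all_classical all_reals all_analysis.
From mathcomp Require Import complex.

Import numFieldNormedType.Exports.

Local Open Scope classical_set_scope.
Local Open Scope complex_scope.

(* The limits below are taken for the topology of the norm of K; it is the
   usual topology of the complex plane for K = R[i]. *)
Definition infinite_prod (K : numFieldType) (u : nat -> K) : K :=
  lim ((\prod_(1 <= k < n.+1) u k) @[n --> \oo]).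

Definition bilateral_sum (K : numFieldType) (u : int -> K) : K :=
  lim (series (fun n => u (Posz n)) @ \oo) +
  lim (series (fun n => u (Negz n)) @ \oo).

Section Theta.
Variable R : realType.

Definition cexp (w : R[i]) : R[i] :=
  (expR (complex.Re w))%:C * (cos (complex.Im w) +i* sin (complex.Im w)).

(* q ^ r = exp (2 pi i r z). *)
Definition qpow (z : R[i]) (r : R) : R[i] := cexp ((0 +i* (2 * pi * r)) * z).

Definition eta (z : R[i]) : R[i] :=
  qpow z (1 / 24) * infinite_prod (fun n => 1 - qpow z n%:R).

Definition theta (e l : int) (z : R[i]) : R[i] :=
  qpow z (e%:~R / 104) *
  bilateral_sum
    (fun n => (-1) ^ n * qpow z (1 / 2 * (13 * n ^+ 2 + l * n)%:~R)).

Definition theta13 (z : R[i]) (i : 'I_6) : R[i] :=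
  tnth [tuple theta 121 11 z; theta 49 7 z; theta 25 5 z;
              - theta 9 3 z; theta 81 9 z; theta 1 1 z] i.

Definition zeta13 : R[i] := cexp (0 +i* (2 * pi / 13)).

(* S13 and T13 are the matrices in the transformation laws of the column vector
   theta13:  theta13 (-1/z) = e^(pi i/4) sqrt z S13 theta13 (z)  and
   theta13 (z+1) = e^(-3 pi i/4) T13 theta13 (z).  One has S13^2 = -1, so that
   they generate a representation of SL(2,13), and of PSL(2,13) only
   projectively. *)
Definition S13 : 'M[R[i]]_6 := - (1 / (Num.sqrt 13)%:C) *:
  mx_of_rows 6 [seq [seq zeta13 ^+ e - zeta13 ^+ (13 - e) | e <- r] | r <-
    [:: [:: 12; 10;  4; 5; 2; 6];
        [:: 10;  4; 12; 2; 6; 5];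
        [::  4; 12; 10; 6; 5; 2];
        [::  5;  2;  6; 1; 3; 9];
        [::  2;  6;  5; 3; 9; 1];
        [::  6;  5;  2; 9; 1; 3]]%N].

Definition T13 : 'M[R[i]]_6 :=
  diag_mx (\row_i zeta13 ^+ nth 0%N [:: 7; 11; 8; 6; 2; 5]%N i).

End Theta.

(* Main.v *)
(** The six theta constants of level 13 are, up to a power of [q], lacunary
    series that the Jacobi triple product turns into infinite products; their
    product is [- eta(z) eta(13 z)^5], and the theorem reduces to the identity
    [Phi12(a_1, ..., a_6) = eta^12].

    Let [G] be the difference of the two sides.  As [Phi12] is invariant under
    the Weil representation of [SL(2,13)] and the vector [a] is transformed by
    its matrices [S] and [T], [G] behaves as a cusp form of weight 6 for the full
    modular group.  The transformation under [z |-> -1/z] is proved on the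
    imaginary axis, by Polya's elementary argument for theta functions, and is
    extended to the half-plane by the identity theorem in the Cayley disc.
    Then [mu = |G| y^3] is invariant and bounded, and Schwarz's lemma at the cusp
    improves any bound of [mu] by the factor 5/6, so that [G = 0].

    [Phi12] is invariant because it is a multiple of the sum of the squares of
    the 14 images of [G0], which are permuted like the points of the
    projective line over [F_13].  The relations of the Weil representation are
    verified by computation with exponents modulo 13, and yield a homomorphism
    by the Bruhat decomposition. *)

Require Import Defs.
From mathcomp Require Import all_boot all_order all_algebra all_fingroup.
From mathcomp Require Import all_solvable mxrepresentation zify ring.
From mathcomp Require mpoly.

Set Implicit Arguments.
Unset Strict Implicit.
Unset Printing Implicit Defensive.

Import GRing.Theory Num.Theory.
Local Open Scope ring_scope.

(** * The groups SL(2,F) and PSL(2,13) *)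

(** Both sides of [Phi12(a) = eta^12] begin with [q^(1/2)], so their difference is [q^(1/2)] times a
    power series in [q] without constant term; this one coefficient, [Psi_cusp], is all that is
    computed of the expansions. The factor [q^(1/2)] changes sign under [z |-> z + 1], hence the
    passage to the modulus [mu]. Iterating a contraction of [mu] takes the place of counting zeros
    in a fundamental domain.

    The inversion law is continued from the imaginary axis for the scalar function [defect] only,
    not for the vector of theta constants: its weight is an integer, so no branch of the square root
    of [z] has to be chosen, and in the Cayley disc the law says that one function is even. On the
    axis Polya's argument yields the law up to a constant [K], a Wallis limit; it is found
    afterwards from the pentagonal series of [eta], which is fixed by the inversion at [y = 1].

    The algebra lives over any field with a suitable 13th root of unity [z], where [g] is the Gauss
    sum of [z]. For the complex matrices, written with the positive square root of 13, this requires
    the sign of the Gauss sum, [gauss_sqrt13]. *)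

Section SL2.
Variable F : finFieldType.
Implicit Types (a b c d x l : F) (g : {'GL_2[F]}).
Local Open Scope group_scope.
Local Open Scope ring_scope.

Definition mx2 a b c d : 'M[F]_2 := mx_of_rows 2 [:: [:: a; b]; [:: c; d]].

(* The junk value 1 is taken when the determinant is zero. *)
Definition gl a b c d : {'GL_2[F]} :=
  odflt 1%g (insub (mx2 a b c d) : option {'GL_2[F]}).

Definition SL2 : {set {'GL_2[F]}} := [set g | \det (GLval g) == 1].

Lemma SL2_group_set : group_set SL2.
Proof.
apply/group_setP; split=> [|g h]; first by rewrite inE GL_1E det1.
by rewrite !inE GL_MxE det_mulmx => /eqP-> /eqP->; rewrite mulr1.
Qed.
Canonical SL2_group := Group SL2_group_set.

Definition borel2 : {set {'GL_2[F]}} :=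
  [set g in SL2 | GLval g (1 : 'I_2) (0 : 'I_2) == 0].

Lemma mx2M a b c d a' b' c' d' : mx2 a b c d *m mx2 a' b' c' d' =
  mx2 (a * a' + b * c') (a * b' + b * d') (c * a' + d * c') (c * b' + d * d').
Proof.
by apply/matrixP=> [[[|[|//]] ?] [[|[|//]] ?]];
  rewrite !mxE !big_ord_recr big_ord0 /= !mxE /= add0r.
Qed.

Lemma mx2E (M : 'M[F]_2) : M = mx2 (M 0 0) (M 0 1) (M 1 0) (M 1 1).
Proof.
by apply/matrixP=> [[[|[|//]] ?] [[|[|//]] ?]]; rewrite !mxE /=;
  congr (M _ _); apply: val_inj.
Qed.

Lemma mx2_inj a b c d a' b' c' d' : mx2 a b c d = mx2 a' b' c' d' ->
  [/\ a = a', b = b', c = c' & d = d'].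
Proof.
by move=> /matrixP e; move: (e 0 0) (e 0 1) (e 1 0) (e 1 1); rewrite !mxE.
Qed.

Lemma det_mx2 a b c d : \det (mx2 a b c d) = a * d - b * c.
Proof.
rewrite (expand_det_row _ 0) !big_ord_recl big_ord0 /= /cofactor !det_mx11 !mxE /=.
by rewrite expr0 mul1r addr0 expr1 mulN1r mulrN.
Qed.

Lemma glE a b c d : a * d - b * c = 1 -> GLval (gl a b c d) = mx2 a b c d.
Proof.
move=> h; rewrite /gl insubT //=.
rewrite -[_ \is a _]/(_ \in unitmx) unitmxE det_mx2.
by rewrite h unitr1.
Qed.

Lemma gl_inj a b c d a' b' c' d' :
  a * d - b * c = 1 -> a' * d' - b' * c' = 1 -> gl a b c d = gl a' b' c' d' ->
  [/\ a = a', b = b', c = c' & d = d'].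
Proof. by move=> h h' e; apply: mx2_inj; rewrite -(glE h) -(glE h') e. Qed.

Lemma gl_SL a b c d : a * d - b * c = 1 -> gl a b c d \in SL2.
Proof. by move=> h; rewrite inE glE // det_mx2 h. Qed.

Lemma SL2P g : g \in SL2 ->
  exists a b c d, a * d - b * c = 1 /\ g = gl a b c d.
Proof.
rewrite inE [GLval g]mx2E det_mx2 => /eqP h.
do 4 eexists; split; first exact: h.
by apply: val_inj; rewrite [RHS]glE // -mx2E.
Qed.

Lemma det_mx2M a b c d a' b' c' d' :
  a * d - b * c = 1 -> a' * d' - b' * c' = 1 ->
  (a * a' + b * c') * (c * b' + d * d') - (a * b' + b * d') * (c * a' + d * c') = 1.
Proof.
move=> h h'; transitivity ((a * d - b * c) * (a' * d' - b' * c')); first by ring.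
by rewrite h h' mulr1.
Qed.

Lemma glM a b c d a' b' c' d' :
  a * d - b * c = 1 -> a' * d' - b' * c' = 1 ->
  (gl a b c d * gl a' b' c' d')%g =
  gl (a * a' + b * c') (a * b' + b * d') (c * a' + d * c') (c * b' + d * d').
Proof.
move=> h h'; apply: val_inj; rewrite [RHS]glE; last exact: det_mx2M.
by rewrite [LHS]GL_MxE !glE // mx2M.
Qed.

Lemma gl1 : gl 1 0 0 1 = 1%g.
Proof.
apply: val_inj; rewrite [LHS]glE; last by ring.
by apply/matrixP=> [[[|[|//]] ?] [[|[|//]] ?]]; rewrite !mxE.
Qed.

Lemma glV a b c d : a * d - b * c = 1 -> (gl a b c d)^-1%g = gl d (- b) (- c) a.
Proof.
move=> h; have h' : d * a - (- b) * (- c) = 1 by rewrite -h; ring.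
apply/eqP; rewrite eq_invg_mul; apply/eqP; rewrite (glM h h').
by rewrite -gl1; congr gl; rewrite -?h; ring.
Qed.

Lemma glJ a b c d a' b' c' d' :
  a * d - b * c = 1 -> a' * d' - b' * c' = 1 ->
  (gl a b c d ^ gl a' b' c' d')%g =
  gl (d' * (a * a' + b * c') - b' * (c * a' + d * c'))
     (d' * (a * b' + b * d') - b' * (c * b' + d * d'))
     (a' * (c * a' + d * c') - c' * (a * a' + b * c'))
     (a' * (c * b' + d * d') - c' * (a * b' + b * d')).
Proof.
move=> h h'; rewrite conjgE glV // glM // glM.
- by congr gl; ring.
- by rewrite -h'; ring.
- exact: det_mx2M.
Qed.

(** Transports membership from a matrix computed by the group law to its simplified form; [tac]
    proves the equations between entries. *)
Ltac glin tac :=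
  let H := fresh in move=> H;
  match goal with |- is_true (?x \in _) =>
    match type of H with is_true (?y \in _) =>
      (have -> : x = y by congr gl; tac); exact H end end.

(** Commuting with one transvection and with the Weyl element already forces a scalar matrix, and
    then the determinant gives [a ^+ 2 = 1]. *)
Lemma center_SL2 : 'Z(SL2)%g = [set 1%g; gl (-1) 0 0 (-1)].
Proof.
have d1 : 1 * 1 - 1 * 0 = 1 :> F by ring.
have d2 : 0 * 0 - (-1) * 1 = 1 :> F by ring.
have dm : (-1) * (-1) - 0 * 0 = 1 :> F by ring.
apply/setP=> g; rewrite 3![in RHS]inE; apply/centerP/orP => [[gS gC]|].
  have [a [b [c [d [h e]]]]] := SL2P gS.
  have := gC _ (gl_SL d1); have := gC _ (gl_SL d2).
  rewrite /commute e !glM // => /gl_inj; case; [exact: det_mx2M..|].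
  move=> b1 b2 b3 b4 /gl_inj; case; [exact: det_mx2M..|].
  move=> c1 c2 c3 c4.
  have c0 : c = 0 by transitivity (1 * a + 1 * c - a); [ring|rewrite -c1; ring].
  have b0 : b = 0 by move: b1; rewrite c0 => e1; transitivity (a * 0 + b * 1); [ring|rewrite e1; ring].
  have ad : a = d by transitivity (a * 1 + b * 1 - b); [ring|rewrite c2; ring].
  move: h; rewrite b0 c0 -ad mulr0 subr0 -[X in _ = X](expr1n _ 2) -expr2.
  move=> /eqP; rewrite eqf_sqr => /orP[]/eqP ->; first by left; rewrite gl1.
  by right.
case=> /eqP ->; first by split; [exact: group1|move=> y _; rewrite /commute mul1g mulg1].
split; first exact: gl_SL.
move=> y /SL2P[a [b [c [d [h ->]]]]].
by rewrite /commute !glM //; congr gl; ring.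
Qed.

Lemma card_center_SL2 : (-1 != 1 :> F) -> #|'Z(SL2)%g| = 2%N.
Proof.
move=> ne; rewrite center_SL2 cards2; case: eqP => // /eqP.
rewrite eq_sym -gl1 => /eqP/gl_inj; case; [ring|ring|].
by move=> e; rewrite e eqxx in ne.
Qed.

Lemma borel2P g : reflect (exists a b, a != 0 /\ g = gl a b 0 a^-1)
  (g \in borel2).
Proof.
apply: (iffP setIdP) => [[/SL2P[a [b [c [d [h ->]]]]]]|[a [b [a0 ->]]]].
  rewrite glE // !mxE /= => /eqP c0; exists a, b; move: h; rewrite c0 mulr0 subr0.
  move=> ad; have a0 : a != 0.
    by apply/eqP=> a0; move/eqP: ad; rewrite a0 mul0r eq_sym oner_eq0.
  by split=> //; rewrite -(mulKf a0 d) ad mulr1.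
have h : a * a^-1 - b * 0 = 1 by rewrite mulfV // mulr0 subr0.
by rewrite gl_SL // glE // !mxE.
Qed.

Lemma bruhat_det a c d : c != 0 -> a * d - (a * d - 1) / c * c = 1.
Proof. by move=> c0; rewrite divfK //; ring. Qed.

(** On the big cell the determinant fixes [b], so that [a], [d] and [c != 0] are free parameters. *)
Lemma bruhat g : g \in SL2 -> g \notin borel2 ->
  exists a c d, c != 0 /\ g = gl a ((a * d - 1) / c) c d.
Proof.
move=> gS; have [a [b [c [d [h e]]]]] := SL2P gS.
have [c0|c0 _] := eqVneq c 0; first by rewrite inE gS e glE // !mxE /= c0 eqxx.
exists a, c, d; split=> //; rewrite e; congr gl.
by rewrite -h opprB addrC subrK mulfK.
Qed.

Lemma card_borel2 : #|borel2| = (#|F|.-1 * #|F|)%N.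
Proof.
pose f (p : F * F) := gl p.1 p.2 0 p.1^-1.
have -> : borel2 = f @: (setX (~: [set 0]) setT).
  apply/setP=> g; apply/borel2P/imsetP => [[a [b [a0 ->]]]|[[a b]]].
    by exists (a, b) => //; rewrite !inE a0.
  by rewrite !inE andbT => a0 ->; exists a, b.
rewrite card_in_imset; first by rewrite cardsX cardsC1 cardsT.
move=> [a b] [a' b']; rewrite !inE !andbT /= => a0 a0' /gl_inj[||/= -> ->] //=;
  by rewrite mulr0 subr0 mulfV.
Qed.

(** With [n = #|F|], the two Bruhat cells have [(n - 1) n] and [(n - 1) n ^ 2] elements. *)
Lemma card_SL2 : #|SL2| = (#|F|.-1 * #|F| * #|F|.+1)%N.
Proof.
rewrite -(cardsID borel2).
have -> : SL2 :&: borel2 = borel2.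
  by apply/setIidPr/subsetP=> g; rewrite inE => /andP[].
rewrite card_borel2.
pose f (p : F * F * F) := gl p.1.1 ((p.1.1 * p.2 - 1) / p.1.2) p.1.2 p.2.
have -> : SL2 :\: borel2 = f @: (setX (setX setT (~: [set 0])) setT).
  apply/setP=> g; rewrite inE; apply/andP/imsetP.
    move=> [gB gS]; have [a [c [d [c0 ->]]]] := bruhat gS gB.
    by exists ((a, c), d) => //; rewrite !inE c0.
  case=> [[[a c] d]]; rewrite !inE !andbT /= => c0 ->; have h := bruhat_det a d c0.
  have hS := gl_SL h; split=> //; last by move: hS; rewrite inE.
  by rewrite negb_and glE // !mxE /= c0 orbT.
rewrite card_in_imset.
  by rewrite !cardsX cardsC1 !cardsT mulnS [(_ * #|F|.-1)%N]mulnC.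
move=> [[a c] d] [[a' c'] d']; rewrite !inE !andbT /= => c0 c0'.
by move=> /gl_inj[||/= -> _ -> ->] //=; apply: bruhat_det.
Qed.

Lemma group_set_borel2 : group_set borel2.
Proof.
apply/group_setP; split; first by apply/borel2P; exists 1, 0; rewrite oner_neq0 invr1 gl1.
move=> x y /borel2P[a [b [a0 ->]]] /borel2P[a' [b' [a0' ->]]].
apply/borel2P; exists (a * a'), (a * b' + b * a'^-1); split.
  by rewrite mulf_neq0.
by rewrite glM ?mulr0 ?subr0 ?mulfV //; congr gl; field; rewrite ?a0 ?a0'.
Qed.
Canonical borel2_group := Group group_set_borel2.

Lemma borel2_sub : borel2 \subset SL2.
Proof. by apply/subsetP=> g /setIdP[]. Qed.

Lemma center_sub_borel2 : 'Z(SL2)%g \subset borel2.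
Proof.
apply/subsetP=> g; rewrite center_SL2 !inE => /orP[]/eqP->.
  by have := group1 borel2_group; rewrite !inE.
have h : (-1) * (-1) - 0 * 0 = 1 :> F by ring.
by have := gl_SL h; rewrite inE => -> /=; rewrite glE // !mxE.
Qed.

Lemma SL2_norm_center : SL2 \subset 'N('Z(SL2))%g.
Proof. by rewrite normal_norm ?center_normal. Qed.

(** Holds because the centre lies in the Borel subgroup; it brings the condition on cosets in the
    theorem back to matrices. *)
Lemma coset_borel2 g : g \in SL2 ->
  coset 'Z(SL2) g \in (borel2 / 'Z(SL2))%g -> g \in borel2.
Proof.
move=> gS /morphimP[x xN xB /= e].
have gN : g \in 'N('Z(SL2))%g by apply: subsetP gS; exact: SL2_norm_center.
have [k kZ ->] := kercoset_rcoset gN xN e.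
by rewrite groupM // (subsetP center_sub_borel2).
Qed.

(* B g B is the whole complement of B. *)
Lemma borel2_maximal (H : {group {'GL_2[F]}}) :
  borel2 \subset H -> H \subset SL2 -> H :=: borel2 \/ H :=: SL2.
Proof.
move=> BH HS; have [HB|/subsetPn[g gH gB]] := boolP (H \subset borel2).
  by left; apply/eqP; rewrite eqEsubset HB.
right; apply/eqP; rewrite eqEsubset HS; apply/subsetP=> x xS.
have [xB|xB] := boolP (x \in borel2); first exact: (subsetP BH).
have [a [c [d [c0 e]]]] := bruhat (subsetP HS _ gH) gB.
have [a' [c' [d' [c0' e']]]] := bruhat xS xB.
(* The torus part of [B1] turns the lower left entry [c] into [c'], its unipotent part makes the
   upper left entry [a'], and [B2] adjusts the lower right entry to [d']; the last entry follows
   from the determinant. *)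
pose B1 := gl (c / c') ((a' - c / c' * a) / c) 0 (c / c')^-1.
pose B2 := gl 1 ((d' - d * c' / c) / c') 0 1.
have h1 : c / c' != 0 by rewrite mulf_neq0 ?invr_neq0.
have B1H : B1 \in H by apply/(subsetP BH)/borel2P; exists (c / c'); eexists.
have B2H : B2 \in H.
  apply/(subsetP BH)/borel2P; exists 1; rewrite invr1.
  by eexists; split; [exact: oner_neq0|reflexivity].
suff -> : x = (B1 * g * B2)%g by rewrite !groupM.
rewrite e e' !glM; last 4 first.
- by field; rewrite c0 c0'.
- by ring.
- by field; rewrite c0 c0'.
- by field.
by congr gl; field; rewrite ?c0 ?c0'.
Qed.

(** An element of the big cell is a product of an upper, a lower and an upper transvection, and a
    triangular element is one of the big cell times a lower transvection. *)
Lemma transvection_gen (N : {group {'GL_2[F]}}) :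
  (forall x, gl 1 x 0 1 \in N) -> (forall x, gl 1 0 x 1 \in N) ->
  SL2 \subset N.
Proof.
pose t x := gl 1 x 0 1; pose u x := gl 1 0 x 1.
move=> tX uX.
have ht x : 1 * 1 - x * 0 = 1 by ring.
have hu x : 1 * 1 - 0 * x = 1 by ring.
have cN a c d : c != 0 -> gl a ((a * d - 1) / c) c d \in N.
  move=> c0; pose x := (a - 1) / c; pose y := (d - 1) / c.
  have -> : gl a ((a * d - 1) / c) c d = (t x * u c * t y)%g.
    rewrite /t /u (glM (ht x) (hu c)) (glM (det_mx2M (ht x) (hu c)) (ht y)).
    by congr gl; rewrite /x /y; field.
  exact: groupM (groupM (tX _) (uX _)) (tX _).
apply/subsetP=> g gS.
have [/borel2P[a [b [a0 ->]]]|gB] := boolP (g \in borel2); last first.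
  by have [a [c [d [c0 ->]]]] := bruhat gS gB; apply: cN.
have a1 : a^-1 != 0 by rewrite invr_neq0.
have := groupM (cN (a + b) a^-1 a^-1 a1) (uX (-1)).
rewrite (glM (bruhat_det _ _ a1) (hu _)).
have -> : ((a + b) * a^-1 - 1) / a^-1 = b.
  by rewrite invrK mulrBl mul1r divfK // addrC addKr.
by glin ltac:(ring).
Qed.

(** A non-central normal subgroup is made to contain a triangular element with distinct diagonal
    entries, and its commutators with transvections are all the transvections. The condition on [l]
    rules out the fields with 2, 3 and 5 elements. *)
Lemma normal_SL2 (l : F) (N : {group {'GL_2[F]}}) :
  l != 0 -> l ^+ 4 != 1 -> (N <| SL2)%g -> N \subset 'Z(SL2)%g \/ N :=: SL2.
Proof.
move=> l0 l4 nNS; have /andP[NS nN] := nNS.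
have [NZ|/subsetPn[g gN gZ]] := boolP (N \subset 'Z(SL2)%g); [by left|right].
have NJ (u v : {'GL_2[F]}) : u \in N -> v \in SL2 -> (u ^ v)%g \in N.
  by move=> uN vS; rewrite (memJ_norm _ (subsetP nN _ vS)).
have d2 : 0 * 0 - (-1) * 1 = 1 :> F by ring.
have [a [b [c [d [h e]]]]] := SL2P (subsetP NS _ gN).
(* a conjugate of g moves the point at infinity *)
have {a b c d h e} [a [b [c [d [h gN' c0]]]]] : exists a b c d,
    [/\ a * d - b * c = 1, gl a b c d \in N & c != 0].
  have [c0|c0] := eqVneq c 0; last by exists a, b, c, d; rewrite -e.
  have d3 : 1 * 1 - 0 * 1 = 1 :> F by ring.
  have [b0|b0] := eqVneq b 0; last first.
    have := NJ _ _ gN (gl_SL d2); rewrite e glJ //.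
    set a' := (X in gl X); set b' := (X in gl _ X).
    set c' := (X in gl _ _ X); set d' := (X in gl _ _ _ X) => H.
    exists a', b', c', d'; split=> //.
    - by rewrite -h /a' /b' /c' /d'; ring.
    - by rewrite /c' c0 (_ : _ - _ = - b) ?oppr_eq0 //; ring.
  have [ad|ad] := eqVneq a d.
    case/negP: gZ; rewrite center_SL2 3!inE e b0 c0 -ad.
    move: h; rewrite b0 c0 -ad mulr0 subr0 -[X in _ = X](expr1n _ 2) -expr2.
    by move=> /eqP; rewrite eqf_sqr => /orP[]/eqP ->; rewrite ?gl1 eqxx ?orbT.
  have := NJ _ _ gN (gl_SL d3); rewrite e glJ //.
  set a' := (X in gl X); set b' := (X in gl _ X).
  set c' := (X in gl _ _ X); set d' := (X in gl _ _ _ X) => H.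
  exists a', b', c', d'; split=> //.
  - by rewrite -h /a' /b' /c' /d'; ring.
  - rewrite /c' c0 b0 (_ : _ - _ = d - a); last by ring.
    by rewrite subr_eq0 eq_sym.
(* conjugate so that the upper left entry vanishes *)
have {a b d h gN'} [d gN'] : exists d, gl 0 (- c^-1) c d \in N.
  have dt : 1 * 1 - (a / c) * 0 = 1 by ring.
  have := NJ _ _ gN' (gl_SL dt); rewrite glJ //.
  rewrite (_ : _ - a / c * _ = 0); last by field.
  rewrite (_ : 1 * (c * 1 + d * 0) - _ = c); last by ring.
  rewrite (_ : 1 * (a * _ + b * 1) - _ = - c^-1); first by move=> H; eexists; exact: H.
  by transitivity (- (a * d - b * c) / c); [field|rewrite h mulN1r].
have h : 0 * d - (- c^-1) * c = 1 by field.
have dh : l * l^-1 - 0 * 0 = 1 by field.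
pose m := l ^+ 2; have m0 : m != 0 by rewrite expf_neq0.
(* The commutator with the diagonal matrix of [l] is triangular with diagonal [m], [m^-1]. *)
have B1 : gl m (d / c * (1 - m^-1)) 0 m^-1 \in N.
  have := groupM (groupVr gN') (NJ _ _ gN' (gl_SL dh)).
  rewrite glJ // glV // glM; last 2 first.
  - by rewrite -h; ring.
  - by field; rewrite l0 c0.
  by glin ltac:(rewrite /m; field; rewrite ?l0 ?c0).
have dB : m * m^-1 - d / c * (1 - m^-1) * 0 = 1 by field; rewrite ?m0 ?c0.
have m2 : 1 - m ^- 2 != 0.
  rewrite subr_eq0 eq_sym; apply: contra l4 => /eqP e.
  by rewrite (exprM l 2 2) -/m -[m ^+ 2]invrK e invr1.
(* The commutator of this triangular element with the transvection of [y] is the transvection of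
   [y * (1 - m ^- 2)], and [l ^+ 4 != 1] makes the factor invertible. *)
have tX x : gl 1 x 0 1 \in N.
  have [y ->] : exists y, x = y * (1 - m ^- 2).
    by exists (x / (1 - m ^- 2)); rewrite divfK.
  have d1 : 1 * 1 - y * 0 = 1 by ring.
  have := groupM (groupVr B1) (NJ _ _ B1 (gl_SL d1)).
  rewrite glJ // glV // glM; last 2 first.
  - by rewrite -dB; ring.
  - by field; rewrite ?m0 ?c0.
  by glin ltac:(field; rewrite ?m0 ?c0).
apply/eqP; rewrite eqEsubset NS transvection_gen // => x.
have ht : 1 * 1 - (- x) * 0 = 1 by ring.
have := NJ _ _ (tX (- x)) (gl_SL d2); rewrite (glJ ht d2).
by glin ltac:(ring).
Qed.

Lemma PSL2_simple (l : F) : -1 != 1 :> F ->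
  l != 0 -> l ^+ 4 != 1 -> simple (SL2 / 'Z(SL2))%g.
Proof.
move=> ne l0 l4; apply/simpleP; split.
  apply/eqP=> e; have := card_quotient SL2_norm_center.
  rewrite e cards1 -divgS ?center_sub // card_center_SL2 // card_SL2 => /eqP.
  have : (2 < #|F|)%N.
    have := max_card [set 0; 1; -1 : F]; rewrite -setUA !cardsU1 cards1 !inE.
    by rewrite [1 == -1]eq_sym (negbTE ne) ![0 == _]eq_sym oppr_eq0 oner_eq0.
  case: #|F| => [|[|[|n]]] // _ /= /eqP e1.
  have : (2 <= (n.+2 * n.+3 * n.+4) %/ 2)%N.
    by rewrite leq_divRL // (@leq_trans (2 * 3 * 4)%N) // !leq_mul.
  by rewrite -e1.
move=> H nH.
pose K := (coset 'Z(SL2) @*^-1 H)%G.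
have HE : (K / 'Z(SL2))%g = H :> {set _} by rewrite /= cosetpreK.
have KS : (K <| SL2)%g.
  by rewrite -(quotientGK (center_normal SL2_group)) cosetpre_normal.
have [KZ|e] := normal_SL2 l0 l4 KS; [left|right]; last by rewrite -HE e.
by rewrite -HE; apply/trivgP; rewrite -(trivg_quotient 'Z(SL2)) quotientS.
Qed.

Lemma PSL2_borel_maximal : borel2 != SL2 ->
  maximal (borel2 / 'Z(SL2))%g (SL2 / 'Z(SL2))%g.
Proof.
move=> neBS.
have nZ := SL2_norm_center.
have nB := subset_trans borel2_sub nZ.
have sZ := center_sub_borel2.
have BE : (coset 'Z(SL2) @*^-1 (borel2 / 'Z(SL2)))%g = borel2.
  by apply: (@quotientGK _ _ borel2_group); rewrite /normal sZ nB.
have SE : (coset 'Z(SL2) @*^-1 (SL2 / 'Z(SL2)))%g = SL2.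
  exact: (@quotientGK _ _ SL2_group (center_normal _)).
apply/maxgroupP; split=> [|H].
  rewrite properEneq quotientS ?borel2_sub // andbT.
  by apply: contra neBS => /eqP e; rewrite -BE e SE.
rewrite properE => /andP[HP nHP] BH.
pose K := (coset 'Z(SL2) @*^-1 H)%G.
have HE : (K / 'Z(SL2))%g = H :> {set _} by rewrite /= cosetpreK.
have KS : K \subset SL2 by have := morphpreS (coset 'Z(SL2)) HP; rewrite SE.
have BK : borel2 \subset K by have := morphpreS (coset 'Z(SL2)) BH; rewrite BE.
have [e|e] := borel2_maximal BK KS; first by rewrite -HE e.
by case/negP: nHP; rewrite -HE e.
Qed.

End SL2.

Lemma SL2_13E : SL2_13 = SL2 'F_13. Proof. by []. Qed.

Lemma F13_N1 : -1 != 1 :> 'F_13. Proof. by []. Qed.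

Lemma card_SL13 : #|SL2_13| = 2184%N.
Proof. by rewrite SL2_13E card_SL2 card_ord. Qed.

Lemma card_borel_SL13 : #|borel_SL2_13| = 156%N.
Proof. by rewrite [LHS](card_borel2 'F_13) card_ord. Qed.

Lemma card_borel : #|borel| = 78%N.
Proof.
transitivity #|(borel2 'F_13 / 'Z(SL2 'F_13))%g|; first by [].
rewrite card_quotient; last first.
  exact: subset_trans (borel2_sub _) (SL2_norm_center _).
rewrite -divgS ?(center_sub_borel2 'F_13) //= [X in (X %/ _)%N]card_borel_SL13.
by rewrite card_center_SL2 ?F13_N1.
Qed.

Lemma card_PSL : #|PSL2_13| = 1092%N.
Proof.
rewrite [LHS](card_quotient (SL2_norm_center 'F_13)) -divgS ?center_sub //=.
by rewrite [X in (X %/ _)%N]card_SL13 card_center_SL2 ?F13_N1.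
Qed.

(** The value 2 serves for [l], since [2 ^ 4 = 3] modulo 13. *)
Lemma simple_PSL : simple PSL2_13.
Proof. exact: (@PSL2_simple 'F_13 2). Qed.

Lemma borel_maximal : maximal borel PSL2_13.
Proof.
apply: (@PSL2_borel_maximal 'F_13); apply/eqP => e.
by have := card_SL13; rewrite SL2_13E -e [X in X = _]card_borel_SL13.
Qed.

(** * The Weil representation and its invariant forms *)

Section RootOfUnity.
Variables (A : comNzRingType) (y : A).
Hypotheses (y13 : y ^+ 13 = 1) (yS : \sum_(k < 13) y ^+ k = 0).

Lemma sum13E : \sum_(k < 13) y ^+ k = 1 + y + y ^+ 2 + y ^+ 3 + y ^+ 4 + y ^+ 5
  + y ^+ 6 + y ^+ 7 + y ^+ 8 + y ^+ 9 + y ^+ 10 + y ^+ 11 + y ^+ 12.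
Proof. by rewrite !big_ord_recr big_ord0 /= expr0 expr1 add0r. Qed.

(** Multiplication by [m] permutes the exponents modulo 13. The ring is arbitrary because the roots
    of unity also occur as constant polynomials. *)
Lemma sum13_exp (m : nat) : ~~ (13 %| m)%N -> \sum_(k < 13) (y ^+ m) ^+ k = 0.
Proof.
rewrite -(expr_mod _ y13) /dvdn.
have : (m %% 13 < 13)%N by rewrite ltn_mod.
move: yS; rewrite sum13E => yS'.
case: (m %% 13)%N => [//|r] rlt _; rewrite -[RHS]yS' !big_ord_recr big_ord0 /=.
by do 12 (case: r rlt => [_|r rlt]; first by ring: y13).
Qed.

(** Parseval's identity on Z/13: orthogonality keeps the pairs with [i + j = 0]. It turns the sum of
    squares of the images of [G0] into the pairing of [G_i] with [G_(13-i)]; the reduction modulo 13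
    sends [i = 0] to itself. *)
Lemma sum13_sqr (c : 'I_13 -> A) :
  \sum_(k < 13) (\sum_(i < 13) c i * (y ^+ k) ^+ i) ^+ 2 =
  13 * \sum_(i < 13) c i * c (inord ((13 - i) %% 13)).
Proof.
under eq_bigr do rewrite expr2 big_distrlr /=.
rewrite exchange_big /= mulr_sumr; apply: eq_bigr => i _.
rewrite exchange_big /=; set j0 := inord _.
have ej (j : 'I_13) : (13 %| i + j)%N = (j == j0).
  rewrite -val_eqE /= inordK ?ltn_mod //.
  have := ltn_ord i; have := ltn_ord j; lia.
rewrite (bigD1 j0) //= [X in _ + X]big1 ?addr0 => [|j jj].
  under eq_bigr => k _.
    rewrite (_ : _ * _ = c i * c j0); first over.
    rewrite mulrACA -exprD -!exprM mulnC exprM.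
    have : (13 %| i + j0)%N by rewrite ej.
    by move=> /dvdnP[m ->]; rewrite mulnC exprM y13 !expr1n mulr1.
  by rewrite sumr_const card_ord -[LHS]mulr_natl.
under eq_bigr do rewrite mulrACA -exprD -exprM mulnC exprM.
by rewrite -mulr_sumr sum13_exp ?mulr0 // ej.
Qed.

End RootOfUnity.

Section WeilMatrices.
Variables (K : fieldType) (z g : K).

(** With [p_i] the points [H_pts], the entries of [S_exp] are [- p_i p_j] and those of [T_exp] are
    [p_i ^ 2 / 2] modulo 13: [S] is the Fourier transform on odd functions and [T] the
    multiplication by a quadratic character, as in the Weil representation. *)
Definition S_exp : seq (seq nat) :=
  [:: [:: 12; 10;  4; 5; 2; 6];
      [:: 10;  4; 12; 2; 6; 5];
      [::  4; 12; 10; 6; 5; 2];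
      [::  5;  2;  6; 1; 3; 9];
      [::  2;  6;  5; 3; 9; 1];
      [::  6;  5;  2; 9; 1; 3]]%N.
Definition T_exp : seq nat := [:: 7; 11; 8; 6; 2; 5]%N.

Definition Smx : 'M[K]_6 := - (1 / g) *:
  mx_of_rows 6 [seq [seq z ^+ e - z ^+ (13 - e) | e <- r] | r <- S_exp].

Definition Tmx (y : K) : 'M[K]_6 := diag_mx (\row_i y ^+ nth 0%N T_exp i).

(* The i-th coordinate is the value at H_pts_i of an odd function on Z/13, and
   Hmx a is the operator f |-> (a/13) f (a _). *)
Definition H_pts : seq nat := [:: 1; 3; 9; 8; 11; 7]%N.
Definition H_img (a i : nat) : nat := ((a * nth 0 H_pts i) %% 13)%N.
Definition H_idx (a i : nat) : nat :=
  let r := H_img a i in index (if r \in H_pts then r else (13 - r)%N) H_pts.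
Definition H_sgn (a i : nat) : bool :=
  (H_img a i \in H_pts) (+) (a \in [:: 1; 3; 4; 9; 10; 12]%N).

Definition Hmx (a : nat) : 'M[K]_6 :=
  \matrix_(i, j) ((-1) ^+ H_sgn a i *+ (H_idx a i == j)).

Definition ford (k : nat) : 'I_6 := inord k.

Lemma H_idx_lt a i : (0 < a < 13)%N -> (i < 6)%N -> (H_idx a i < 6)%N.
Proof.
move=> /andP[a0 a13] i6.
have : all (fun a => all (fun i => H_idx a i < 6)%N (iota 0 6)) (iota 1 12) by [].
move=> /allP/(_ a); rewrite mem_iota a0 => /(_ a13)/allP/(_ i).
by rewrite mem_iota; apply.
Qed.

Lemma Hmx_mul a m (M : 'M[K]_(6, m)) i j : (0 < a < 13)%N ->
  (Hmx a *m M) i j = (-1) ^+ H_sgn a i * M (ford (H_idx a i)) j.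
Proof.
move=> ha; have hi := H_idx_lt ha (ltn_ord i).
rewrite mxE (bigD1 (ford (H_idx a i))) //= mxE inordK // eqxx.
rewrite big1 ?addr0 // => k kn; rewrite mxE; case: eqP => [e|_].
  by case/eqP: kn; apply: val_inj; rewrite /= inordK.
by rewrite mul0r.
Qed.

Lemma Tmx_mul m (M : 'M[K]_(6, m)) y i j :
  (Tmx y *m M) i j = y ^+ nth 0%N T_exp i * M i j.
Proof. by rewrite mul_diag_mx !mxE. Qed.

Lemma mul_Tmx m (M : 'M[K]_(m, 6)) y i j :
  (M *m Tmx y) i j = M i j * y ^+ nth 0%N T_exp j.
Proof. by rewrite mul_mx_diag !mxE. Qed.

(** Integral combinations of powers of [z] as lists of pairs (coefficient, exponent), on which the
    relations between matrices are decided by [vm_compute]. *)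
Definition cyc := seq (int * nat).
Definition ev (l : cyc) : K := \sum_(p <- l) p.1%:~R * z ^+ p.2.
Definition cmul (l1 l2 : cyc) : cyc :=
  [seq (x.1 * y.1, (x.2 + y.2)%N) | x <- l1, y <- l2].
Definition copp (l : cyc) : cyc := [seq (- x.1, x.2) | x <- l].
Definition ccoef (l : cyc) (e : nat) : int :=
  foldr (fun p c => if (p.2 %% 13)%N == e then p.1 + c else c) 0 l.
(** Equal coefficients, rather than zero ones, since the sum of the 13 powers of [z] vanishes. *)
Definition czero (l : cyc) : bool :=
  all (fun e => ccoef l e == ccoef l 0) (iota 0 13).

Lemma ev_cat l1 l2 : ev (l1 ++ l2) = ev l1 + ev l2.
Proof. exact: big_cat. Qed.
Lemma ev_mul l1 l2 : ev (cmul l1 l2) = ev l1 * ev l2.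
Proof.
rewrite /ev big_allpairs_dep /= big_distrl /=; apply: eq_bigr => x _.
rewrite big_distrr /=; apply: eq_bigr => y _.
by rewrite intrM exprD; ring.
Qed.
Lemma ev_opp l : ev (copp l) = - ev l.
Proof.
rewrite /ev big_map /= -sumrN; apply: eq_bigr => x _.
by rewrite intrN mulNr.
Qed.
Lemma ev_flatten (f : nat -> cyc) n :
  ev (flatten [seq f k | k <- iota 0 n]) = \sum_(k < n) ev (f k).
Proof.
rewrite -(big_mkord xpredT (fun k => ev (f k))) /index_iota subn0.
elim: (iota 0 n) => [|k s IH]; first by rewrite big_nil /ev big_nil.
by rewrite /= ev_cat big_cons IH.
Qed.
Lemma ev_sgn b (e : nat) : ev [:: ((-1) ^+ b, e)] = (-1) ^+ b * z ^+ e.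
Proof. by rewrite /ev big_seq1 /= rmorphXn /= intrN. Qed.

Hypotheses (z13 : z ^+ 13 = 1) (zS : \sum_(k < 13) z ^+ k = 0).

Lemma ev_eq0 l : czero l -> ev l = 0.
Proof.
have evE : ev l = \sum_(e < 13) (ccoef l e)%:~R * z ^+ e.
  elim: l => [|p l IH].
    by rewrite /ev big_nil big1 // => e _; rewrite mul0r.
  rewrite /ev big_cons -/(ev l) IH /= -(expr_mod _ z13).
  have r13 : (p.2 %% 13 < 13)%N by rewrite ltn_mod.
  rewrite (bigD1 (Ordinal r13)) //= [in RHS](bigD1 (Ordinal r13)) //= eqxx.
  rewrite intrD mulrDl addrA; congr (_ + _); apply: eq_bigr => e en.
  by case: eqP => // ee; case/eqP: en; apply: val_inj.
move=> /allP h; rewrite evE.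
under eq_bigr => e _ do rewrite (eqP (h e _)) ?mem_iota //=.
by rewrite -mulr_sumr zS mulr0.
Qed.

Lemma ev_eq l1 l2 : czero (l1 ++ copp l2) -> ev l1 = ev l2.
Proof.
by move=> /ev_eq0/eqP; rewrite ev_cat ev_opp subr_eq0 => /eqP.
Qed.

(** The quadratic Gauss sum, the sum of [z ^ (x ^ 2)] over [x] modulo 13: each nonzero square has
    two roots. *)
Definition gauss : cyc :=
  [:: (1, 0%N) & [seq (2, e) | e <- [:: 1; 3; 4; 9; 10; 12]%N]].
Hypotheses (gE : g = ev gauss) (nz13 : 13 != 0 :> K).

Lemma gauss_sqr : g ^+ 2 = 13.
Proof.
rewrite expr2 gE -ev_mul.
rewrite (@ev_eq _ [:: (13, 0%N)]); last by vm_compute.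
by rewrite /ev big_seq1 expr0 mulr1.
Qed.

Lemma gauss_neq0 : g != 0.
Proof. by apply: contra_neq nz13 => g0; rewrite -gauss_sqr g0 expr0n. Qed.
Let g0 := gauss_neq0.

Definition all6 (P : nat -> nat -> bool) : bool :=
  all (fun i => all (P i) (iota 0 6)) (iota 0 6).

Lemma all6P P : all6 P -> forall i j : 'I_6, P i j.
Proof.
move=> h i j; move: (allP h i); rewrite mem_iota ltn_ord => /(_ isT)/allP/(_ j).
by rewrite mem_iota ltn_ord; apply.
Qed.

Definition sg (i j : nat) : cyc :=
  let e := nth 0%N (nth [::] S_exp i) j in [:: (-1, e); (1, (13 - e)%N)].

Lemma SmxE (i j : 'I_6) : Smx i j = g^-1 * ev (sg i j).
Proof.
rewrite !mxE (nth_map [::]) ?ltn_ord //.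
rewrite (nth_map 0%N); last first.
  exact: (@all6P (fun i j => j < size (nth [::] S_exp i))%N isT).
by rewrite /ev big_cons big_seq1 /=; field.
Qed.

Lemma Hmx1 : Hmx 1 = 1%:M.
Proof.
apply/matrixP=> i j; rewrite !mxE.
have := @all6P (fun i j => (H_sgn 1 i == false) && (H_idx 1 i == i)) isT i j.
by move=> /andP[/eqP-> /eqP->]; rewrite expr0.
Qed.

(** 12 is -1, which is a square modulo 13, and the coordinates are values of odd functions. *)
Lemma Hmx12 : Hmx 12 = (-1)%:M.
Proof.
apply/matrixP=> i j; rewrite !mxE.
have := @all6P (fun i j => (H_sgn 12 i == true) && (H_idx 12 i == i)) isT i j.
by move=> /andP[/eqP-> /eqP->]; rewrite expr1.
Qed.

Lemma all12P (P : nat -> bool) : all P (iota 1 12) ->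
  forall a, (0 < a < 13)%N -> P a.
Proof. by move=> /allP h a /andP[a0 a1]; apply: h; rewrite mem_iota a0. Qed.

Lemma HmxM a b : (0 < a < 13)%N -> (0 < b < 13)%N ->
  Hmx a *m Hmx b = Hmx ((a * b) %% 13).
Proof.
move=> ha hb; apply/matrixP=> i j; rewrite Hmx_mul // !mxE inordK ?H_idx_lt //.
pose P a b i (j : nat) := (H_sgn a i (+) H_sgn b (H_idx a i) ==
  H_sgn ((a * b) %% 13) i) && (H_idx b (H_idx a i) == H_idx ((a * b) %% 13) i).
have PT : all (fun a => all (fun b => all6 (P a b)) (iota 1 12)) (iota 1 12).
  by vm_compute.
have /andP[/eqP <- /eqP->] := all6P (all12P (all12P PT ha) hb) i j.
by rewrite signr_addb mulrnAr.
Qed.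

Lemma HTmx a (x y : nat) : (0 < a < 13)%N -> y = a * a * x %[mod 13] ->
  Hmx a *m Tmx (z ^+ x) = Tmx (z ^+ y) *m Hmx a.
Proof.
move=> ha e; apply/matrixP=> i j; rewrite mul_Tmx Tmx_mul mulrC !mxE.
case: eqP => [ej|]; last by rewrite mulr0n !mulr0.
congr (_ * _); rewrite -!exprM -[LHS](expr_mod _ z13) -[RHS](expr_mod _ z13).
congr (_ ^+ _); rewrite -ej.
pose P a i (j : nat) := (nth 0 T_exp (H_idx a i) ==
  a * a * nth 0 T_exp i %[mod 13])%N.
have PT : all (fun a => all6 (P a)) (iota 1 12) by vm_compute.
have /eqP h := all6P (all12P PT ha) i j.
rewrite -modnMmr h modnMmr -[RHS]modnMml e modnMml; congr (_ %% _)%N.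
by rewrite mulnCA mulnA mulnC mulnA.
Qed.

(** The inverse as the power [a ^ 11], by Fermat, in a form that computes on natural numbers. *)
Definition inv13 (a : nat) : nat := iter 11 (fun r => (r * a) %% 13)%N 1%N.

Lemma inv13_lt a : (0 < a < 13)%N -> (0 < inv13 a < 13)%N.
Proof. by move=> ha; apply: (@all12P (fun a => (0 < inv13 a < 13)%N)) => //; vm_compute. Qed.

Lemma SHmx a : (0 < a < 13)%N -> Smx *m Hmx a = Hmx (inv13 a) *m Smx.
Proof.
move=> ha; apply/matrixP=> i j; rewrite Hmx_mul ?inv13_lt //.
rewrite SmxE inordK ?H_idx_lt ?inv13_lt // mulrCA mxE.
pose f (a i j k : nat) : cyc :=
  if H_idx a k == j then cmul (sg i k) [:: ((-1) ^+ H_sgn a k, 0%N)] else [::].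
have -> : \sum_k Smx i k * Hmx a k j =
    g^-1 * ev (flatten [seq f a i j k | k <- iota 0 6]).
  rewrite ev_flatten mulr_sumr; apply: eq_bigr => k _.
  rewrite SmxE mxE -mulrA /f; congr (_ * _); case: eqP => _.
    by rewrite ev_mul ev_sgn expr0 mulr1.
  by rewrite mulr0n mulr0 /ev big_nil.
congr (_ * _); rewrite -[(-1) ^+ _]mulr1 -[1](expr0 z) -ev_sgn -ev_mul.
pose P a i j := czero (flatten [seq f a i j k | k <- iota 0 6] ++
  copp (cmul [:: ((-1) ^+ H_sgn (inv13 a) i, 0%N)] (sg (H_idx (inv13 a) i) j))).
have PT : all (fun a => all6 (P a)) (iota 1 12) by vm_compute.
by apply: ev_eq; apply: (all6P (all12P PT ha) i j).
Qed.

Lemma SSmx : Smx *m Smx = Hmx 12.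
Proof.
apply/matrixP=> i j; rewrite Hmx12 !mxE.
pose f (i j k : nat) := cmul (sg i k) (sg k j).
have -> : \sum_k Smx i k * Smx k j =
    (g ^+ 2)^-1 * ev (flatten [seq f i j k | k <- iota 0 6]).
  rewrite ev_flatten mulr_sumr; apply: eq_bigr => k _.
  by rewrite !SmxE ev_mul; field.
apply: (canLR (mulKf _)); first by rewrite expf_neq0.
rewrite gauss_sqr -[13]mulr1 -[in RHS](expr0 z).
transitivity (ev [:: (13 * - (i == j)%:Z, 0%N)]); last first.
  rewrite /ev big_seq1 expr0 !mulr1 intrM intrN /=.
  by case: eqP => _ /=; rewrite ?mulr0n ?mulr1n ?oppr0 ?mulr0.
pose P (i j : nat) := czero (flatten [seq f i j k | k <- iota 0 6] ++
  copp [:: (13 * - (i == j)%:Z, 0%N)]).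
have PT : all6 P by vm_compute.
by apply: ev_eq; rewrite -val_eqE; apply: (all6P PT i j).
Qed.

(** The image of an identity between matrices of SL(2): completing the square in the sum over the
    middle index produces a Gauss sum. The factor [gauss] in [h] brings both sides over the
    denominator [g ^+ 2]. *)
Lemma STSmx (k l : nat) : (0 < k < 13)%N -> l = (13 - inv13 k)%N ->
  Smx *m Tmx (z ^+ k) *m Smx =
  Tmx (z ^+ l) *m Hmx (inv13 k) *m Smx *m Tmx (z ^+ l).
Proof.
move=> hk ->; have hi := inv13_lt hk.
pose f (k i j l : nat) := cmul (cmul (sg i l) [:: (1, (k * nth 0 T_exp l)%N)]) (sg l j).
pose h (k i j : nat) := let l := (13 - inv13 k)%N in
  cmul gauss (cmul [:: ((-1) ^+ H_sgn (inv13 k) i,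
     (l * nth 0 T_exp i + l * nth 0 T_exp j)%N)] (sg (H_idx (inv13 k) i) j)).
apply/matrixP=> i j; rewrite mul_Tmx -!mulmxA Tmx_mul Hmx_mul // SmxE.
rewrite inordK ?H_idx_lt // mulmxA mxE.
have -> : \sum_l (Smx *m Tmx (z ^+ k)) i l * Smx l j =
    (g ^+ 2)^-1 * ev (flatten [seq f k i j l | l <- iota 0 6]).
  rewrite ev_flatten mulr_sumr; apply: eq_bigr => m _.
  rewrite mul_Tmx !SmxE !ev_mul /ev big_seq1 /= mul1r -exprM; field.
  exact: g0.
transitivity ((g ^+ 2)^-1 * ev (h k i j)).
  pose P k i j := czero (flatten [seq f k i j l | l <- iota 0 6] ++ copp (h k i j)).
  have PT : all (fun k => all6 (P k)) (iota 1 12) by vm_compute.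
  by congr (_ * _); apply: ev_eq; apply: (all6P (all12P PT hk) i j).
rewrite !ev_mul ev_sgn -gE exprD -!exprM; field.
exact: g0.
Qed.

End WeilMatrices.

(** Models [x |-> -1/x] on the projective line over ['F_13]: [p] is the value at infinity, exchanged
    with the value at 0. *)
Lemma sum_F13_negV (A : comNzRingType) (f f' : 'F_13 -> A) (p p' : A) :
  p' = f 0 -> f' 0 = p -> (forall x, x != 0 -> f' x = f (- x^-1)) ->
  p' ^+ 2 + \sum_x f' x ^+ 2 = p ^+ 2 + \sum_x f x ^+ 2.
Proof.
move=> p'E f'0 f'E; rewrite (bigD1 0) //= [in RHS](bigD1 0) //= f'0 p'E addrCA.
congr (_ + (_ + _)).
have inj : injective (fun x : 'F_13 => - x^-1) by move=> x y /oppr_inj/invr_inj.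
rewrite [RHS](reindex_inj inj) /=; apply: eq_big => [x|x x0].
  by rewrite oppr_eq0 invr_eq0.
by rewrite f'E.
Qed.

(** * Linear substitutions, degrees and invariance of the forms *)

Module FormsTheory.
Import mpoly Forms.

Section FormsTheory.
Variable K : fieldType.
Implicit Types (M N : 'M[K]_6) (p : {mpoly K[6]}).

Definition lin M (i : 'I_6) : {mpoly K[6]} := \sum_(j < 6) M i j *: 'X_j.

Lemma subst_mxE M p : subst_mx M p = p \mPo [tuple lin M i | i < 6].
Proof. by []. Qed.

Lemma subst_mxX M i : subst_mx M 'X_i = lin M i.
Proof. by rewrite subst_mxE comp_mpolyXU -tnth_nth tnth_mktuple. Qed.

Lemma subst_mxD M : {morph subst_mx M : p q / p + q}.
Proof. exact: comp_mpolyD. Qed.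
Lemma subst_mxN M : {morph subst_mx M : p / - p}.
Proof. exact: comp_mpolyN. Qed.
Lemma subst_mxM M : {morph subst_mx M : p q / p * q}.
Proof. by move=> p q; rewrite !subst_mxE rmorphM. Qed.
Lemma subst_mxXn M n : {morph subst_mx M : p / p ^+ n}.
Proof. by move=> p; rewrite !subst_mxE rmorphXn. Qed.
Lemma subst_mx_nat M n : subst_mx M n%:R = n%:R.
Proof. by rewrite subst_mxE rmorph_nat. Qed.
Lemma subst_mxZ M c p : subst_mx M (c *: p) = c *: subst_mx M p.
Proof. exact: comp_mpolyZ. Qed.
Lemma subst_mx_sum M (I : finType) (F : I -> {mpoly K[6]}) :
  subst_mx M (\sum_i F i) = \sum_i subst_mx M (F i).
Proof. by rewrite subst_mxE raddf_sum. Qed.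

Definition subst_mxm M :=
  (subst_mxD M, subst_mxN M, subst_mxM M, subst_mxXn M, subst_mx_nat M).

(** Substitution is a right action, whence the order of the product. It suffices to check it on
    linear forms, a polynomial being the sum of its monomials. *)
Lemma subst_mx_mul M N p : subst_mx N (subst_mx M p) = subst_mx (M *m N) p.
Proof.
have linM i : subst_mx N (lin M i) = lin (M *m N) i.
  rewrite subst_mx_sum /lin; under eq_bigr do rewrite subst_mxZ subst_mxX /lin scaler_sumr.
  rewrite exchange_big; apply: eq_bigr => j _.
  by rewrite mxE scaler_suml; apply: eq_bigr => k _; rewrite scalerA.
rewrite !subst_mxE (comp_mpolyEX p) raddf_sum (comp_mpolyEX p) /=.
apply: eq_bigr => m _; rewrite comp_mpolyZ !comp_mpolyX rmorph_prod; congr (_ *: _).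
by apply: eq_bigr => i _; rewrite rmorphXn /= !tnth_mktuple -subst_mxE linM.
Qed.

Lemma invariant_mul M N p :
  invariant_under M p -> invariant_under N p -> invariant_under (M *m N) p.
Proof. by rewrite /invariant_under -subst_mx_mul => -> ->. Qed.

Lemma homog_nat n : homogeneous 0 (n%:R : {mpoly K[6]}).
Proof.
rewrite /homogeneous; elim: n => [|n IH]; first exact: dhomog0.
by rewrite mulrSr; apply: dhomogD => //; apply: dhomog1.
Qed.

Lemma homogM d e f (p q : {mpoly K[6]}) : homogeneous d p -> homogeneous e q ->
  f = (d + e)%N -> homogeneous f (p * q).
Proof. by move=> hp hq ->; apply: dhomogM. Qed.

Lemma homogXn d e n (p : {mpoly K[6]}) : homogeneous d p -> e = (d * n)%N ->
  homogeneous e (p ^+ n).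
Proof. by move=> hp ->; apply: dhomogMn. Qed.

Lemma homogD d (p q : {mpoly K[6]}) : homogeneous d p -> homogeneous d q ->
  homogeneous d (p + q).
Proof. exact: dhomogD. Qed.

Lemma homogN d (p : {mpoly K[6]}) : homogeneous d p -> homogeneous d (- p).
Proof. by rewrite /homogeneous rpredN. Qed.

Lemma homogX i : homogeneous 1 ('X_i : {mpoly K[6]}).
Proof. by rewrite /homogeneous dhomogX /= mdeg1. Qed.

(** Reads the degree off the syntax; the last clause serves the forms [G0] to [G12]. *)
Ltac homdeg p := lazymatch p with
  | ?a * ?b => let d := homdeg a in let e := homdeg b in constr:((d + e)%N)
  | ?a ^+ ?n => let d := homdeg a in constr:((d * n)%N)
  | ?a + ?b => homdeg a
  | - ?a => homdeg a
  | _%:R => constr:(0%N)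
  | z1 _ => constr:(1%N)
  | z2 _ => constr:(1%N)
  | z3 _ => constr:(1%N)
  | z4 _ => constr:(1%N)
  | z5 _ => constr:(1%N)
  | z6 _ => constr:(1%N)
  | D0 _ => constr:(3%N)
  | Doo _ => constr:(3%N)
  | D1 _ => constr:(3%N)
  | D2 _ => constr:(3%N)
  | D3 _ => constr:(3%N)
  | D4 _ => constr:(3%N)
  | D5 _ => constr:(3%N)
  | D6 _ => constr:(3%N)
  | D7 _ => constr:(3%N)
  | D8 _ => constr:(3%N)
  | D9 _ => constr:(3%N)
  | D10 _ => constr:(3%N)
  | D11 _ => constr:(3%N)
  | D12 _ => constr:(3%N)
  | _ => constr:(6%N)
  end.
Ltac hom := lazymatch goal with
  | |- is_true (homogeneous _ (?a * ?b)) =>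
    let d := homdeg a in let e := homdeg b in
    apply: (@homogM d e); [hom | hom | by []]
  | |- is_true (homogeneous _ (?a ^+ ?n)) =>
    let d := homdeg a in apply: (@homogXn d); [hom | by []]
  | |- is_true (homogeneous _ (_ + _)) => apply: homogD; hom
  | |- is_true (homogeneous _ (- _)) => apply: homogN; hom
  | |- is_true (homogeneous _ _%:R) => exact: homog_nat
  | _ => first [exact: homogX | eauto with hforms]
  end.
Lemma D0_homog : homogeneous 3 (D0 K).
Proof. by rewrite /D0; hom. Qed.
Lemma Doo_homog : homogeneous 3 (Doo K).
Proof. by rewrite /Doo; hom. Qed.
Lemma D1_homog : homogeneous 3 (D1 K).
Proof. by rewrite /D1; hom. Qed.
Lemma D2_homog : homogeneous 3 (D2 K).
Proof. by rewrite /D2; hom. Qed.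
Lemma D3_homog : homogeneous 3 (D3 K).
Proof. by rewrite /D3; hom. Qed.
Lemma D4_homog : homogeneous 3 (D4 K).
Proof. by rewrite /D4; hom. Qed.
Lemma D5_homog : homogeneous 3 (D5 K).
Proof. by rewrite /D5; hom. Qed.
Lemma D6_homog : homogeneous 3 (D6 K).
Proof. by rewrite /D6; hom. Qed.
Lemma D7_homog : homogeneous 3 (D7 K).
Proof. by rewrite /D7; hom. Qed.
Lemma D8_homog : homogeneous 3 (D8 K).
Proof. by rewrite /D8; hom. Qed.
Lemma D9_homog : homogeneous 3 (D9 K).
Proof. by rewrite /D9; hom. Qed.
Lemma D10_homog : homogeneous 3 (D10 K).
Proof. by rewrite /D10; hom. Qed.
Lemma D11_homog : homogeneous 3 (D11 K).
Proof. by rewrite /D11; hom. Qed.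
Lemma D12_homog : homogeneous 3 (D12 K).
Proof. by rewrite /D12; hom. Qed.
Local Hint Resolve D0_homog Doo_homog D1_homog D2_homog D3_homog D4_homog D5_homog D6_homog D7_homog D8_homog D9_homog D10_homog D11_homog D12_homog : hforms.
Lemma G0_homog : homogeneous 6 (G0 K).
Proof. by rewrite /G0; hom. Qed.
Lemma G1_homog : homogeneous 6 (G1 K).
Proof. by rewrite /G1; hom. Qed.
Lemma G2_homog : homogeneous 6 (G2 K).
Proof. by rewrite /G2; hom. Qed.
Lemma G3_homog : homogeneous 6 (G3 K).
Proof. by rewrite /G3; hom. Qed.
Lemma G4_homog : homogeneous 6 (G4 K).
Proof. by rewrite /G4; hom. Qed.
Lemma G5_homog : homogeneous 6 (G5 K).
Proof. by rewrite /G5; hom. Qed.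
Lemma G6_homog : homogeneous 6 (G6 K).
Proof. by rewrite /G6; hom. Qed.
Lemma G7_homog : homogeneous 6 (G7 K).
Proof. by rewrite /G7; hom. Qed.
Lemma G8_homog : homogeneous 6 (G8 K).
Proof. by rewrite /G8; hom. Qed.
Lemma G9_homog : homogeneous 6 (G9 K).
Proof. by rewrite /G9; hom. Qed.
Lemma G10_homog : homogeneous 6 (G10 K).
Proof. by rewrite /G10; hom. Qed.
Lemma G11_homog : homogeneous 6 (G11 K).
Proof. by rewrite /G11; hom. Qed.
Lemma G12_homog : homogeneous 6 (G12 K).
Proof. by rewrite /G12; hom. Qed.
Local Hint Resolve G0_homog G1_homog G2_homog G3_homog G4_homog G5_homog G6_homog G7_homog G8_homog G9_homog G10_homog G11_homog G12_homog : hforms.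

Lemma Phi12_homog : homogeneous 12 (Phi12 K).
Proof.
rewrite /Phi12 -mul_mpolyC; apply: (@homogM 0 12); [|by hom|by []].
by rewrite -[_%:MP]mulr1 mul_mpolyC; apply: dhomogZ; apply: dhomog1.
Qed.

Lemma lin_Tmx (y : K) i : lin (Tmx y) i = (y%:MP) ^+ nth 0%N T_exp i * 'X_i.
Proof.
rewrite /lin (bigD1 i) //= big1 ?addr0 => [|j ji].
  by rewrite !mxE eqxx mulr1n -rmorphXn /= mul_mpolyC.
by rewrite !mxE eq_sym (negbTE ji) mulr0n scale0r.
Qed.

Definition zs (k : nat) : {mpoly K[6]} :=
  nth 0 [:: z1 K; z2 K; z3 K; z4 K; z5 K; z6 K] k.

Lemma zsE (i : 'I_6) : 'X_i = zs i.
Proof. by case: i => [[|[|[|[|[|[|//]]]]]] i6]; congr 'X_(_); apply: val_inj. Qed.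

Lemma lin_Hmx a (i : 'I_6) : (0 < a < 13)%N ->
  lin (Hmx K a) i = (-1) ^+ H_sgn a i * zs (H_idx a i).
Proof.
move=> ha; have hi := H_idx_lt ha (ltn_ord i).
rewrite /lin (bigD1 (ford (H_idx a i))) //= big1 ?addr0 => [|j ji].
  rewrite mxE inordK // eqxx mulr1n zsE inordK //.
  by rewrite -mul_mpolyC rmorphXn /= rmorphN1.
rewrite mxE; case: eqP => [e|_]; last by rewrite mulr0n scale0r.
by case/eqP: ji; apply: val_inj; rewrite /= inordK.
Qed.

(** The coordinates of [D0] sit at the points 1, 3, 9 and those of [Doo] at 8 times these. Up to
    sign, multiplication by [a] therefore preserves [D0] and [Doo] or exchanges them. *)
Lemma G0_Hmx a : (0 < a < 13)%N -> invariant_under (Hmx K a) (G0 K).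
Proof.
move=> ha; rewrite /invariant_under /G0 /D0 /Doo !subst_mxm.
rewrite /z1 /z2 /z3 /z4 /z5 /z6 !subst_mxX !lin_Hmx // !zsE /=.
by move: a ha; case=> [//|]; do 12 (case=> [_|]; first by rewrite /zs /H_idx /H_sgn /H_img /=; ring); case.
Qed.

(** [Hmx a] is a signed permutation of the coordinates, and the square absorbs the sign. *)
Lemma coord_prod_sq_Hmx a : (0 < a < 13)%N ->
  invariant_under (Hmx K a) (coord_prod_sq K).
Proof.
move=> ha; rewrite /invariant_under /coord_prod_sq !subst_mxm.
rewrite /z1 /z2 /z3 /z4 /z5 /z6 !subst_mxX !lin_Hmx // !zsE /=.
by move: a ha; case=> [//|]; do 12 (case=> [_|]; first by rewrite /zs /H_idx /H_sgn /H_img /=; ring); case.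
Qed.

Section Diagonal.
Variable y : K.
Hypothesis y13 : y ^+ 13 = 1.
Let Y := y%:MP_[6].
Lemma Y13 : Y ^+ 13 = 1. Proof. by rewrite -rmorphXn /= y13. Qed.

Ltac diag := rewrite !subst_mxm /z1 /z2 /z3 /z4 /z5 /z6 !subst_mxX !lin_Tmx /= -/Y;
  ring: Y13.
Ltac diag1 := match goal with |- subst_mx _ ?d = _ => rewrite /d; diag end.

(** The exponents of [T] add up to 39, a multiple of 13. *)
Lemma coord_prod_sq_Tmx : invariant_under (Tmx y) (coord_prod_sq K).
Proof. by rewrite /invariant_under /coord_prod_sq; diag. Qed.
(** The subscript of each [D_k], and below of each [G_k], is its weight under [T] modulo 13; both
    [D0] and [Doo] have weight 0. *)
Lemma D0_Tmx : subst_mx (Tmx y) (D0 K) = Y ^+ 0 * D0 K.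
Proof. by rewrite /D0; diag. Qed.
Lemma Doo_Tmx : subst_mx (Tmx y) (Doo K) = Y ^+ 0 * Doo K.
Proof. by rewrite /Doo; diag. Qed.
Lemma D1_Tmx : subst_mx (Tmx y) (D1 K) = Y ^+ 1 * D1 K.
Proof. by rewrite /D1; diag. Qed.
Lemma D2_Tmx : subst_mx (Tmx y) (D2 K) = Y ^+ 2 * D2 K.
Proof. by rewrite /D2; diag. Qed.
Lemma D3_Tmx : subst_mx (Tmx y) (D3 K) = Y ^+ 3 * D3 K.
Proof. by rewrite /D3; diag. Qed.
Lemma D4_Tmx : subst_mx (Tmx y) (D4 K) = Y ^+ 4 * D4 K.
Proof. by rewrite /D4; diag. Qed.
Lemma D5_Tmx : subst_mx (Tmx y) (D5 K) = Y ^+ 5 * D5 K.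
Proof. by rewrite /D5; diag. Qed.
Lemma D6_Tmx : subst_mx (Tmx y) (D6 K) = Y ^+ 6 * D6 K.
Proof. by rewrite /D6; diag. Qed.
Lemma D7_Tmx : subst_mx (Tmx y) (D7 K) = Y ^+ 7 * D7 K.
Proof. by rewrite /D7; diag. Qed.
Lemma D8_Tmx : subst_mx (Tmx y) (D8 K) = Y ^+ 8 * D8 K.
Proof. by rewrite /D8; diag. Qed.
Lemma D9_Tmx : subst_mx (Tmx y) (D9 K) = Y ^+ 9 * D9 K.
Proof. by rewrite /D9; diag. Qed.
Lemma D10_Tmx : subst_mx (Tmx y) (D10 K) = Y ^+ 10 * D10 K.
Proof. by rewrite /D10; diag. Qed.
Lemma D11_Tmx : subst_mx (Tmx y) (D11 K) = Y ^+ 11 * D11 K.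
Proof. by rewrite /D11; diag. Qed.
Lemma D12_Tmx : subst_mx (Tmx y) (D12 K) = Y ^+ 12 * D12 K.
Proof. by rewrite /D12; diag. Qed.
(** The cubic forms are generalised first, so that [ring] treats them as atoms and never expands
    them in the coordinates. *)
Ltac gdiag := move: D0_Tmx Doo_Tmx D1_Tmx D2_Tmx D3_Tmx D4_Tmx D5_Tmx D6_Tmx D7_Tmx D8_Tmx D9_Tmx D10_Tmx D11_Tmx D12_Tmx;
  move: (D0 K) (Doo K) (D1 K) (D2 K) (D3 K) (D4 K) (D5 K) (D6 K) (D7 K) (D8 K) (D9 K) (D10 K) (D11 K) (D12 K);
  intros; rewrite !subst_mxm;
  repeat match goal with h : subst_mx _ ?d = _ |- context [subst_mx _ ?d] =>
    rewrite {}h end; ring: Y13.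
Lemma G0_Tmx : subst_mx (Tmx y) (G0 K) = Y ^+ 0 * G0 K.
Proof. by rewrite /G0; gdiag. Qed.
Lemma G1_Tmx : subst_mx (Tmx y) (G1 K) = Y ^+ 1 * G1 K.
Proof. by rewrite /G1; gdiag. Qed.
Lemma G2_Tmx : subst_mx (Tmx y) (G2 K) = Y ^+ 2 * G2 K.
Proof. by rewrite /G2; gdiag. Qed.
Lemma G3_Tmx : subst_mx (Tmx y) (G3 K) = Y ^+ 3 * G3 K.
Proof. by rewrite /G3; gdiag. Qed.
Lemma G4_Tmx : subst_mx (Tmx y) (G4 K) = Y ^+ 4 * G4 K.
Proof. by rewrite /G4; gdiag. Qed.
Lemma G5_Tmx : subst_mx (Tmx y) (G5 K) = Y ^+ 5 * G5 K.
Proof. by rewrite /G5; gdiag. Qed.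
Lemma G6_Tmx : subst_mx (Tmx y) (G6 K) = Y ^+ 6 * G6 K.
Proof. by rewrite /G6; gdiag. Qed.
Lemma G7_Tmx : subst_mx (Tmx y) (G7 K) = Y ^+ 7 * G7 K.
Proof. by rewrite /G7; gdiag. Qed.
Lemma G8_Tmx : subst_mx (Tmx y) (G8 K) = Y ^+ 8 * G8 K.
Proof. by rewrite /G8; gdiag. Qed.
Lemma G9_Tmx : subst_mx (Tmx y) (G9 K) = Y ^+ 9 * G9 K.
Proof. by rewrite /G9; gdiag. Qed.
Lemma G10_Tmx : subst_mx (Tmx y) (G10 K) = Y ^+ 10 * G10 K.
Proof. by rewrite /G10; gdiag. Qed.
Lemma G11_Tmx : subst_mx (Tmx y) (G11 K) = Y ^+ 11 * G11 K.
Proof. by rewrite /G11; gdiag. Qed.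
Lemma G12_Tmx : subst_mx (Tmx y) (G12 K) = Y ^+ 12 * G12 K.
Proof. by rewrite /G12; gdiag. Qed.
(** In every product [G_i * G_(13-i)] the weights add up to 13. *)
Lemma Phi12_Tmx : invariant_under (Tmx y) (Phi12 K).
Proof.
rewrite /invariant_under /Phi12 subst_mxZ; congr (_ *: _).
move: G0_Tmx G1_Tmx G2_Tmx G3_Tmx G4_Tmx G5_Tmx G6_Tmx G7_Tmx G8_Tmx G9_Tmx G10_Tmx G11_Tmx G12_Tmx.
move: (G0 K) (G1 K) (G2 K) (G3 K) (G4 K) (G5 K) (G6 K) (G7 K) (G8 K) (G9 K) (G10 K) (G11 K) (G12 K)
  => g0 g1 g2 g3 g4 g5 g6 g7 g8 g9 g10 g11 g12
  hg0 hg1 hg2 hg3 hg4 hg5 hg6 hg7 hg8 hg9 hg10 hg11 hg12.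
by rewrite !subst_mxm ?(hg0, hg1, hg2, hg3, hg4, hg5, hg6, hg7, hg8, hg9, hg10, hg11, hg12); ring: Y13.
Qed.
End Diagonal.

Section Transform.
Variables z g : K.
Hypotheses (z13 : z ^+ 13 = 1) (zS : \sum_(k < 13) z ^+ k = 0).
Hypotheses (gE : g = ev z gauss) (nz26 : 26 != 0 :> K).
Let Z := z%:MP_[6].
Let Gi := (g^-1)%:MP_[6].

Lemma nz13 : 13 != 0 :> K.
Proof. by apply: contra_neq nz26 => e; rewrite (natrM K 2 13) e mulr0. Qed.

Lemma Z13 : Z ^+ 13 = 1. Proof. exact: Y13. Qed.

Lemma Gi13 : 13 * Gi ^+ 2 = 1.
Proof.
rewrite -[13](rmorph_nat (@mpolyC 6 K)) -rmorphXn -rmorphM /= exprVn.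
by rewrite (gauss_sqr z13 zS gE) mulfV ?nz13.
Qed.

(** [d1] and [d2] are differences of Gaussian periods of three terms, attached to the cosets of {1,
    3, 9} in the units modulo 13. They carry all the dependence on [Z] in the transforms of [D0] and
    [Doo]. *)
Definition d1 : {mpoly K[6]} := Z ^+ 4 + Z ^+ 10 + Z ^+ 12 - Z - Z ^+ 3 - Z ^+ 9.
Definition d2 : {mpoly K[6]} :=
  Z ^+ 7 + Z ^+ 8 + Z ^+ 11 - Z ^+ 2 - Z ^+ 5 - Z ^+ 6.

Lemma d1_d2 : d2 ^+ 2 = - 13 - d1 ^+ 2.
Proof.
pose e1 := [seq (1 : int, e) | e <- [:: 4; 10; 12]%N]
  ++ [seq (-1 : int, e) | e <- [:: 1; 3; 9]%N].
pose e2 := [seq (1 : int, e) | e <- [:: 7; 8; 11]%N]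
  ++ [seq (-1 : int, e) | e <- [:: 2; 5; 6]%N].
have E1 : d1 = (ev z e1)%:MP.
  rewrite /ev !big_cons big_nil /= !rmorphD !rmorphM /= ?rmorphXn /= !mpolyCN.
  by rewrite /d1 -/Z; ring.
have E2 : d2 = (ev z e2)%:MP.
  rewrite /ev !big_cons big_nil /= !rmorphD !rmorphM /= ?rmorphXn /= !mpolyCN.
  by rewrite /d2 -/Z; ring.
have : ev z (cmul e1 e1 ++ cmul e2 e2) = -13.
  rewrite (@ev_eq _ z z13 zS _ [:: (-13, 0%N)]); last by vm_compute.
  by rewrite /ev big_seq1 expr0 mulr1.
rewrite ev_cat !ev_mul => /(congr1 (@mpolyC 6 K)).
rewrite rmorphD !rmorphM /= -E1 -E2 rmorphN rmorph_nat => e.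
by rewrite -e; ring.
Qed.

Lemma lin_Smx (i : 'I_6) : lin (Smx z g) i =
  Gi * \sum_(j < 6) (Z ^+ (13 - nth 0%N (nth [::] S_exp i) j)
                     - Z ^+ nth 0%N (nth [::] S_exp i) j) * zs j.
Proof.
rewrite /lin mulr_sumr; apply: eq_bigr => j _.
rewrite (SmxE z13 zS gE nz13) (zsE j) -mul_mpolyC mpolyCM mulrA; congr (_ * _ * _).
rewrite /ev big_cons big_seq1 /= mul1r mulN1r addrC.
by rewrite -!rmorphXn -rmorphB.
Qed.

Let X1 := D1 K + D3 K + D9 K.
Let X2 := D2 K + D5 K + D6 K.
Let X4 := D4 K + D10 K + D12 K.
Let X7 := D7 K + D8 K + D11 K.

Lemma D0_Smx : subst_mx (Smx z g) (D0 K) = Gi ^+ 3 *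
  ((2 * d1 - 3 * d2) * D0 K - (3 * d1 + 2 * d2) * Doo K + (d1 + d2) * X1
   + d1 * X2 + (d2 - d1) * X4 + d2 * X7).
Proof.
rewrite /X1 /X2 /X4 /X7 /D0 !subst_mxm /z1 /z2 /z3 !subst_mxX !lin_Smx.
rewrite !big_ord_recr !big_ord0 /= /zs /= /d1 /d2.
rewrite /Doo /D1 /D2 /D3 /D4 /D5 /D6 /D7 /D8 /D9 /D10 /D11 /D12.
rewrite /z1 /z2 /z3.
ring: Z13.
Qed.

Lemma Doo_Smx : subst_mx (Smx z g) (Doo K) = Gi ^+ 3 *
  (- (3 * d1 + 2 * d2) * D0 K - (2 * d1 - 3 * d2) * Doo K + (d1 - d2) * X1
   - d2 * X2 + (d1 + d2) * X4 + d1 * X7).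
Proof.
rewrite /X1 /X2 /X4 /X7 /Doo !subst_mxm /z4 /z5 /z6 !subst_mxX !lin_Smx.
rewrite !big_ord_recr !big_ord0 /= /zs /= /d1 /d2.
rewrite /D0 /D1 /D2 /D3 /D4 /D5 /D6 /D7 /D8 /D9 /D10 /D11 /D12.
rewrite /z4 /z5 /z6.
ring: Z13.
Qed.

Definition Gsum : {mpoly K[6]} := G1 K + G2 K + G3 K + G4 K + G5 K + G6 K
  + G7 K + G8 K + G9 K + G10 K + G11 K + G12 K.

(** The origin of the [G_k]: they are the components of weight [k] of the transform of [G0] by [S],
    multiplied by 169. Only [13 * Gi ^+ 2 = 1] and [d1_d2] enter. *)
Lemma G0_Smx : 169 * subst_mx (Smx z g) (G0 K) = - (13 * G0 K) + Gsum.
Proof.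
have e1 : 169 * Gi ^+ 6 * 13 = 1.
  by transitivity ((13 * Gi ^+ 2) ^+ 3); [ring|rewrite Gi13 expr1n].
rewrite -[RHS]mul1r -[X in _ = X * _]e1 /G0 subst_mxD !subst_mxXn D0_Smx Doo_Smx.
rewrite /Gsum /G0 /G1 /G2 /G3 /G4 /G5 /G6 /G7 /G8 /G9 /G10 /G11 /G12 /X1 /X2 /X4 /X7.
move: d1_d2; move: d1 d2 => a b ab.
move: (D0 K) (Doo K) (D1 K) (D2 K) (D3 K) (D4 K) (D5 K) (D6 K) (D7 K) (D8 K)
  (D9 K) (D10 K) (D11 K) (D12 K); intros.
ring: ab.
Qed.

(** The triangular matrices fix [G0], so its images are indexed by the projective line: [G0] stands
    at infinity and [E x] at the finite point [x]. *)
Let E (x : nat) := subst_mx (Smx z g *m Tmx (z ^+ x)) (G0 K).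

Let c (i : 'I_13) : {mpoly K[6]} := nth 0 [:: - (13 * G0 K); G1 K; G2 K; G3 K;
  G4 K; G5 K; G6 K; G7 K; G8 K; G9 K; G10 K; G11 K; G12 K] i.

Lemma EE x : 169 * E x = \sum_(i < 13) c i * (Z ^+ x) ^+ i.
Proof.
have zx : (z ^+ x) ^+ 13 = 1 by rewrite exprAC z13 expr1n.
rewrite /E -subst_mx_mul -(subst_mx_nat (Tmx (z ^+ x)) 169) -subst_mxM G0_Smx /Gsum.
rewrite !big_ord_recr big_ord0 /= /c /=.
move: (G0_Tmx zx) (G1_Tmx zx) (G2_Tmx zx) (G3_Tmx zx) (G4_Tmx zx) (G5_Tmx zx)
 (G6_Tmx zx) (G7_Tmx zx) (G8_Tmx zx) (G9_Tmx zx) (G10_Tmx zx) (G11_Tmx zx)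
 (G12_Tmx zx).
move: (G0 K) (G1 K) (G2 K) (G3 K) (G4 K) (G5 K) (G6 K) (G7 K) (G8 K) (G9 K)
  (G10 K) (G11 K) (G12 K); intros.
rewrite !subst_mxm.
repeat match goal with h : subst_mx _ ?d = _ |- context [subst_mx _ ?d] =>
    rewrite {}h end.
by rewrite rmorphXn /= -/Z; ring.
Qed.

(** [sum13_sqr] applied to [EE] gives the products [G_i G_(13-i)] the coefficient 26 and [G0 ^+ 2]
    the coefficient [169 ^ 2 + 13 * 169 = 26 * 7 * 13 ^ 2]; this explains the factor [7 * 13 ^ 2] of
    [Phi12]. *)
Lemma Phi12E : Phi12 K = (- (1 / 26 * 169 ^+ 2 / 26)) *:
  (G0 K ^+ 2 + \sum_(x : 'F_13) E x ^+ 2).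
Proof.
have ZS : \sum_(k < 13) Z ^+ k = 0.
  under eq_bigr do rewrite -rmorphXn.
  by rewrite -rmorph_sum zS rmorph0.
have S2 : 169 ^+ 2 * (\sum_(x < 13) E x ^+ 2) = 13 * (\sum_(i < 13) c i * c (inord ((13 - i) %% 13))).
  rewrite -(sum13_sqr Z13 ZS) mulr_sumr; apply: eq_bigr => x _.
  by rewrite -EE exprMn.
have -> : \sum_(x : 'F_13) E x ^+ 2 = \sum_(x < 13) E x ^+ 2 by [].
set V := \sum_(x < 13) _ in S2 *.
pose a := (1 / 26 : K)%:MP_[6].
have a26 : a * 26 = 1.
  by rewrite -[26](rmorph_nat (@mpolyC 6 K)) -rmorphM /= divfK.
have -> : (- (1 / 26 * 169 ^+ 2 / 26)) *: (G0 K ^+ 2 + V) =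
    - (a * a * 169 ^+ 2) * (G0 K ^+ 2 + V).
  rewrite -mul_mpolyC; congr (_ * _); rewrite rmorphN; congr (- _).
  rewrite -(rmorph_nat (@mpolyC 6 K) 169) -rmorphXn -!rmorphM /=.
  by congr (_%:MP); ring.
rewrite /Phi12 -mul_mpolyC rmorphN /= -/a.
rewrite -[X in X = _]mul1r -[X in X * _ = _]a26.
transitivity (- (a * a) * (26 * (7 * 13 ^+ 2 * G0 K ^+ 2 + G1 K * G12 K + G2 K * G11 K +
   G3 K * G10 K + G4 K * G9 K + G5 K * G8 K + G6 K * G7 K))); first by ring.
transitivity (- (a * a) * (169 ^+ 2 * (G0 K ^+ 2 + V))); last by ring.
congr (_ * _); rewrite [RHS]mulrDr S2.
rewrite !big_ord_recr big_ord0 /= /c !inordK //=.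
by move: (G0 K) (G1 K) (G2 K) (G3 K) (G4 K) (G5 K) (G6 K) (G7 K) (G8 K) (G9 K)
  (G10 K) (G11 K) (G12 K); intros; ring.
Qed.

Lemma G0_STmx x (M : 'M[K]_6) a : (0 < a < 13)%N ->
  subst_mx (Tmx (z ^+ x) *m Hmx K a *m M) (G0 K) = subst_mx M (G0 K).
Proof.
move=> ha; have zx : (z ^+ x) ^+ 13 = 1 by rewrite exprAC z13 expr1n.
by rewrite -!subst_mx_mul (G0_Tmx zx) expr0 mul1r (G0_Hmx ha).
Qed.

Lemma inv13E (x : 'F_13) : x != 0 -> inv13 x = x^-1 :> nat.
Proof.
by case: x => m mlt; do 13 (case: m mlt => [|m] mlt; first by []).
Qed.

(** [STSmx] writes [S T^x S] as a triangular matrix times [S T^(-1/x)], and the triangular factor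
    does not affect [G0]; thus [S] permutes the 14 squares like [x |-> -1/x]. *)
Lemma Phi12_Smx : invariant_under (Smx z g) (Phi12 K).
Proof.
have T0 : Tmx (z ^+ 0) = 1%:M.
  by apply/matrixP=> i j; rewrite !mxE expr0 expr1n.
rewrite /invariant_under Phi12E subst_mxZ subst_mxD subst_mxXn subst_mx_sum.
congr (_ *: _).
under eq_bigr do rewrite subst_mxXn.
apply: (sum_F13_negV (f := fun x => E x) (f' := fun x => subst_mx (Smx z g) (E x))).
- by rewrite /E T0 mulmx1.
- by rewrite /E T0 mulmx1 subst_mx_mul (SSmx z13 zS gE nz13) (@G0_Hmx 12).
move=> x x0; have hx : (0 < x < 13)%N by rewrite ltn_ord andbT lt0n.
rewrite /E subst_mx_mul (STSmx z13 zS gE nz13 hx (l := - x^-1)).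
  by rewrite -mulmxA G0_STmx //; exact: inv13_lt.
rewrite inv13E //= modn_small // ltn_subrL /=.
by rewrite -inv13E //; case/andP: (inv13_lt hx) => ->.
Qed.

End Transform.

(** * Fractional powers of q taken out of the forms *)

Section Scaled.
Variables u b1 b2 b3 b4 b5 b6 q : K.
(** Here [u] stands for [q^(1/104)]. After the substitution of [u^e_i b_i] for the coordinates, the
    exponents of [u] in one form agree modulo 104; a power of [u] is taken out and the rest is a
    polynomial in the [b_i] and [q], which makes sense at [q = 0] as well. The sign of the fourth
    coordinate is included. *)
Definition tD0 :=
  b1 * b2 * b3.
Definition tDoo :=
  - (b4 * b5 * b6).
Definition tD1 :=
  2 * b2 * b3 * b3 + b2 * b2 * b6 - b4 * b4 * b5 + q * b1 * b5 * b6.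
Definition tD2 :=
  - (b6 * b6 * b6) - q * b2 * b2 * b4 - 2 * q ^+ 2 * b2 * b5 * b5 - q ^+ 2 *
  b1 * b4 * b5 + 3 * q * b3 * b5 * b6.
Definition tD3 :=
  2 * q ^+ 2 * b1 * b2 * b2 + q ^+ 3 * b1 * b1 * b5 + b4 * b6 * b6 - q * b3
  * b4 * b5.
Definition tD4 :=
  - (q * b2 * b2 * b3) + q * b1 * b6 * b6 - 2 * b4 * b4 * b6 - q ^+ 2 * b1 *
  b3 * b5.
Definition tD5 :=
  b4 * b4 * b4 + q * b3 * b3 * b5 - 2 * b3 * b6 * b6 + q * b2 * b5 * b6 - 3
  * q * b1 * b4 * b6.
Definition tD6 :=
  - (q ^+ 2 * b5 * b5 * b5) + q ^+ 2 * b1 * b1 * b6 - 2 * q * b1 * b4 * b4 -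
  b3 * b4 * b6 - 3 * q * b2 * b4 * b5.
Definition tD7 :=
  - (q * b2 * b2 * b2) + b3 * b4 * b4 - q * b1 * b3 * b6 - 3 * q ^+ 2 * b1 *
  b2 * b5 - 2 * q ^+ 2 * b1 * b1 * b4.
Definition tD8 :=
  - (q ^+ 3 * b1 * b1 * b1) + b2 * b6 * b6 - q * b2 * b3 * b5 + 3 * q * b1 *
  b3 * b4 + 2 * b3 * b3 * b6.
Definition tD9 :=
  2 * q ^+ 2 * b1 * b1 * b3 - b3 * b3 * b4 - q * b5 * b5 * b6 - b2 * b4 *
  b6.
Definition tD10 :=
  - (q * b1 * b3 * b3) + b2 * b4 * b4 + 2 * q * b4 * b5 * b5 - q * b1 * b2 *
  b6.
Definition tD11 :=
  - (b3 * b3 * b3) + q ^+ 2 * b1 * b5 * b5 + q * b1 * b2 * b4 - 3 * b2 * b3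
  * b6 + 2 * q * b2 * b2 * b5.
Definition tD12 :=
  - (q ^+ 2 * b1 * b1 * b2) + q * b3 * b5 * b5 - 2 * b5 * b6 * b6 + b2 * b3
  * b4.
Definition tG0 :=
  q ^+ 2 * tD0 * tD0 + tDoo * tDoo.
Definition tG1 :=
  - (tD7 * tD7) + 2 * q ^+ 2 * tD0 * tD1 + 10 * q * tDoo * tD1 + 2 * tD2 *
  tD12 - 2 * tD3 * tD11 - 4 * tD4 * tD10 - 2 * tD9 * tD5.
Definition tG2 :=
  - (2 * q * tD1 * tD1) - 4 * q * tD0 * tD2 + 6 * tDoo * tD2 - 2 * tD4 *
  tD11 + 2 * tD5 * tD10 - 2 * tD6 * tD9 - 2 * tD7 * tD8.
Definition tG3 :=
  - (tD8 * tD8) + 2 * q * tD0 * tD3 + 10 * tDoo * tD3 + 2 * tD6 * tD10 - 2 *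
  tD9 * tD7 - 4 * tD12 * tD4 - 2 * tD1 * tD2.
Definition tG4 :=
  - (tD2 * tD2) + 10 * q ^+ 2 * tD0 * tD4 - 2 * q * tDoo * tD4 + 2 * q * tD5
  * tD12 - 2 * q * tD9 * tD8 - 4 * q * tD1 * tD3 - 2 * q * tD10 * tD7.
Definition tG5 :=
  - (2 * q * tD9 * tD9) - 4 * q ^+ 2 * tD0 * tD5 + 6 * q * tDoo * tD5 - 2 *
  q * tD10 * tD8 + 2 * q * tD6 * tD12 - 2 * tD2 * tD3 - 2 * q * tD11 * tD7.
Definition tG6 :=
  - (2 * tD3 * tD3) - 4 * q ^+ 2 * tD0 * tD6 + 6 * q * tDoo * tD6 - 2 * q *
  tD12 * tD7 + 2 * tD2 * tD4 - 2 * q * tD5 * tD1 - 2 * q * tD8 * tD11.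
Definition tG7 :=
  - (2 * q * tD10 * tD10) + 6 * q ^+ 2 * tD0 * tD7 + 4 * q * tDoo * tD7 - 2
  * q * tD1 * tD6 - 2 * tD2 * tD5 - 2 * q * tD8 * tD12 - 2 * q * tD9 * tD11.
Definition tG8 :=
  - (2 * tD4 * tD4) + 6 * q ^+ 2 * tD0 * tD8 + 4 * q * tDoo * tD8 - 2 * tD3
  * tD5 - 2 * tD6 * tD2 - 2 * q * tD11 * tD10 - 2 * q * tD1 * tD7.
Definition tG9 :=
  - (q * tD11 * tD11) + 2 * q ^+ 2 * tD0 * tD9 + 10 * q * tDoo * tD9 + 2 *
  tD5 * tD4 - 2 * q * tD1 * tD8 - 4 * q * tD10 * tD12 - 2 * tD3 * tD6.
Definition tG10 :=
  - (tD5 * tD5) + 10 * q ^+ 2 * tD0 * tD10 - 2 * q * tDoo * tD10 + 2 * tD6 *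
  tD4 - 2 * tD3 * tD7 - 4 * q * tD9 * tD1 - 2 * q * tD12 * tD11.
Definition tG11 :=
  - (2 * q * tD12 * tD12) + 6 * q ^+ 2 * tD0 * tD11 + 4 * q * tDoo * tD11 -
  2 * tD9 * tD2 - 2 * tD5 * tD6 - 2 * tD7 * tD4 - 2 * tD3 * tD8.
Definition tG12 :=
  - (tD6 * tD6) + 10 * q ^+ 2 * tD0 * tD12 - 2 * q * tDoo * tD12 + 2 * tD2 *
  tD10 - 2 * q * tD1 * tD11 - 4 * tD3 * tD9 - 2 * tD4 * tD8.
Definition Psi := - (1 / 26) * (7 * 169 * q ^+ 3 * tG0 ^+ 2 + q * (tG1 * tG12
  + tG2 * tG11 + tG3 * tG10) + tG4 * tG9 + tG5 * tG8 + tG6 * tG7).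

Hypothesis qE : q = u ^+ 104.
Variable v : 'I_6 -> K.
Hypotheses (v1 : v (@Ordinal 6 0 isT) = u ^+ 121 * b1)
  (v2 : v (@Ordinal 6 1 isT) = u ^+ 49 * b2)
  (v3 : v (@Ordinal 6 2 isT) = u ^+ 25 * b3)
  (v4 : v (@Ordinal 6 3 isT) = - (u ^+ 9 * b4))
  (v5 : v (@Ordinal 6 4 isT) = u ^+ 81 * b5)
  (v6 : v (@Ordinal 6 5 isT) = u * b6).

Let mevm := (mevalD v, mevalN v, mevalM v, rmorphXn (meval v), rmorph_nat (meval v)).
Ltac mz := rewrite !mevm /= /z1 /z2 /z3 /z4 /z5 /z6 !mevalXU ?(v1, v2, v3, v4, v5, v6).
Lemma ev_D0 : (D0 K).@[v] = u ^+ 195 * tD0.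
Proof. by rewrite /D0; mz; rewrite /tD0; ring. Qed.
Lemma ev_Doo : (Doo K).@[v] = u ^+ 91 * tDoo.
Proof. by rewrite /Doo; mz; rewrite /tDoo; ring. Qed.
Lemma ev_D1 : (D1 K).@[v] = u ^+ 99 * tD1.
Proof. by rewrite /D1; mz; rewrite /tD1 qE; ring. Qed.
Lemma ev_D2 : (D2 K).@[v] = u ^+ 3 * tD2.
Proof. by rewrite /D2; mz; rewrite /tD2 qE; ring. Qed.
Lemma ev_D3 : (D3 K).@[v] = u ^+ 11 * tD3.
Proof. by rewrite /D3; mz; rewrite /tD3 qE; ring. Qed.
Lemma ev_D4 : (D4 K).@[v] = u ^+ 19 * tD4.
Proof. by rewrite /D4; mz; rewrite /tD4 qE; ring. Qed.
Lemma ev_D5 : (D5 K).@[v] = u ^+ 27 * tD5.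
Proof. by rewrite /D5; mz; rewrite /tD5 qE; ring. Qed.
Lemma ev_D6 : (D6 K).@[v] = u ^+ 35 * tD6.
Proof. by rewrite /D6; mz; rewrite /tD6 qE; ring. Qed.
Lemma ev_D7 : (D7 K).@[v] = u ^+ 43 * tD7.
Proof. by rewrite /D7; mz; rewrite /tD7 qE; ring. Qed.
Lemma ev_D8 : (D8 K).@[v] = u ^+ 51 * tD8.
Proof. by rewrite /D8; mz; rewrite /tD8 qE; ring. Qed.
Lemma ev_D9 : (D9 K).@[v] = u ^+ 59 * tD9.
Proof. by rewrite /D9; mz; rewrite /tD9 qE; ring. Qed.
Lemma ev_D10 : (D10 K).@[v] = u ^+ 67 * tD10.
Proof. by rewrite /D10; mz; rewrite /tD10 qE; ring. Qed.
Lemma ev_D11 : (D11 K).@[v] = u ^+ 75 * tD11.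
Proof. by rewrite /D11; mz; rewrite /tD11 qE; ring. Qed.
Lemma ev_D12 : (D12 K).@[v] = u ^+ 83 * tD12.
Proof. by rewrite /D12; mz; rewrite /tD12 qE; ring. Qed.
Ltac mg := move: ev_D0 ev_Doo ev_D1 ev_D2 ev_D3 ev_D4 ev_D5 ev_D6 ev_D7 ev_D8 ev_D9 ev_D10 ev_D11 ev_D12;
  move: (D0 K) (Doo K) (D1 K) (D2 K) (D3 K) (D4 K) (D5 K) (D6 K) (D7 K) (D8 K) (D9 K) (D10 K) (D11 K) (D12 K); intros; rewrite !mevm /=;
  repeat match goal with h : meval _ ?d = _ |- context [meval _ ?d] =>
    rewrite {}h end.
Lemma ev_G0 : (G0 K).@[v] = u ^+ 182 * tG0.
Proof. by rewrite /G0; mg; rewrite /tG0 qE; ring. Qed.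
Lemma ev_G1 : (G1 K).@[v] = u ^+ 86 * tG1.
Proof. by rewrite /G1; mg; rewrite /tG1 qE; ring. Qed.
Lemma ev_G2 : (G2 K).@[v] = u ^+ 94 * tG2.
Proof. by rewrite /G2; mg; rewrite /tG2 qE; ring. Qed.
Lemma ev_G3 : (G3 K).@[v] = u ^+ 102 * tG3.
Proof. by rewrite /G3; mg; rewrite /tG3 qE; ring. Qed.
Lemma ev_G4 : (G4 K).@[v] = u ^+ 6 * tG4.
Proof. by rewrite /G4; mg; rewrite /tG4 qE; ring. Qed.
Lemma ev_G5 : (G5 K).@[v] = u ^+ 14 * tG5.
Proof. by rewrite /G5; mg; rewrite /tG5 qE; ring. Qed.
Lemma ev_G6 : (G6 K).@[v] = u ^+ 22 * tG6.
Proof. by rewrite /G6; mg; rewrite /tG6 qE; ring. Qed.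
Lemma ev_G7 : (G7 K).@[v] = u ^+ 30 * tG7.
Proof. by rewrite /G7; mg; rewrite /tG7 qE; ring. Qed.
Lemma ev_G8 : (G8 K).@[v] = u ^+ 38 * tG8.
Proof. by rewrite /G8; mg; rewrite /tG8 qE; ring. Qed.
Lemma ev_G9 : (G9 K).@[v] = u ^+ 46 * tG9.
Proof. by rewrite /G9; mg; rewrite /tG9 qE; ring. Qed.
Lemma ev_G10 : (G10 K).@[v] = u ^+ 54 * tG10.
Proof. by rewrite /G10; mg; rewrite /tG10 qE; ring. Qed.
Lemma ev_G11 : (G11 K).@[v] = u ^+ 62 * tG11.
Proof. by rewrite /G11; mg; rewrite /tG11 qE; ring. Qed.
Lemma ev_G12 : (G12 K).@[v] = u ^+ 70 * tG12.
Proof. by rewrite /G12; mg; rewrite /tG12 qE; ring. Qed.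
Lemma Phi12_scaled : eval v (Phi12 K) = u ^+ 52 * Psi.
Proof.
rewrite /eval /Phi12 mevalZ.
move: ev_G0 ev_G1 ev_G2 ev_G3 ev_G4 ev_G5 ev_G6 ev_G7 ev_G8 ev_G9 ev_G10 ev_G11 ev_G12.
move: (G0 K) (G1 K) (G2 K) (G3 K) (G4 K) (G5 K) (G6 K) (G7 K) (G8 K) (G9 K) (G10 K) (G11 K) (G12 K); intros; rewrite !mevm /=.
repeat match goal with h : meval _ ?d = _ |- context [meval _ ?d] =>
    rewrite {}h end.
by rewrite /Psi qE; ring.
Qed.

End Scaled.

Lemma eval_subst_mx M (v : 'I_6 -> K) p :
  eval v (subst_mx M p) = eval (fun i => \sum_(j < 6) M i j * v j) p.
Proof.
rewrite /eval /subst_mx comp_mpoly_meval; apply: meval_eq => i.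
rewrite tnth_mktuple raddf_sum; apply: eq_bigr => j _.
by rewrite /= mevalZ mevalXU.
Qed.

Lemma eval_homog d c (v : 'I_6 -> K) p : homogeneous d p ->
  eval (fun i => c * v i) p = c ^+ d * eval v p.
Proof.
move=> /dhomogP hp; rewrite /eval !mevalE mulr_sumr; apply: eq_big_seq => m /hp hm.
under eq_bigr do rewrite exprMn.
by rewrite big_split /= mulrCA prodrXr -mdegE hm.
Qed.

Lemma eval_ext (v w : 'I_6 -> K) p : v =1 w -> eval v p = eval w p.
Proof. exact: meval_eq. Qed.

(** The constant term in [q]; it matches that of the product for [eta^12]. *)
Lemma Psi_cusp : 26 != 0 :> K -> Psi 1 1 1 1 1 1 0 = 1 :> K.
Proof.
move=> h.
rewrite /Psi /tG0 /tG1 /tG2 /tG3 /tG4 /tG5 /tG6 /tG7 /tG8 /tG9 /tG10 /tG11 /tG12.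
rewrite /tD0 /tDoo /tD1 /tD2 /tD3 /tD4 /tD5 /tD6 /tD7 /tD8 /tD9 /tD10 /tD11 /tD12.
by field.
Qed.

Section Closed.
Variables (T : Type) (H : (T -> K) -> Prop).
Hypotheses (Hc : forall c, H (fun=> c))
  (HD : forall f g, H f -> H g -> H (fun w => f w + g w))
  (HM : forall f g, H f -> H g -> H (fun w => f w * g w))
  (HN : forall f, H f -> H (fun w => - f w)).
Variables b1 b2 b3 b4 b5 b6 q : T -> K.
Hypotheses (h1 : H b1) (h2 : H b2) (h3 : H b3) (h4 : H b4) (h5 : H b5)
  (h6 : H b6) (hq : H q).

(** Stated for an abstract class of functions, to be applied to holomorphic functions on the
    disc. *)
Lemma Psi_closed : H (fun w => Psi (b1 w) (b2 w) (b3 w) (b4 w) (b5 w) (b6 w) (q w)).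
Proof.
rewrite /Psi /tG0 /tG1 /tG2 /tG3 /tG4 /tG5 /tG6 /tG7 /tG8 /tG9 /tG10 /tG11 /tG12.
rewrite /tD0 /tDoo /tD1 /tD2 /tD3 /tD4 /tD5 /tD6 /tD7 /tD8 /tD9 /tD10 /tD11 /tD12.
do !first [exact: h1 | exact: h2 | exact: h3 | exact: h4 | exact: h5 | exact: h6 | exact: hq | exact: Hc | apply: HD | apply: HM | apply: HN].
Qed.
End Closed.

End FormsTheory.
End FormsTheory.

(** * Representations of SL(2,F) from the Bruhat decomposition *)

Section SL2Representation.
Variables (F : finFieldType) (K : fieldType) (n : nat).
Variables (S : 'M[K]_n) (T H : F -> 'M[K]_n).
Hypotheses (T0 : T 0 = 1%:M) (TD : forall x y, T x *m T y = T (x + y)).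
Hypotheses (H1 : H 1 = 1%:M)
  (HM : forall a b, a != 0 -> b != 0 -> H a *m H b = H (a * b)).
Hypothesis HT : forall a x, a != 0 -> H a *m T x = T (a ^+ 2 * x) *m H a.
Hypothesis SH : forall a, a != 0 -> S *m H a = H a^-1 *m S.
Hypothesis SS : S *m S = H (-1).
Hypothesis STS : forall x, x != 0 ->
  S *m T x *m S = T (- x^-1) *m H x^-1 *m S *m T (- x^-1).

(** The normal form of the matrix with rows [(a, b)] and [(c, d)]: [t(ab) h(a)] when [c = 0], and
    [t(a/c) h(1/c) s t(d/c)] otherwise. *)
Definition bruhat_mx (a b c d : F) : 'M[K]_n :=
  if c == 0 then T (a * b) *m H a
  else T (a / c) *m H c^-1 *m S *m T (d / c).

Definition bruhat_repr (g : {'GL_2[F]}) : 'M[K]_n :=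
  let M := GLval g in bruhat_mx (M 0 0) (M 0 1) (M 1 0) (M 1 1).

Lemma bruhat_reprE a b c d : a * d - b * c = 1 ->
  bruhat_repr (gl a b c d) = bruhat_mx a b c d.
Proof. by move=> h; rewrite /bruhat_repr glE // !mxE. Qed.

(** This and the next two lemmas treat right multiplication by one generator each; multiplicativity
    follows, the second factor being a word in the generators. *)
Lemma bruhat_mx_T a b c d x : a * d - b * c = 1 ->
  bruhat_mx a b c d *m T x = bruhat_mx a (a * x + b) c (c * x + d).
Proof.
move=> h; rewrite /bruhat_mx; case: eqP => [c0|/eqP c0].
  have a0 : a != 0.
    by apply: contra_eq_neq h => ->; rewrite c0 mul0r mulr0 subr0 eq_sym oner_neq0.
  by rewrite -mulmxA HT // mulmxA TD; congr (T _ *m _); ring.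
by rewrite -mulmxA TD; congr (_ *m T _); field.
Qed.

Lemma bruhat_mx_H a b c d l : a * d - b * c = 1 -> l != 0 ->
  bruhat_mx a b c d *m H l = bruhat_mx (a * l) (b / l) (c * l) (d / l).
Proof.
move=> h l0; rewrite /bruhat_mx mulf_eq0 (negbTE l0) orbF; case: eqP => [c0|/eqP c0].
  have a0 : a != 0.
    by apply: contra_eq_neq h => ->; rewrite c0 mul0r mulr0 subr0 eq_sym oner_neq0.
  by rewrite -mulmxA HM //; congr (T _ *m _); field.
have -> : d / c = l ^+ 2 * (d / l / (c * l)) by field; rewrite c0 l0.
rewrite -!mulmxA -HT // (mulmxA S) SH // !mulmxA -(mulmxA _ (H c^-1)) HM ?invr_neq0 //.
by rewrite -invfM; congr (T _ *m _ *m _ *m _); field; rewrite l0 c0.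
Qed.

Lemma bruhat_mx_S a b c d : a * d - b * c = 1 ->
  bruhat_mx a b c d *m S = bruhat_mx b (- a) d (- c).
Proof.
move=> h; rewrite /bruhat_mx; case: (eqVneq c 0) => [c0|c0].
  have ad : a * d = 1 by rewrite -h c0 mulr0 subr0.
  have a0 : a != 0.
    by apply: contra_eq_neq ad => ->; rewrite mul0r eq_sym oner_neq0.
  have -> : d = a^-1 by rewrite -[d](mulKf a0) ad mulr1.
  rewrite invr_eq0 (negbTE a0) c0 oppr0 mul0r T0 mulmx1 invrK.
  by rewrite mulrC.
case: (eqVneq d 0) => [d0|d0].
  have bE : b = - c^-1.
    by rewrite -[b](mulfK c0) -mulN1r -h d0 mulr0 sub0r opprK.
  rewrite d0 mul0r T0 mulmx1 -mulmxA SS -mulmxA HM ?invr_neq0 ?oppr_eq0 ?oner_neq0 //.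
  by rewrite mulrN1 -bE; congr (T _ *m _); rewrite bE; ring.
have dc0 : d / c != 0 by rewrite mulf_neq0 ?invr_neq0.
(* With [c] and [d] both nonzero a product [S T S] appears, the only place where [STS] is called
   for. *)
rewrite -!mulmxA (mulmxA S (T _)) STS // invf_div !mulmxA -[T (a / c) *m _ *m _]mulmxA.
rewrite HT ?invr_neq0 // !mulmxA TD -[_ *m H c^-1 *m _]mulmxA HM ?invr_neq0 //; last first.
  by rewrite mulf_neq0 ?invr_neq0.
congr (T _ *m H _ *m _ *m T _); last 2 first.
- by field; rewrite c0 d0.
- by field.
have -> : b = (a * d - 1) / c.
  by rewrite -h opprB addrC subrK mulfK.
by field; rewrite c0 d0.
Qed.

Lemma bruhat_mx_repr : mx_repr (SL2_group F) bruhat_repr.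
Proof.
have h1 : 1 * 1 - 0 * 0 = 1 :> F by ring.
split; first by rewrite -gl1 bruhat_reprE // /bruhat_mx eqxx mulr0 T0 H1 mulmx1.
move=> g g' /SL2P[a [b [c [d [h ->]]]]] /SL2P[a' [b' [c' [d' [h' ->]]]]].
rewrite glM // !bruhat_reprE //; last exact: det_mx2M.
rewrite [bruhat_mx a' _ _ _]/bruhat_mx; case: eqP => [c0|/eqP c0].
  have ad : a' * d' = 1 by rewrite -h' c0 mulr0 subr0.
  have a0 : a' != 0.
    by apply: contra_eq_neq ad => ->; rewrite mul0r eq_sym oner_neq0.
  have -> : d' = a'^-1 by rewrite -[d'](mulKf a0) ad mulr1.
  rewrite mulmxA bruhat_mx_T // bruhat_mx_H //; last by rewrite -h; ring.
  by rewrite c0; congr bruhat_mx; field.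
have c1 : c'^-1 != 0 by rewrite invr_neq0.
rewrite !mulmxA bruhat_mx_T // bruhat_mx_H //; last by rewrite -h; ring.
rewrite !invrK bruhat_mx_S; last by rewrite -h; field.
rewrite bruhat_mx_T; last by rewrite -h; field.
have -> : b' = (a' * d' - 1) / c' by rewrite -h' opprB addrC subrK mulfK.
by congr bruhat_mx; field.
Qed.

Lemma bruhat_repr_s : bruhat_repr (gl 0 (-1) 1 0) = S.
Proof.
rewrite bruhat_reprE; last by ring.
by rewrite /bruhat_mx oner_eq0 !mul0r T0 mul1mx mulmx1 invr1 H1 mul1mx.
Qed.

Lemma bruhat_repr_t x : bruhat_repr (gl 1 x 0 1) = T x.
Proof.
rewrite bruhat_reprE; last by ring.
by rewrite /bruhat_mx eqxx mul1r H1 mulmx1.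
Qed.

Lemma bruhat_repr_N1 : bruhat_repr (gl (-1) 0 0 (-1)) = H (-1).
Proof.
rewrite bruhat_reprE; last by ring.
by rewrite /bruhat_mx eqxx mulr0 T0 mul1mx.
Qed.

Lemma bruhat_repr_borel a b : a != 0 -> bruhat_repr (gl a b 0 a^-1) = T (a * b) *m H a.
Proof.
move=> a0; rewrite bruhat_reprE; last by rewrite mulr0 subr0 mulfV.
by rewrite /bruhat_mx eqxx.
Qed.

Lemma bruhat_repr_ind (P : 'M[K]_n -> Prop) :
  (forall x, P (T x)) -> (forall a, a != 0 -> P (H a)) -> P S ->
  (forall M N, P M -> P N -> P (M *m N)) ->
  forall g, g \in SL2 F -> P (bruhat_repr g).
Proof.
move=> PT PH PS PM g /SL2P[a [b [c [d [h ->]]]]]; rewrite bruhat_reprE //.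
rewrite /bruhat_mx; case: eqP => [c0|/eqP c0].
  apply: (PM _ _ (PT _)); apply: PH.
  by apply: contra_eq_neq h => ->; rewrite c0 mul0r mulr0 subr0 eq_sym oner_neq0.
have c1 : c^-1 != 0 by rewrite invr_neq0.
exact: (PM _ _ (PM _ _ (PM _ _ (PT _) (PH _ c1)) PS) (PT _)).
Qed.

End SL2Representation.

(** * The six-dimensional Weil representation of SL(2,13) *)

Section WeilRepresentation.
Variables (K : fieldType) (z g : K).
Hypotheses (z13 : z ^+ 13 = 1) (zS : \sum_(k < 13) z ^+ k = 0).
Hypotheses (gE : g = ev z gauss) (nz26 : 26 != 0 :> K).

Let nz13 : 13 != 0 :> K := FormsTheory.nz13 nz26.
Let T (x : 'F_13) := Tmx (z ^+ x).
Let H (a : 'F_13) := Hmx K a.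
Let S := Smx z g.

Lemma F13_lt (a : 'F_13) : a != 0 -> (0 < a < 13)%N.
Proof. by move=> a0; rewrite ltn_ord andbT lt0n. Qed.

Lemma weil_T0 : T 0 = 1%:M.
Proof. by apply/matrixP=> i j; rewrite !mxE expr0 expr1n. Qed.

Lemma weil_TD x y : T x *m T y = T (x + y).
Proof.
apply/matrixP=> i j; rewrite Tmx_mul !mxE mulrnAr; congr (_ *+ _).
rewrite -exprMn; congr (_ ^+ _); rewrite -exprD -[LHS](expr_mod _ z13).
by congr (_ ^+ _).
Qed.

Lemma weil_HM a b : a != 0 -> b != 0 -> H a *m H b = H (a * b).
Proof. by move=> /F13_lt a0 /F13_lt b0; rewrite /H HmxM. Qed.

Lemma weil_HT a x : a != 0 -> H a *m T x = T (a ^+ 2 * x) *m H a.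
Proof.
move=> /F13_lt a0; apply: HTmx => //=.
by rewrite modn_mod modnMml.
Qed.

Lemma weil_SH a : a != 0 -> S *m H a = H a^-1 *m S.
Proof. by move=> a0; rewrite /S /H SHmx ?F13_lt // FormsTheory.inv13E. Qed.

Lemma weil_SS : S *m S = H (-1).
Proof. exact: SSmx. Qed.

Lemma weil_STS x : x != 0 ->
  S *m T x *m S = T (- x^-1) *m H x^-1 *m S *m T (- x^-1).
Proof.
move=> x0; rewrite /H -FormsTheory.inv13E //; apply: STSmx => //; first exact: F13_lt.
rewrite FormsTheory.inv13E //= modn_small // ltn_subrL /=.
by rewrite -FormsTheory.inv13E //; case/andP: (inv13_lt (F13_lt x0)) => ->.
Qed.

Let weil_mx := bruhat_repr S T H.

Lemma weil_repr : mx_repr SL2_13_group weil_mx.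
Proof.
apply: bruhat_mx_repr; [exact: weil_T0|exact: weil_TD|exact: Hmx1|exact: weil_HM|
  exact: weil_HT|exact: weil_SH|exact: weil_SS|exact: weil_STS].
Qed.

Lemma invariant_T p (x : 'F_13) :
  (forall y : K, y ^+ 13 = 1 -> Forms.invariant_under (Tmx y) p) ->
  Forms.invariant_under (T x) p.
Proof. by move=> h; apply: h; rewrite exprAC z13 expr1n. Qed.

(* The relation S T^x S = ... writes the torus in terms of S and T. *)
Lemma Phi12_H (a : 'F_13) : a != 0 ->
  Forms.invariant_under (H a) (Forms.Phi12 K).
Proof.
move=> a0; have iT x : Forms.invariant_under (T x) (Forms.Phi12 K).
  by apply: invariant_T => y; exact: FormsTheory.Phi12_Tmx.
have iS : Forms.invariant_under S (Forms.Phi12 K) by exact: FormsTheory.Phi12_Smx.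
have -> : H a = T a *m (S *m T a^-1 *m S) *m T a *m (S *m S *m S).
  rewrite weil_STS ?invr_eq0 // invrK !mulmxA weil_TD subrr weil_T0 mul1mx.
  rewrite -(mulmxA _ (T (- a))) weil_TD addNr weil_T0 mulmx1.
  rewrite -(mulmxA (H a) S S) weil_SS -(mulmxA _ S S) weil_SS -mulmxA weil_HM //.
  by rewrite mulrNN mulr1 /H Hmx1 mulmx1.
have im := @FormsTheory.invariant_mul K.
exact: (im _ _ _ (im _ _ _ (im _ _ _ (iT a) (im _ _ _ (im _ _ _ iS (iT _)) iS))
  (iT a)) (im _ _ _ (im _ _ _ iS iS) iS)).
Qed.

Lemma weil_representation : exists rho : mx_representation K SL2_13 6,
  [/\ rho sl2_s = Smx z g /\ rho sl2_t = Tmx z,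
      forall g, g \in 'Z(SL2_13)%g -> is_scalar_mx (rho g),
      forall g, g \in SL2_13 -> Forms.invariant_under (rho g) (Forms.Phi12 K) &
      forall g, g \in borel_SL2_13 ->
        Forms.invariant_under (rho g) (Forms.coord_prod_sq K)].
Proof.
exists (MxRepresentation weil_repr); split=> /=.
- have -> : sl2_s = gl 0 (-1) 1 0 by apply: val_inj; rewrite [RHS]glE; [|ring].
  have -> : sl2_t = gl 1 1 0 1 by apply: val_inj; rewrite [RHS]glE; [|ring].
  split; first exact: (bruhat_repr_s _ weil_T0 (Hmx1 K)).
  by rewrite /weil_mx (bruhat_repr_t _ _ (Hmx1 K)) /T expr1.
- move=> x; rewrite [in X in X -> _](center_SL2 'F_13) !inE => /orP[]/eqP->.
    by rewrite (weil_repr.1) scalar_mx_is_scalar.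
  rewrite /weil_mx (bruhat_repr_N1 _ _ weil_T0).
  by rewrite /H [X in is_scalar_mx X](Hmx12 K) scalar_mx_is_scalar.
- apply: (bruhat_repr_ind (P := fun M => Forms.invariant_under M (Forms.Phi12 K))).
  + by move=> y; apply: invariant_T => y'; exact: FormsTheory.Phi12_Tmx.
  + exact: Phi12_H.
  + exact: FormsTheory.Phi12_Smx.
  + by move=> M N; exact: FormsTheory.invariant_mul.
- move=> x /(borel2P (F := 'F_13))[a [b [a0 ->]]].
  rewrite /weil_mx (bruhat_repr_borel _ _ _ _ a0); apply: FormsTheory.invariant_mul.
    by apply: invariant_T => y; exact: FormsTheory.coord_prod_sq_Tmx.
  by apply: FormsTheory.coord_prod_sq_Hmx; apply: F13_lt.
Qed.

End WeilRepresentation.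

From mathcomp Require Import lra.
From mathcomp Require Import all_classical all_reals all_analysis.
From mathcomp Require Import complex.

Import Order.TTheory.
Import numFieldNormedType.Exports.
Import Normc.
Local Open Scope classical_set_scope.
Local Open Scope ring_scope.
Local Open Scope complex_scope.

(** * Limits and holomorphic functions in the unit disc *)

Section ComplexNorm.
Variable R : realType.
Local Notation C := R[i].
Local Notation nc := (@normc R).
Implicit Types (x y w : C) (a b e r : R).

Lemma ncE x : `|x| = (nc x)%:C.
Proof. by rewrite normc_def; case: x. Qed.

Lemma nc_ge0 x : 0 <= nc x.
Proof. by case: x => a b; rewrite sqrtr_ge0. Qed.

Lemma nc_real a : nc a%:C = `|a|.
Proof. by rewrite /= expr0n addr0 sqrtr_sqr. Qed.

Lemma nc_nat n : nc n%:R = n%:R.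
Proof. by rewrite -(rmorph_nat (real_complex R)) nc_real ger0_norm. Qed.

Lemma ncD x y : nc (x + y) <= nc x + nc y.
Proof. by have := ler_normD x y; rewrite !ncE -rmorphD lecR. Qed.

Lemma nc_dist x y : nc (x - y) = nc (y - x).
Proof. by rewrite -normcN opprB. Qed.

Lemma ncB x y : nc (x - y) <= nc x + nc y.
Proof. by rewrite -(normcN y) ncD. Qed.

Lemma ncX x n : nc (x ^+ n) = nc x ^+ n.
Proof. by elim: n => [|n IH]; rewrite ?expr0 ?normc1 // !exprS normcM IH. Qed.

Lemma nc_sum (I : Type) (s : seq I) (P : pred I) (F : I -> C) :
  nc (\sum_(i <- s | P i) F i) <= \sum_(i <- s | P i) nc (F i).
Proof.
elim/big_rec2: _ => [|i a x _ h]; first by rewrite normc0.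
by rewrite (le_trans (ncD _ _)) // lerD2l.
Qed.

Lemma nc_eq0 x : (nc x == 0) = (x == 0).
Proof. by apply/eqP/eqP => [/eq0_normc|->] //; rewrite normc0. Qed.

Lemma nc_gt0 x : (0 < nc x) = (x != 0).
Proof. by rewrite lt_def nc_ge0 nc_eq0 andbT. Qed.

Lemma nc_sign n : nc ((-1) ^+ n) = 1.
Proof. by rewrite ncX normcN normc1 expr1n. Qed.

Lemma nc_le_sum x : nc x <= `|complex.Re x| + `|complex.Im x|.
Proof.
case: x => a b /=; rewrite -[X in _ <= X]ger0_norm ?addr_ge0 //.
rewrite -sqrtr_sqr ler_sqrt ?sqr_ge0 // sqrrD !real_normK ?num_real //.
by rewrite addrAC lerDl mulrn_wge0 // mulr_ge0.
Qed.

Lemma Re_le_nc x : `|complex.Re x| <= nc x.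
Proof.
case: x => a b /=; rewrite -sqrtr_sqr ler_sqrt ?addr_ge0 ?sqr_ge0 //.
by rewrite lerDl sqr_ge0.
Qed.

Lemma Im_le_nc x : `|complex.Im x| <= nc x.
Proof.
case: x => a b /=; rewrite -sqrtr_sqr ler_sqrt ?addr_ge0 ?sqr_ge0 //.
by rewrite lerDr sqr_ge0.
Qed.

Lemma eq_ler a b : a = b -> a <= b.
Proof. by move=> ->. Qed.

Lemma ler_eps a b : (forall e, 0 < e -> a <= b + e) -> a <= b.
Proof. by move=> h; apply/ler_addgt0Pr => e e0; apply: h. Qed.

Lemma exp_small a r : 0 <= r < 1 -> 0 < a -> exists n, r ^+ n < a.
Proof.
move=> /andP[r0 r1] a0.
have : (fun n => r ^+ n) @ \oo --> (0 : R) by apply: cvg_expr; rewrite ger0_norm.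
move=> /cvgrPdist_lt/(_ _ a0)[N _ h]; exists N.
by have := h N (leqnn N); rewrite /= sub0r normrN ger0_norm ?exprn_ge0.
Qed.

Lemma inv_small a : 0 < a -> exists n : nat, n.+1%:R^-1 < a.
Proof.
move=> a0; have := near_infty_natSinv_lt (PosNum a0); case=> N _ h.
by exists N; apply: h => /=.
Qed.

Lemma geom_sum r n : r != 1 -> \sum_(i < n) r ^+ i = (1 - r ^+ n) / (1 - r).
Proof.
move=> r1; have r0 : 1 - r != 0 by rewrite subr_eq0 eq_sym.
apply: (mulIf r0); rewrite divfK //.
by rewrite mulrC -[1 - r]opprB mulNr -subrX1 opprB.
Qed.

Lemma geom_sum_le r n : 0 <= r < 1 -> \sum_(i < n) r ^+ i <= (1 - r)^-1.
Proof.
move=> /andP[r0 r1]; rewrite geom_sum ?lt_eqF //.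
by rewrite ler_pdivrMr ?subr_gt0 // mulVf ?gt_eqF ?subr_gt0 // gerBl exprn_ge0.
Qed.

Lemma geom_tail_le r m n : 0 <= r < 1 -> \sum_(m <= i < n) r ^+ i <= r ^+ m / (1 - r).
Proof.
move=> r01; have /andP[r0 r1] := r01; have [mn|nm] := leqP m n; last first.
  by rewrite big_geq ?(ltnW nm) // divr_ge0 ?exprn_ge0 // subr_ge0 ltW.
rewrite -{1}[m]add0n big_addn big_mkord.
under eq_bigr do rewrite exprD mulrC.
by rewrite -mulr_sumr ler_wpM2l ?exprn_ge0 // geom_sum_le.
Qed.

(* Unlike the [cvg] of the library this notion has its epsilon in R. *)
Definition ctends (u : nat -> C) (l : C) := forall e, 0 < e ->
  exists N, forall n, (N <= n)%N -> nc (u n - l) <= e.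

Lemma ctends_lim u l : ctends u l ->
  lim ((u : nat -> (R[i] : numFieldType)) @ \oo) = l.
Proof.
move=> h; apply: cvg_lim => //; apply/cvgrPdist_le => e e0.
have eE : e = (complex.Re e)%:C.
  by move: e0; case: e => a b /=; rewrite ltcE /= => /andP[/eqP->].
have e0' : 0 < complex.Re e by move: e0; rewrite {1}eE ltcR.
have [N hN] := h _ e0'; exists N => // n /= /hN.
by rewrite eE ncE lecR nc_dist.
Qed.

Lemma ctends_unique u l l' : ctends u l -> ctends u l' -> l = l'.
Proof.
move=> h h'; apply/eqP; rewrite -subr_eq0 -nc_eq0 eq_le nc_ge0 andbT.
apply: ler_eps => e e0; have e2 : 0 < e / 2 by rewrite divr_gt0.
have [N hN] := h _ e2; have [N' hN'] := h' _ e2; pose n := maxn N N'.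
have := hN n (leq_maxl _ _); have := hN' n (leq_maxr _ _).
have -> : l - l' = (u n - l') - (u n - l) by ring.
by move=> h1 h2; rewrite add0r (le_trans (ncB _ _)) // [e]splitr lerD.
Qed.

Lemma ctends_eq u v l : (forall n, u n = v n) -> ctends u l -> ctends v l.
Proof. by move=> uv h e /h[N hN]; exists N => n /hN; rewrite uv. Qed.

Lemma ctends_cst l : ctends (fun=> l) l.
Proof. by move=> e e0; exists 0%N => n _; rewrite subrr normc0 ltW. Qed.

Lemma ctendsD u v l m : ctends u l -> ctends v m ->
  ctends (fun n => u n + v n) (l + m).
Proof.
move=> hu hv e e0; have e2 : 0 < e / 2 by rewrite divr_gt0.
have [N hN] := hu _ e2; have [N' hN'] := hv _ e2; exists (maxn N N') => n.
rewrite geq_max => /andP[/hN h1 /hN' h2]; rewrite opprD addrACA.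
by rewrite (le_trans (ncD _ _)) // [e]splitr lerD.
Qed.

Lemma ctendsMl c u l : ctends u l -> ctends (fun n => c * u n) (c * l).
Proof.
move=> hu e e0; have c0 : 0 < nc c + 1 by rewrite ltr_wpDl ?nc_ge0.
have [N hN] := hu _ (divr_gt0 e0 c0); exists N => n /hN h.
rewrite -mulrBr normcM (le_trans (ler_wpM2l (nc_ge0 _) h)) //.
rewrite mulrA ler_pdivrMr // [nc c * e]mulrC ler_wpM2l ?ltW //.
by rewrite ltrDl.
Qed.

Lemma ctends_bounded u l : ctends u l -> exists N B, forall n, (N <= n)%N -> nc (u n) <= B.
Proof.
move=> h; have [N hN] := h 1 ltr01; exists N, (1 + nc l) => n /hN h1.
by rewrite -(subrK l (u n)) (le_trans (ncD _ _)) // lerD2r.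
Qed.

Lemma ctendsM u v l m : ctends u l -> ctends v m ->
  ctends (fun n => u n * v n) (l * m).
Proof.
move=> hu hv e e0.
have [N0 [B hB]] := ctends_bounded hv; pose B' := `|B| + 1.
have B0 : 0 < B' by rewrite ltr_wpDl.
have l0 : 0 < nc l + 1 by rewrite ltr_wpDl ?nc_ge0.
have e2 : 0 < e / 2 by rewrite divr_gt0.
have [N1 h1] := hu _ (divr_gt0 e2 B0); have [N2 h2] := hv _ (divr_gt0 e2 l0).
exists (maxn N0 (maxn N1 N2)) => n; rewrite !geq_max => /and3P[/hB n0 /h1 n1 /h2 n2].
have -> : u n * v n - l * m = (u n - l) * v n + l * (v n - m) by ring.
rewrite (le_trans (ncD _ _)) // !normcM [e]splitr lerD //.
  rewrite -[X in _ <= X](@divfK _ B') ?gt_eqF // ler_pM ?nc_ge0 //.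
  by rewrite (le_trans n0) // (le_trans (ler_norm _)) // lerDl.
rewrite mulrC -[X in _ <= X](@divfK _ (nc l + 1)) ?gt_eqF // ler_pM ?nc_ge0 //.
by rewrite lerDl.
Qed.

Lemma ctends_prod (I : Type) (s : seq I) (u : I -> nat -> C) (l : I -> C) :
  (forall i, ctends (u i) (l i)) ->
  ctends (fun n => \prod_(i <- s) u i n) (\prod_(i <- s) l i).
Proof.
move=> h; elim: s => [|i s IH].
  by rewrite big_nil; apply: (ctends_eq _ (ctends_cst 1)) => n; rewrite big_nil.
rewrite big_cons; apply: (ctends_eq _ (ctendsM (h i) IH)) => n.
by rewrite big_cons.
Qed.

Lemma ctends_sum (I : Type) (s : seq I) (u : I -> nat -> C) (l : I -> C) :
  (forall i, ctends (u i) (l i)) ->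
  ctends (fun n => \sum_(i <- s) u i n) (\sum_(i <- s) l i).
Proof.
move=> h; elim: s => [|i s IH].
  by rewrite big_nil; apply: (ctends_eq _ (ctends_cst 0)) => n; rewrite big_nil.
rewrite big_cons; apply: (ctends_eq _ (ctendsD (h i) IH)) => n.
by rewrite big_cons.
Qed.

Lemma ctends_sub u l (k : nat -> nat) : (forall n, (n <= k n)%N) -> ctends u l ->
  ctends (fun n => u (k n)) l.
Proof.
move=> hk h e /h[N hN]; exists N => n Nn; apply: hN.
exact: leq_trans Nn (hk n).
Qed.

(** Nested intervals: [d n] is the full tail of the dominating series, so [u - d] increases, [u + d]
    decreases, and the supremum of the former is the limit. The explicit rate later gives uniform
    convergence on discs. *)
Lemma real_geo_cvg (u : nat -> R) B r : 0 <= B -> 0 <= r < 1 ->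
  (forall n, `|u n.+1 - u n| <= B * r ^+ n) ->
  exists l, forall n, `|u n - l| <= B * r ^+ n / (1 - r).
Proof.
move=> B0 /andP[r0 r1] hu; have r2 : 0 < 1 - r by rewrite subr_gt0.
pose d n := B * r ^+ n / (1 - r).
have dS n : d n = d n.+1 + B * r ^+ n.
  by rewrite /d exprS; field; rewrite subr_eq0 gt_eqF.
have d0 n : 0 <= d n by rewrite divr_ge0 ?mulr_ge0 ?exprn_ge0 // ltW.
pose v n := u n + d n; pose w n := u n - d n.
have vS n : v n.+1 <= v n.
  have /ler_normlP[_ h] := hu n; rewrite /v (dS n); lra.
have wS n : w n <= w n.+1.
  have /ler_normlP[h _] := hu n; rewrite /w (dS n); lra.
have vle n k : v (n + k)%N <= v n.
  by elim: k => [|k IH]; rewrite ?addn0 // addnS (le_trans (vS _)).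
have wle n k : w n <= w (n + k)%N.
  by elim: k => [|k IH]; rewrite ?addn0 // addnS (le_trans IH).
have wv n k : w n <= v k.
  apply: le_trans (wle n k) _; rewrite (le_trans _ (vle k n)) // addnC /w /v.
  by have := d0 (k + n)%N; lra.
pose A : set R := range w; exists (sup A) => n.
have Aub k : ubound A (v k) by move=> _ [m _ <-]; exact: wv.
have Asup : has_sup A by split; [exists (w 0%N), 0%N | exists (v 0%N)].
have h1 : w n <= sup A by apply: ub_le_sup; [case: Asup | exists n].
have h2 : sup A <= v n by apply: ge_sup; [case: Asup | exact: Aub].
by apply/ler_normlP; rewrite -/(d n); move: h1 h2; rewrite /w /v; split; lra.
Qed.

Lemma geo_cvg (u : nat -> C) B r : 0 <= B -> 0 <= r < 1 ->
  (forall n, nc (u n.+1 - u n) <= B * r ^+ n) ->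
  exists l, forall n, nc (u n - l) <= 2 * B / (1 - r) * r ^+ n.
Proof.
move=> B0 r01 hu.
have [n|a ha] := @real_geo_cvg (fun n => complex.Re (u n)) B r B0 r01.
  have -> : complex.Re (u n.+1) - complex.Re (u n) = complex.Re (u n.+1 - u n).
    by case: (u n.+1) (u n) => ? ? [].
  exact: le_trans (Re_le_nc _) (hu n).
have [n|b hb] := @real_geo_cvg (fun n => complex.Im (u n)) B r B0 r01.
  have -> : complex.Im (u n.+1) - complex.Im (u n) = complex.Im (u n.+1 - u n).
    by case: (u n.+1) (u n) => ? ? [].
  exact: le_trans (Im_le_nc _) (hu n).
exists (a +i* b) => n; rewrite (le_trans (nc_le_sum _)) //.
have -> : 2 * B / (1 - r) * r ^+ n = B * r ^+ n / (1 - r) + B * r ^+ n / (1 - r).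
  by ring.
by rewrite lerD //; [move: (ha n) | move: (hb n)]; case: (u n).
Qed.

Lemma geo_ctends u l B r : 0 <= r < 1 ->
  (forall n, nc (u n - l) <= B * r ^+ n) -> ctends u l.
Proof.
move=> r01 hu e e0; have /andP[r0 r1] := r01.
have B0 : 0 < `|B| + 1 by rewrite ltr_wpDl.
have [N hN] := exp_small r01 (divr_gt0 e0 B0); exists N => n Nn.
rewrite (le_trans (hu n)) // (@le_trans _ _ ((`|B| + 1) * r ^+ N)) //.
  apply: le_trans (_ : (`|B| + 1) * r ^+ n <= _).
    by rewrite ler_wpM2r ?exprn_ge0 // (le_trans (ler_norm _)) // lerDl.
  by apply: ler_wpM2l; [exact: ltW|apply: ler_wiXn2l => //; exact: ltW].
by rewrite mulrC -ler_pdivlMr // ltW.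
Qed.

(** Tannery's theorem, dominated convergence for series with a varying number of terms: a head of
    [n0] terms converges termwise, and the geometric bound controls both tails. *)
Lemma tannery (f : nat -> nat -> C) (g : nat -> C) (K : nat -> nat) N0 B r l :
  0 <= r < 1 ->
  (forall N n, (N0 <= N)%N -> (n < K N)%N -> nc (f N n) <= B * r ^+ n) ->
  (forall n, nc (g n) <= B * r ^+ n) ->
  (forall n, ctends (f ^~ n) (g n)) ->
  (forall N, (N <= K N)%N) ->
  ctends (fun n => \sum_(k < n) g k) l ->
  ctends (fun N => \sum_(n < K N) f N n) l.
Proof.
move=> r01 fB gB fg hK gl; have /andP[r0 r1] := r01.
have B0 : 0 <= B by have := gB 0%N; rewrite expr0 mulr1; apply: le_trans; exact: nc_ge0.
have r2 : 0 < 1 - r by rewrite subr_gt0.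
have gl' := ctends_sub hK gl.
suff h : ctends (fun N => \sum_(n < K N) (f N n - g n)) 0.
  rewrite -[l]add0r; apply: (ctends_eq _ (ctendsD h gl')) => N.
  by rewrite -big_split; apply: eq_bigr => n _ /=; rewrite subrK.
move=> e e0; have e2 : 0 < e / 2 by rewrite divr_gt0.
have c0 : 0 < 2 * B / (1 - r) + 1.
  by rewrite ltr_wpDl // divr_ge0 ?mulr_ge0 // ltW.
have [n0 hn0] := exp_small r01 (divr_gt0 e2 c0).
have hs : ctends (fun N => \sum_(n < n0) (f N n - g n)) 0.
  have := @ctends_sum _ (index_enum 'I_n0) (fun n N => f N n - g n) (fun n => g n - g n).
  rewrite [X in ctends _ X]big1 => [|i _]; last by rewrite subrr.
  by apply => n; exact: ctendsD (fg n) (ctends_cst _).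
have [N1 hN1] := hs _ e2; exists (maxn N0 (maxn n0 N1)) => N.
rewrite !geq_max => /and3P[NN0 Nn0 NN1]; have := hN1 N NN1; rewrite !subr0 => hs1.
rewrite -(big_mkord xpredT (fun n => f N n - g n)) (@big_cat_nat _ _ _ n0) //=; last first.
  exact: leq_trans Nn0 (hK N).
rewrite big_mkord (le_trans (ncD _ _)) // [e]splitr lerD //.
rewrite (le_trans (nc_sum _ _ _)) //.
apply: le_trans (_ : \sum_(n0 <= i < K N) 2 * B * r ^+ i <= _).
  rewrite big_nat_cond [X in _ <= X]big_nat_cond; apply: ler_sum => i /andP[/andP[_ ik] _].
  rewrite (le_trans (ncB _ _)) // -mulrA mulr2n mulrDl mul1r.
  by rewrite lerD ?gB ?fB.
rewrite -mulr_sumr (le_trans (ler_wpM2l _ (geom_tail_le _ _ r01))) ?mulr_ge0 //.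
rewrite [X in X <= _](_ : _ = 2 * B / (1 - r) * r ^+ n0); last by ring.
apply: le_trans (_ : (2 * B / (1 - r) + 1) * r ^+ n0 <= _).
  by rewrite ler_wpM2r ?exprn_ge0 // lerDl.
by rewrite mulrC -ler_pdivlMr // ltW.
Qed.

(* By Runge's theorem this is holomorphy on the unit disc; in this form neither
   derivatives nor contour integrals are needed. *)
Definition hol (f : C -> C) := forall r e, 0 <= r < 1 -> 0 < e ->
  exists p : {poly C}, forall w, nc w <= r -> nc (f w - p.[w]) <= e.

Lemma hol_ext f g : (forall w, nc w < 1 -> f w = g w) -> hol f -> hol g.
Proof.
move=> fg hf r e r01 e0; have [p hp] := hf r e r01 e0; exists p => w wr.
rewrite -fg ?hp //; apply: le_lt_trans wr _; by case/andP: r01.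
Qed.

Lemma hol_poly (p : {poly C}) : hol (horner p).
Proof. by move=> r e _ e0; exists p => w _; rewrite subrr normc0 ltW. Qed.

Lemma hol_cst c : hol (fun=> c).
Proof. by apply: (hol_ext _ (hol_poly c%:P)) => w _; rewrite hornerC. Qed.

Lemma hol_id : hol id.
Proof. by apply: (hol_ext _ (hol_poly 'X)) => w _; rewrite hornerX. Qed.

Lemma holD f g : hol f -> hol g -> hol (fun w => f w + g w).
Proof.
move=> hf hg r e r01 e0; have e2 : 0 < e / 2 by rewrite divr_gt0.
have [p hp] := hf _ _ r01 e2; have [q hq] := hg _ _ r01 e2.
exists (p + q) => w wr; rewrite hornerD opprD addrACA.
by rewrite (le_trans (ncD _ _)) // [e]splitr lerD ?hp ?hq.
Qed.

Lemma poly_bounded (p : {poly C}) r : 0 <= r ->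
  exists B, 0 <= B /\ forall w, nc w <= r -> nc p.[w] <= B.
Proof.
move=> r0; exists (\sum_(i < size p) nc p`_i * r ^+ i); split.
  by apply: sumr_ge0 => i _; rewrite mulr_ge0 ?nc_ge0 ?exprn_ge0.
move=> w wr; rewrite horner_coef (le_trans (nc_sum _ _ _)) //.
apply: ler_sum => i _; rewrite normcM ncX ler_wpM2l ?nc_ge0 //.
by rewrite lerXn2r ?nnegrE ?nc_ge0.
Qed.

Lemma hol_bounded f r : hol f -> 0 <= r < 1 ->
  exists B, 0 <= B /\ forall w, nc w <= r -> nc (f w) <= B.
Proof.
move=> hf r01; have [p hp] := hf _ _ r01 ltr01; have /andP[r0 _] := r01.
have [B [B0 hB]] := poly_bounded p r0; exists (1 + B); split; first by rewrite addr_ge0.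
move=> w wr; rewrite -(subrK p.[w] (f w)) (le_trans (ncD _ _)) // lerD ?hp ?hB //.
Qed.

(** Weierstrass' theorem, through which series, products and the exponential become holomorphic. *)
Lemma hol_lim f : (forall r e, 0 <= r < 1 -> 0 < e ->
  exists2 g, hol g & forall w, nc w <= r -> nc (f w - g w) <= e) -> hol f.
Proof.
move=> h r e r01 e0; have e2 : 0 < e / 2 by rewrite divr_gt0.
have [g hg fg] := h _ _ r01 e2; have [p hp] := hg _ _ r01 e2; exists p => w wr.
have -> : f w - p.[w] = (f w - g w) + (g w - p.[w]) by ring.
by rewrite (le_trans (ncD _ _)) // [e]splitr lerD ?hp ?fg.
Qed.

Lemma holM f g : hol f -> hol g -> hol (fun w => f w * g w).
Proof.
move=> hf hg r e r01 e0; have e2 : 0 < e / 2 by rewrite divr_gt0.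
have /andP[r0 _] := r01.
have [B [B0 hB]] := hol_bounded hg r01; have B1 : 0 < B + 1 by rewrite ltr_wpDl.
have [p hp] := hf _ _ r01 (divr_gt0 e2 B1).
have [D [D0 hD]] := poly_bounded p r0; have D1 : 0 < D + 1 by rewrite ltr_wpDl.
have [q hq] := hg _ _ r01 (divr_gt0 e2 D1).
exists (p * q) => w wr; rewrite hornerM.
have -> : f w * g w - p.[w] * q.[w] = (f w - p.[w]) * g w + p.[w] * (g w - q.[w]) by ring.
rewrite (le_trans (ncD _ _)) // !normcM [e]splitr lerD //.
  rewrite -[X in _ <= X](@divfK _ (B + 1)) ?gt_eqF // ler_pM ?nc_ge0 ?hp //.
  by rewrite (le_trans (hB _ wr)) // lerDl.
rewrite mulrC -[X in _ <= X](@divfK _ (D + 1)) ?gt_eqF // ler_pM ?nc_ge0 ?hq //.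
by rewrite (le_trans (hD _ wr)) // lerDl.
Qed.

Lemma holX f n : hol f -> hol (fun w => f w ^+ n).
Proof.
move=> hf; elim: n => [|n IH]; first exact: hol_cst.
by apply: (hol_ext _ (holM hf IH)) => w _; rewrite exprS.
Qed.

Lemma holN f : hol f -> hol (fun w => - f w).
Proof.
by move=> hf; apply: (hol_ext _ (holM (hol_cst (-1)) hf)) => w _; rewrite mulN1r.
Qed.

Lemma hol_sum (I : Type) (s : seq I) (F : I -> C -> C) :
  (forall i, hol (F i)) -> hol (fun w => \sum_(i <- s) F i w).
Proof.
move=> h; elim: s => [|i s IH].
  by apply: (hol_ext _ (hol_cst 0)) => w _; rewrite big_nil.
by apply: (hol_ext _ (holD (h i) IH)) => w _; rewrite big_cons.
Qed.

Lemma hol_prod (I : Type) (s : seq I) (F : I -> C -> C) :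
  (forall i, hol (F i)) -> hol (fun w => \prod_(i <- s) F i w).
Proof.
move=> h; elim: s => [|i s IH].
  by apply: (hol_ext _ (hol_cst 1)) => w _; rewrite big_nil.
by apply: (hol_ext _ (holM (h i) IH)) => w _; rewrite big_cons.
Qed.

(** The last hypothesis keeps the image of a closed subdisc inside another one, where [f] is
    uniformly close to a polynomial. *)
Lemma hol_comp f g : hol f -> hol g ->
  (forall r, 0 <= r < 1 -> exists2 r', 0 <= r' < 1 &
     forall w, nc w <= r -> nc (g w) <= r') ->
  hol (fun w => f (g w)).
Proof.
move=> hf hg gr; apply: hol_lim => r e r01 e0.
have [r' r'01 hr'] := gr _ r01; have [p hp] := hf _ _ r'01 e0.
exists (fun w => p.[g w]); last by move=> w wr; rewrite hp ?hr'.
apply: (@hol_ext (fun w => \sum_(i < size p) p`_i * g w ^+ i)) => [w _|].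
  by rewrite horner_coef.
by apply: hol_sum => i; apply: holM (hol_cst _) _; apply: holX.
Qed.

Lemma hol_opp f : hol f -> hol (fun w => f (- w)).
Proof.
move=> hf; apply: (hol_comp hf (holN hol_id)) => r r01.
by exists r => // w; rewrite normcN.
Qed.

Lemma hol_geom : hol (fun w => (1 - w)^-1).
Proof.
apply: hol_lim => r e r01 e0; have /andP[r0 r1] := r01.
have r2 : 0 < 1 - r by rewrite subr_gt0.
have [n hn] := exp_small r01 (mulr_gt0 e0 r2).
exists (fun w => \sum_(i < n) w ^+ i); first by apply: hol_sum => i; apply: holX hol_id.
move=> w wr; have w2 : 1 - r <= nc (1 - w).
  by rewrite lerBlDr -normc1 -{1}(subrK w 1) (le_trans (ncD _ _)) // lerD2l.
have w1 : 1 - w != 0 by rewrite -nc_gt0 (lt_le_trans r2).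
have -> : (1 - w)^-1 - \sum_(i < n) w ^+ i = w ^+ n / (1 - w).
  apply: (mulIf w1); rewrite mulrBl mulVf // divfK // [_ * (1 - w)]mulrC.
  by rewrite -[1 - w]opprB mulNr -subrX1; ring.
rewrite normcM normcV ncX ler_pdivrMr ?(lt_le_trans r2) //.
apply: le_trans (_ : r ^+ n <= _); first by rewrite lerXn2r ?nnegrE ?nc_ge0.
by rewrite (le_trans (ltW hn)) // ler_wpM2l // ltW.
Qed.

(** * The complex exponential and bounds for the cosine *)

Lemma ReD x y : complex.Re (x + y) = complex.Re x + complex.Re y.
Proof. by case: x y => ? ? []. Qed.
Lemma ImD x y : complex.Im (x + y) = complex.Im x + complex.Im y.
Proof. by case: x y => ? ? []. Qed.

Lemma cexpD x y : cexp (x + y) = cexp x * cexp y.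
Proof.
rewrite /cexp ReD ImD expRD cosD sinD rmorphM /=.
by case: x y => a b [c d] /=; apply/eqP; rewrite eq_complex /=; apply/andP; split; apply/eqP; ring.
Qed.

Lemma cexp0 : cexp (0 : C) = 1.
Proof. by rewrite /cexp /= expR0 cos0 sin0 mul1r. Qed.

Lemma cexpM_nat n x : cexp (n%:R * x) = cexp x ^+ n.
Proof.
elim: n => [|n IH]; first by rewrite mul0r cexp0.
by rewrite -natr1 mulrDl mul1r cexpD IH exprSr.
Qed.

Lemma nc_cexp x : nc (cexp x) = expR (complex.Re x).
Proof.
rewrite /cexp normcM nc_real ger0_norm ?expR_ge0 //=.
by rewrite cos2Dsin2 sqrtr1 mulr1.
Qed.

Lemma cexp_neq0 x : cexp x != 0.
Proof. by rewrite -nc_gt0 nc_cexp expR_gt0. Qed.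

Lemma deriv_ge0 (f df : R -> R) (T : R) :
  (forall t : R, is_derive t 1 f (df t)) -> f 0 = 0 ->
  (forall t : R, 0 <= t <= T -> 0 <= df t) -> 0 <= T -> 0 <= f T.
Proof.
move=> fd f0 dpos; rewrite le_eqVlt => /predU1P[<-|T0]; first by rewrite f0.
have fc : {within `[0, T], continuous f}.
  by apply: derivable_within_continuous => t _; exact: ex_derive.
have [c] := MVT T0 (fun c _ => fd c) fc; rewrite in_itv /= => /andP[c0 cT].
rewrite f0 !subr0 => ->; rewrite mulr_ge0 ?(ltW T0) // dpos //.
by rewrite !ltW.
Qed.

Lemma sin_le_id a : 0 <= a -> sin a <= a.
Proof.
move=> a0; rewrite -subr_ge0.
apply: (@deriv_ge0 (id \- sin) (fun t => 1 - cos t)) => //=.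
by rewrite sin0 subr0.
Qed.

Lemma sin_ge_cos a : 0 <= a <= pi -> a * cos a <= sin a.
Proof.
move=> /andP[a0 api]; rewrite -subr_ge0.
apply: (@deriv_ge0 (sin \- (id \* cos)) (fun t => t * sin t)) => //=.
- move=> t; apply: is_derive_eq.
  by rewrite /GRing.scale /= mulrN mulr1 opprD opprK addrCA subrr addr0.
- by rewrite sin0 mul0r subr0.
- move=> t /andP[t0 ta]; rewrite mulr_ge0 // sin_ge0_pi // t0 /=.
  exact: le_trans ta api.
Qed.

Lemma cos_half a : cos a = 1 - 2 * sin (a / 2) ^+ 2.
Proof.
have -> : cos a = cos ((a / 2) *+ 2) by congr cos; rewrite -mulr_natr divfK.
by rewrite cos_mulr2n cos2sin2; ring.
Qed.

Lemma sin_sqr_le a : sin a ^+ 2 <= a ^+ 2.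
Proof.
wlog a0 : a / 0 <= a => [h|].
  have [/h//|/ltW a0] := leP 0 a.
  by have := h (- a); rewrite sinN !sqrrN oppr_ge0; exact.
have [api|api] := leP a pi.
  by rewrite lerXn2r ?nnegrE ?sin_le_id // sin_ge0_pi ?a0.
apply: le_trans (_ : 1 <= _).
  by rewrite sin2cos2 gerBl sqr_ge0.
by rewrite expr_ge1 // (le_trans _ (ltW api)) // (le_trans _ (pi_ge2 R)) // ler1n.
Qed.

Lemma cos_ge a : 1 - a ^+ 2 / 2 <= cos a.
Proof.
rewrite cos_half lerD2l lerN2; have := sin_sqr_le (a / 2); rewrite expr_div_n.
by move=> h; lra.
Qed.

(** With [cos_ge] it determines the cosine to second order, enough for the limit of its powers. The
    coefficient 1/8 stems from [sin x >= x cos x] at the half angle. *)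
Lemma cos_le_small a : `|a| <= pi -> cos a <= 1 - a ^+ 2 / 2 + a ^+ 4 / 8.
Proof.
move=> api; rewrite cos_half.
have h1 : (a / 2) ^+ 2 * (1 - (a / 2) ^+ 2) <= sin (a / 2) ^+ 2.
  apply: le_trans (_ : (a / 2) ^+ 2 * cos (a / 2) ^+ 2 <= _).
    by rewrite ler_wpM2l ?sqr_ge0 // cos2sin2 lerD2l lerN2 sin_sqr_le.
  wlog a0 : a api / 0 <= a => [h|].
    have [/h//|/ltW a0] := leP 0 a; first exact.
    have := h (- a); rewrite mulNr cosN sinN !sqrrN normrN oppr_ge0 => h'.
    exact: h'.
  rewrite ger0_norm // in api; have p0 := pi_gt0 R.
  rewrite -exprMn lerXn2r ?nnegrE ?sin_ge_cos //.
  - by rewrite mulr_ge0 ?divr_ge0 // cos_ge0_pihalf //; lra.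
  - by rewrite sin_ge0_pi //; lra.
  - by lra.
have -> : a ^+ 4 = (a ^+ 2) ^+ 2 by rewrite -exprM.
move: h1; rewrite expr_div_n; move: (a ^+ 2) (sin _ ^+ 2) => x y; lra.
Qed.

(** Cruder than [cos_le_small], but a genuine Gaussian bound on the whole range: it supplies the
    domination of the powers of the cosine. *)
Lemma cos_le_dom a : `|a| <= pi / 2 -> cos a <= 1 - a ^+ 2 / 4.
Proof.
move=> api; rewrite cos_half; have p0 := pi_gt0 R.
have h1 : (a / 2) ^+ 2 / 2 <= sin (a / 2) ^+ 2.
  wlog a0 : a api / 0 <= a => [h|].
    have [/h//|/ltW a0] := leP 0 a; first exact.
    have := h (- a); rewrite mulNr sinN !sqrrN normrN oppr_ge0 => h'.
    exact: h'.
  rewrite ger0_norm // in api.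
  apply: le_trans (_ : (a / 2) ^+ 2 * cos (a / 2) ^+ 2 <= _).
    rewrite ler_wpM2l ?sqr_ge0 //.
    have : 0 <= cos ((a / 2) *+ 2).
      by rewrite -mulr_natr divfK // cos_ge0_pihalf //; lra.
    by rewrite cos_mulr2n -mulr_natr; lra.
  rewrite -exprMn lerXn2r ?nnegrE ?sin_ge_cos //.
  - by rewrite mulr_ge0 ?divr_ge0 // cos_ge0_pihalf //; lra.
  - by rewrite sin_ge0_pi //; lra.
  - by lra.
by move: h1; rewrite expr_div_n; lra.
Qed.

Lemma expR_le_inv a : a < 1 -> expR a <= (1 - a)^-1.
Proof.
move=> a1; have h : 0 < 1 - a by rewrite subr_gt0.
rewrite -[expR a]invrK lef_pV2 ?posrE ?invr_gt0 ?expR_gt0 // -expRN.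
by have := expR_ge1Dx (- a).
Qed.

Lemma cexp_taylor w : nc w <= 1 / 2 -> nc (cexp w - 1 - w) <= 4 * nc w ^+ 2.
Proof.
case: w => a b hw; have ha := Re_le_nc (a +i* b); have hb := Im_le_nc (a +i* b).
have nE : nc (a +i* b) ^+ 2 = a ^+ 2 + b ^+ 2.
  by rewrite /= sqr_sqrtr // addr_ge0 ?sqr_ge0.
have {ha}ha : `|a| <= 1 / 2 by exact: le_trans ha hw.
have {hb}hb : `|b| <= 1 / 2 by exact: le_trans hb hw.
have /ler_normlP[ha1 ha2] := ha; have /ler_normlP[hb1 hb2] := hb.
have e1 := expR_ge1Dx a.
have e2 : expR a <= 1 + a + 2 * a ^+ 2.
  apply: le_trans (expR_le_inv _) _; first by lra.
  rewrite -[X in _ <= X]divr1 ler_pdivlMr // mulr1 -[X in X <= _]mul1r.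
  rewrite ler_pdivrMr; last by lra.
  rewrite -subr_ge0 (_ : _ - 1 = a ^+ 2 * (1 - 2 * a)); last by ring.
  by rewrite mulr_ge0 ?sqr_ge0 //; lra.
have e3 : expR a <= 2.
  have : a ^+ 2 <= (1 / 2) ^+ 2.
    by rewrite -[a ^+ 2]real_normK ?num_real // lerXn2r ?nnegrE.
  by rewrite expr_div_n expr1n; lra.
have a20 := sqr_ge0 a; have b20 := sqr_ge0 b.
have c1 := cos_le1 b; have c2 := cos_ge b.
have hre : `|expR a * cos b - 1 - a| <= b ^+ 2 + 2 * a ^+ 2.
  have -> : expR a * cos b - 1 - a = (expR a - 1 - a) - expR a * (1 - cos b) by ring.
  have h1 : 0 <= expR a * (1 - cos b) by rewrite mulr_ge0 ?expR_ge0 //; lra.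
  have h2 : expR a * (1 - cos b) <= 2 * (b ^+ 2 / 2).
    by apply: ler_pM; rewrite ?expR_ge0 //; lra.
  by apply/ler_normlP; split; lra.
have hs : `|sin b - b| <= b ^+ 2.
  wlog b0 : b hb hb1 hb2 b20 c1 c2 {hw nE hre} / 0 <= b => [h|].
    have [b0|/ltW b0] := leP 0 b; first exact: h.
    have := h (- b); rewrite normrN cosN sinN sqrrN -opprD normrN oppr_ge0 => h'.
    by apply: h' => //; lra.
  have s1 := sin_le_id b0; have p2 := pi_ge2 R.
  have s2 : b * cos b <= sin b by rewrite sin_ge_cos // b0 /=; lra.
  have s3 : b * (1 - cos b) <= b * (b ^+ 2 / 2) by rewrite ler_wpM2l //; lra.
  have s4 : b * (b ^+ 2 / 2) <= b ^+ 2.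
    rewrite mulrA ler_pdivrMr // [X in _ <= X]mulrC ler_wpM2r //; lra.
  by apply/ler_normlP; split; lra.
have him : `|expR a * sin b - b| <= 2 * `|a * b| + b ^+ 2 + b ^+ 2.
  have -> : expR a * sin b - b = (expR a - 1) * sin b + (sin b - b) by ring.
  apply: le_trans (ler_normD _ _) _; rewrite lerD //.
  rewrite normrM.
  have h1 : `|expR a - 1| <= 2 * `|a|.
    have h3 : a ^+ 2 <= `|a| * (1 / 2).
      by rewrite -[a ^+ 2]real_normK ?num_real // expr2 ler_wpM2l.
    have := ler_norm a; have := lerNnormlW (lexx `|a|) => h4 h5.
    by apply/ler_normlP; split; lra.
  have h2 : `|sin b| <= `|b|.
    by rewrite -ler_sqr ?nnegrE // !real_normK ?num_real // sin_sqr_le.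
  apply: le_trans (ler_pM _ _ h1 h2) _ => //.
  by rewrite normrM -mulrA; lra.
have hab : 2 * `|a * b| <= a ^+ 2 + b ^+ 2.
  rewrite normrM -(real_normK (num_real a)) -(real_normK (num_real b)).
  by rewrite -subr_ge0 (_ : _ - _ = (`|a| - `|b|) ^+ 2) ?sqr_ge0 //; ring.
rewrite (le_trans (nc_le_sum _)) // nE /cexp /=.
move: hre him; rewrite !mul0r !subr0 ?addr0 ?oppr0 ?add0r; lra.
Qed.

Lemma nc_subX x y M n : 1 <= M -> nc x <= M -> nc y <= M ->
  nc (x ^+ n - y ^+ n) <= n%:R * M ^+ n * nc (x - y).
Proof.
move=> M1 xM yM; have M0 : 0 <= M by rewrite (le_trans ler01).
elim: n => [|n IH]; first by rewrite subrr normc0 !mul0r.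
have -> : x ^+ n.+1 - y ^+ n.+1 = x * (x ^+ n - y ^+ n) + y ^+ n * (x - y).
  by rewrite !exprS; ring.
rewrite (le_trans (ncD _ _)) // !normcM ncX.
have h1 : nc x * nc (x ^+ n - y ^+ n) <= n%:R * M ^+ n.+1 * nc (x - y).
  apply: le_trans (ler_pM (nc_ge0 _) (nc_ge0 _) xM IH) _.
  by rewrite exprS; apply: eq_ler; ring.
have h2 : nc y ^+ n * nc (x - y) <= M ^+ n.+1 * nc (x - y).
  rewrite ler_wpM2r ?nc_ge0 // (@le_trans _ _ (M ^+ n)) //.
    by rewrite lerXn2r ?nnegrE ?nc_ge0.
  by rewrite exprS ler_peMl ?exprn_ge0.
rewrite -[n.+1%:R]natr1 !mulrDl mul1r; exact: lerD.
Qed.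

(** [cexp (f w)] is the uniform limit of [(1 + f w / n) ^ n]: the bases [cexp v] and [1 + v] differ
    by [O(n ^ -2)], and [nc_subX] loses a factor [n] only. *)
Lemma hol_cexp f : hol f -> hol (fun w => cexp (f w)).
Proof.
move=> hf; apply: hol_lim => r e r01 e0.
have [B0 [B00 hB0]] := hol_bounded hf r01; pose B := B0 + 1.
have B1 : 1 <= B by rewrite lerDr.
have B2 : 0 < B by exact: lt_le_trans ltr01 B1.
have hB w : nc w <= r -> nc (f w) <= B by move=> /hB0 h; rewrite (le_trans h) // lerDl.
have c0 : 0 < 4 * B ^+ 2 * expR B by rewrite !mulr_gt0 ?expR_gt0 ?exprn_gt0.
have [n1 hn1] := inv_small (divr_gt0 e0 c0).
have [n2 hn2] : exists n : nat, n.+1%:R^-1 < (2 * B)^-1.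
  by apply: inv_small; rewrite invr_gt0 mulr_gt0.
pose n := (maxn n1 n2).+1; have n0 : 0 < n%:R :> R by rewrite ltr0n.
have le_n k : (k <= maxn n1 n2)%N -> n%:R^-1 <= k.+1%:R^-1 :> R.
  by move=> kn; rewrite lef_pV2 ?posrE ?ltr0n // ler_nat.
have {}hn1 := le_lt_trans (le_n _ (leq_maxl n1 n2)) hn1.
have {}hn2 := le_lt_trans (le_n _ (leq_maxr n1 n2)) hn2.
exists (fun w => (1 + f w * (n%:R)^-1) ^+ n).
  by apply: holX; apply: holD (hol_cst _) _; apply: holM hf (hol_cst _).
move=> w wr; have nz : n%:R != 0 :> C by rewrite pnatr_eq0.
set v := f w * _; have -> : f w = n%:R * v by rewrite mulrC divfK.
rewrite cexpM_nat; have vB : nc v <= B / n%:R.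
  by rewrite normcM normcV nc_nat ler_wpM2r ?invr_ge0 ?hB // ltW.
have v2 : nc v <= 1 / 2.
  apply: le_trans vB _; apply: ltW; rewrite -ltr_pdivlMl //.
  by rewrite mul1r -invfM mulrC.
have M1 : 1 <= expR (B / n%:R) by rewrite -expR0 ler_expR divr_ge0 // ltW.
apply: le_trans (nc_subX n M1 _ _) _.
- rewrite nc_cexp ler_expR (le_trans (ler_norm _)) //.
  exact: le_trans (Re_le_nc _) vB.
- by rewrite (le_trans (ncD _ _)) // normc1 (le_trans _ (expR_ge1Dx _)) // lerD2l.
rewrite -expRM_natr divfK ?gt_eqF //.
have -> : cexp v - (1 + v) = cexp v - 1 - v by ring.
apply: le_trans (ler_wpM2l _ (cexp_taylor v2)) _.
  by rewrite mulr_ge0 ?expR_ge0 // ltW.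
have h1 : nc v ^+ 2 <= (B / n%:R) ^+ 2.
  by rewrite lerXn2r ?nnegrE ?nc_ge0 // divr_ge0 // ltW.
apply: le_trans (_ : n%:R * expR B * (4 * (B / n%:R) ^+ 2) <= _).
  by rewrite ler_wpM2l ?mulr_ge0 ?expR_ge0 ?(ltW n0) // ler_wpM2l.
have -> : n%:R * expR B * (4 * (B / n%:R) ^+ 2) = n%:R^-1 * (4 * B ^+ 2 * expR B).
  by field; rewrite gt_eqF.
by rewrite -ler_pdivlMr // ltW.
Qed.

(** * Discrete Cauchy estimates, Schwarz's lemma and the identity theorem *)

Definition unity_root (N : nat) : C := cexp (0 +i* (2 * pi / N%:R)).

Lemma cexp_iE a : cexp (0 +i* a) = cos a +i* sin a.
Proof. by rewrite /cexp /= expR0 mul1r. Qed.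

Lemma unity_rootX N m : unity_root N ^+ m = cos (m%:R * (2 * pi / N%:R)) +i* sin (m%:R * (2 * pi / N%:R)).
Proof.
rewrite -cexpM_nat -cexp_iE; congr cexp.
rewrite -[m%:R in LHS](rmorph_nat (real_complex R)).
by apply/eqP; rewrite eq_complex /= !mulr0 !mul0r subrr addr0 !eqxx.
Qed.

Lemma unity_rootN N : (0 < N)%N -> unity_root N ^+ N = 1.
Proof.
move=> N0; rewrite unity_rootX mulrC divfK ?pnatr_eq0 -?lt0n //.
by rewrite mulr_natl cos2pi sin2pi.
Qed.

Lemma unity_root_neq1 N m : (0 < m < N)%N -> unity_root N ^+ m != 1.
Proof.
move=> /andP[m0 mN]; rewrite unity_rootX; apply/eqP => -[/eqP h _].
move: h; rewrite cos_half -subr_eq0 addrAC subrr add0r oppr_eq0.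
rewrite mulf_eq0 pnatr_eq0 /= expf_eq0 /= gt_eqF // sin_gt0_pi //.
have N1 : (0 < N)%N by exact: leq_ltn_trans mN.
have N0 : 0 < N%:R :> R by rewrite ltr0n.
rewrite [m%:R * _](_ : _ = (m%:R / N%:R) * pi * 2); last by field; rewrite gt_eqF.
rewrite mulfK ?pnatr_eq0 // mulr_gt0 ?pi_gt0 ?divr_gt0 ?ltr0n //=.
by rewrite gtr_pMl ?pi_gt0 // ltr_pdivrMr // mul1r ltr_nat.
Qed.

Lemma nc_unity_root N : nc (unity_root N) = 1.
Proof. by rewrite nc_cexp /= expR0. Qed.

Lemma sum_unity_root N m : (0 < N)%N ->
  \sum_(j < N) (unity_root N ^+ m) ^+ j = if (N %| m)%N then N%:R else 0.
Proof.
move=> N0; case: ifP => [/dvdnP[k ->]|Nm].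
  under eq_bigr do rewrite mulnC exprM unity_rootN // !expr1n.
  by rewrite sumr_const card_ord.
have h : unity_root N ^+ m != 1.
  rewrite (divn_eq m N) exprD mulnC exprM unity_rootN // expr1n mul1r.
  by rewrite unity_root_neq1 // ltn_mod N0 andbT lt0n; move: Nm; rewrite /dvdn => ->.
rewrite -subr_eq0 in h; apply: (mulfI h); rewrite -subrX1 mulr0.
by rewrite -!exprM mulnC exprM unity_rootN // expr1n subrr.
Qed.

Lemma dvdn_shift (N i k : nat) : (i < N)%N -> (k < N)%N ->
  (N %| i + (N - k))%N = (i == k).
Proof.
move=> iN kN; apply/idP/eqP => [/dvdnP[[|[|d]]]|->]; [lia|lia|nia|].
by rewrite subnKC // ltnW.
Qed.

Lemma sum_cst_le a n : 0 <= a -> \sum_(i < n) (a / n.+1%:R) <= a.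
Proof.
move=> a0; rewrite sumr_const card_ord -[X in X <= _]mulr_natl mulrCA ler_piMr //.
by rewrite ler_pdivrMr ?ltr0n // mul1r ler_nat.
Qed.

(** The contour integral is replaced by the mean over the roots of unity of order [size p], which
    isolates a coefficient exactly; the factor with exponent [N - k] plays the part of
    [z ^ (- j k)]. *)
Lemma cauchy_coef (p : {poly C}) r M k : 0 < r ->
  (forall w, nc w = r -> nc p.[w] <= M) -> nc p`_k * r ^+ k <= M.
Proof.
move=> r0 hp; have rr : nc r%:C = r by rewrite nc_real gtr0_norm.
have [kp|kp] := leqP (size p) k.
  by rewrite nth_default // normc0 mul0r (le_trans (nc_ge0 _) (hp _ rr)).
pose N := size p; pose z := unity_root N.
have N0 : (0 < N)%N by exact: leq_ltn_trans kp.
have e : N%:R * (p`_k * r%:C ^+ k) = \sum_(j < N) p.[r%:C * z ^+ j] * (z ^+ j) ^+ (N - k).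
  under eq_bigr do rewrite horner_coef mulr_suml.
  rewrite exchange_big /= (bigD1 (Ordinal kp)) //= [X in _ + X]big1 ?addr0 => [|i ik].
    under eq_bigr => j _.
      rewrite exprMn mulrA -mulrA -exprD subnKC ?(ltnW kp) //.
      rewrite -exprM mulnC exprM unity_rootN // expr1n mulr1; over.
    by rewrite sumr_const card_ord mulr_natl.
  under eq_bigr do rewrite exprMn mulrA -mulrA -exprD -exprM mulnC exprM.
  rewrite -mulr_sumr sum_unity_root // ifF ?mulr0 //.
  by rewrite dvdn_shift //; apply/negbTE; move: ik; rewrite -val_eqE.
have Nr : 0 < N%:R :> R by rewrite ltr0n.
rewrite -[M](mulKf (lt0r_neq0 Nr)) -ler_pdivrMl ?invr_gt0 // invrK.
have -> : N%:R * (nc p`_k * r ^+ k) = nc (N%:R * (p`_k * r%:C ^+ k)).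
  by rewrite !normcM nc_nat ncX rr.
rewrite e (le_trans (nc_sum _ _ _)) //.
have -> : N%:R * M = \sum_(j < N) M by rewrite sumr_const card_ord mulr_natl.
apply: ler_sum => j _; rewrite normcM !ncX nc_unity_root !expr1n mulr1 hp //.
by rewrite normcM rr ncX nc_unity_root expr1n mulr1.
Qed.

Lemma poly_tail_le (p : {poly C}) r M m w : 0 < r ->
  (forall v, nc v = r -> nc p.[v] <= M) -> nc w < r ->
  nc (p.[w] - \sum_(i < m) p`_i * w ^+ i) <= M * ((nc w / r) ^+ m / (1 - nc w / r)).
Proof.
move=> r0 hp wr; pose t := nc w / r.
have t01 : 0 <= t < 1.
  by rewrite divr_ge0 ?nc_ge0 ?(ltW r0) //= ltr_pdivrMr // mul1r.
have M0 : 0 <= M.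
  by apply: le_trans (nc_ge0 _) (hp r%:C _); rewrite nc_real gtr0_norm.
have -> : p.[w] - \sum_(i < m) p`_i * w ^+ i =
    \sum_(m <= i < maxn m (size p)) p`_i * w ^+ i.
  rewrite (horner_coef_wide _ (leq_maxr m (size p))).
  rewrite -!(big_mkord xpredT (fun i => p`_i * w ^+ i)).
  by rewrite (@big_cat_nat _ _ _ m) ?leq_maxl //= addrAC subrr add0r.
rewrite (le_trans (nc_sum _ _ _)) //.
apply: le_trans (_ : \sum_(m <= i < maxn m (size p)) M * t ^+ i <= _).
  apply: ler_sum => i _; rewrite normcM ncX /t expr_div_n mulrA.
  rewrite mulrAC ler_wpM2r ?exprn_ge0 ?nc_ge0 // ler_pdivlMr ?exprn_gt0 //.
  exact: cauchy_coef.
by rewrite -mulr_sumr ler_wpM2l // geom_tail_le.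
Qed.

(** Cauchy's estimate bounds all coefficients after the constant one, and the geometric series
    accounts for the denominator. The constant coefficient of the approximating polynomial is small
    because [g] vanishes at 0. *)
Lemma hol_schwarz g r M w : hol g -> g 0 = 0 -> 0 < r < 1 ->
  (forall v, nc v = r -> nc (g v) <= M) -> nc w < r ->
  nc (g w) <= M * ((nc w / r) / (1 - nc w / r)).
Proof.
move=> hg g0 /andP[r0 r1] gM wr; set T := _ / (1 - _).
have t1 : nc w / r < 1 by rewrite ltr_pdivrMr // mul1r.
have T0 : 0 <= T.
  by rewrite divr_ge0 ?subr_ge0 ?(ltW t1) // divr_ge0 ?nc_ge0 // ltW.
apply: ler_eps => e e0; have c0 : 0 < 2 + T by rewrite ltr_wpDr.
have d0 := divr_gt0 e0 c0; set d := e / (2 + T) in d0.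
have [|p hp] := hg r d _ d0; first by rewrite (ltW r0).
have pM v : nc v = r -> nc p.[v] <= M + d.
  move=> vr; rewrite -(subKr (g v) p.[v]) (le_trans (ncB _ _)) //.
  by rewrite lerD ?gM ?hp ?vr.
have := poly_tail_le 1 r0 pM wr.
rewrite big_ord_recl big_ord0 addr0 expr0 mulr1 expr1 -/T => h.
have p0 : nc p`_0 <= d.
  have := hp 0; rewrite normc0 g0 sub0r normcN horner_coef0; apply.
  exact: ltW.
have -> : g w = (g w - p.[w]) + (p.[w] - p`_0) + p`_0 by ring.
apply: le_trans (ncD _ _) _; apply: le_trans (lerD (ncD _ _) p0) _.
apply: le_trans (lerD (lerD (hp w (ltW wr)) h) (lexx d)) _.
apply: eq_ler; rewrite mulrDl (_ : e = d * (2 + T)); first by ring.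
by rewrite /d divfK ?gt_eqF.
Qed.

(** The tolerance [e] is chosen before the polynomial and independently of its degree. By induction:
    at a small real [x], the term [p_k x ^ k] is [p(x)] minus lower terms minus a tail of order
    [x ^ (k + 1)], each at most [d x ^ k / 3]. *)
Lemma coef_small M r k : 0 < r <= 1 -> 0 <= M -> forall d, 0 < d ->
  exists2 e, 0 < e & forall p : {poly C},
    (forall w, nc w = r -> nc p.[w] <= M) ->
    (forall a, 0 < a < r -> nc p.[a%:C] <= e) ->
    forall j, (j < k)%N -> nc p`_j <= d.
Proof.
move=> /andP[r0 r1] M0; elim: k => [|k IH] d d0; first by exists 1.
pose c := 2 * M / r ^+ k.+1.
have c0 : 0 <= c by rewrite divr_ge0 ?mulr_ge0 ?exprn_ge0 // ltW.
(* [x <= r / 2] makes the geometric tail at most twice its first term; the second bound then makes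
   it at most [d x ^ k / 3]. *)
pose x := Num.min (r / 2) (d / 3 / (c + 1)).
have c1 : 0 < c + 1 by rewrite ltr_wpDl.
have x0 : 0 < x by rewrite lt_min !divr_gt0.
have xr : x <= r / 2 by rewrite ge_min lexx.
have xc : x * c <= d / 3.
  apply: le_trans (_ : x * (c + 1) <= _); first by rewrite ler_wpM2l ?(ltW x0) // lerDl.
  by rewrite -ler_pdivlMr // ge_min lexx orbT.
have xk : 0 < x ^+ k by rewrite exprn_gt0.
pose d' := Num.min d (d * x ^+ k / 3 / k.+1%:R).
have d'0 : 0 < d' by rewrite lt_min d0 !divr_gt0 ?mulr_gt0 ?ltr0n.
have [e1 e10 he1] := IH d' d'0.
exists (Num.min e1 (d * x ^+ k / 3)); first by rewrite lt_min e10 divr_gt0 ?mulr_gt0.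
move=> p pM pe j; rewrite ltnS leq_eqVlt => /predU1P[->|jk]; last first.
  apply: le_trans (he1 p pM _ j jk) _; last by rewrite ge_min lexx.
  by move=> a /pe h; rewrite (le_trans h) // ge_min lexx.
have xr' : x < r by lra.
have nx : nc x%:C = x by rewrite nc_real gtr0_norm.
have px : nc p.[x%:C] <= d * x ^+ k / 3.
  by apply: le_trans (pe x _) _; rewrite ?x0 // ge_min lexx orbT.
have ps : nc (\sum_(i < k) p`_i * x%:C ^+ i) <= d * x ^+ k / 3.
  apply: le_trans (nc_sum _ _ _) _.
  apply: le_trans (_ : \sum_(i < k) d * x ^+ k / 3 / k.+1%:R <= _).
    apply: ler_sum => i _; rewrite normcM ncX nx.
    apply: le_trans (_ : d' * 1 <= _); last by rewrite mulr1 ge_min lexx orbT.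
    apply: ler_pM; rewrite ?nc_ge0 ?exprn_ge0 ?(ltW x0) //; last first.
      by rewrite exprn_ile1 ?(ltW x0) //; lra.
    by apply: he1 => // a /pe h; rewrite (le_trans h) // ge_min lexx.
  by rewrite sum_cst_le // divr_ge0 ?mulr_ge0 ?ltW.
have wx : nc x%:C < r by rewrite nx.
have := poly_tail_le k.+1 r0 pM wx; rewrite nx big_ord_recr /= => h.
have {}h : nc (p.[x%:C] - (\sum_(i < k) p`_i * x%:C ^+ i + p`_k * x%:C ^+ k)) <= d * x ^+ k / 3.
  apply: le_trans h _; have xr2 : x / r <= 1 / 2 by rewrite ler_pdivrMr //; lra.
  have i2 : (1 - x / r)^-1 <= 2.
    by rewrite invf_ple ?posrE; lra.
  apply: le_trans (_ : M * ((x / r) ^+ k.+1 * 2) <= _).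
    by rewrite ler_wpM2l // ler_wpM2l // exprn_ge0 // divr_ge0 // ltW.
  have -> : M * ((x / r) ^+ k.+1 * 2) = x ^+ k * (x * c).
    by rewrite /c expr_div_n [x ^+ k.+1]exprSr; field; rewrite expf_neq0 // gt_eqF.
  by rewrite [d * _]mulrC -mulrA ler_wpM2l // ltW.
have : nc (p`_k * x%:C ^+ k) <= d * x ^+ k / 3 + d * x ^+ k / 3 + d * x ^+ k / 3.
  have -> : p`_k * x%:C ^+ k = p.[x%:C] - \sum_(i < k) p`_i * x%:C ^+ i
    - (p.[x%:C] - (\sum_(i < k) p`_i * x%:C ^+ i + p`_k * x%:C ^+ k)) by ring.
  apply: le_trans (ncB _ _) _; rewrite lerD //.
  by apply: le_trans (ncB _ _) _; rewrite lerD.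
have -> : d * x ^+ k / 3 + d * x ^+ k / 3 + d * x ^+ k / 3 = d * x ^+ k by field.
by rewrite normcM ncX nx ler_pM2r.
Qed.

(** The order of choices matters: first the number [m] of coefficients, which fixes the tail at [w],
    then the tolerance of [coef_small], and last the polynomial. Its low coefficients are small
    because it is small on the segment. *)
Lemma hol_identity h : hol h -> (forall a, 0 < a < 1 -> h a%:C = 0) ->
  forall w, nc w < 1 -> h w = 0.
Proof.
move=> hh h0 w w1; apply/eqP; rewrite -nc_eq0 eq_le nc_ge0 andbT.
have w0 := nc_ge0 w; pose r := (1 + nc w) / 2.
have r01 : 0 < r < 1 by rewrite /r; apply/andP; split; lra.
have wr : nc w < r by rewrite /r; lra.
have /andP[r0 r1] := r01.
have [|B [B0 hB]] := @hol_bounded h r hh; first by rewrite (ltW r0).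
pose M := B + 1; have M0 : 0 <= M by rewrite addr_ge0.
pose t := nc w / r; have t01 : 0 <= t < 1.
  by rewrite divr_ge0 ?(ltW r0) //= ltr_pdivrMr // mul1r.
have t1 : 0 < 1 - t by rewrite subr_gt0; case/andP: t01.
apply: ler_eps => e e0; rewrite add0r.
have [m hm] : exists m, t ^+ m < e / 3 * (1 - t) / (M + 1).
  by apply: exp_small => //; rewrite divr_gt0 ?mulr_gt0 ?divr_gt0 // ltr_wpDl.
have d0 : 0 < e / 3 / m.+1%:R by rewrite !divr_gt0 ?ltr0n.
have r1' : 0 < r <= 1 by rewrite r0 ltW.
have [e1 e10 he1] := @coef_small M r m r1' M0 _ d0.
pose e2 := Num.min 1 (Num.min e1 (e / 3)).
have e20 : 0 < e2 by rewrite !lt_min ltr01 e10 divr_gt0.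
have e21 : e2 <= 1 by rewrite ge_min lexx.
have e22 : e2 <= e1 by rewrite ge_min ge_min lexx orbT.
have e23 : e2 <= e / 3 by rewrite ge_min ge_min lexx !orbT.
have [|p hp] := hh r e2 _ e20; first by rewrite (ltW r0).
have pM v : nc v = r -> nc p.[v] <= M.
  move=> vr; rewrite -(subKr (h v) p.[v]) (le_trans (ncB _ _)) //.
  by rewrite lerD ?hB ?vr // (le_trans (hp _ _)) // vr.
have pe a : 0 < a < r -> nc p.[a%:C] <= e1.
  move=> /andP[a0 ar]; have na : nc a%:C <= r by rewrite nc_real gtr0_norm // ltW.
  have := hp _ na; rewrite h0 ?a0 ?(lt_trans ar) // sub0r normcN => hpa.
  exact: le_trans hpa e22.
have cs := he1 p pM pe.
have tl := poly_tail_le m r0 pM wr.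
have -> : h w = (h w - p.[w]) + (\sum_(i < m) p`_i * w ^+ i)
   + (p.[w] - \sum_(i < m) p`_i * w ^+ i) by ring.
have -> : e = e / 3 + e / 3 + e / 3 by field.
apply: le_trans (ncD _ _) _; apply: lerD; last first.
  apply: le_trans tl _; rewrite -/t.
  apply: le_trans (_ : (M + 1) * (t ^+ m / (1 - t)) <= _).
    rewrite ler_wpM2r ?lerDl // divr_ge0 ?(ltW t1) // exprn_ge0 //.
    by case/andP: t01.
  rewrite mulrA ler_pdivrMr // mulrC -ler_pdivlMr ?(ltW hm) //.
  by rewrite ltr_wpDl.
apply: le_trans (ncD _ _) _; apply: lerD; first exact: le_trans (hp _ (ltW wr)) e23.
apply: le_trans (nc_sum _ _ _) _.
apply: le_trans (_ : \sum_(i < m) e / 3 / m.+1%:R <= _).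
  apply: ler_sum => i _; rewrite normcM ncX -[X in _ <= X]mulr1.
  by rewrite ler_pM ?nc_ge0 ?exprn_ge0 ?cs // exprn_ile1 // ltW.
by rewrite sum_cst_le // divr_ge0 ?(ltW e0).
Qed.

Lemma qpowD z a b : qpow z (a + b) = qpow z a * qpow z b.
Proof.
rewrite /qpow -cexpD -mulrDl; congr (cexp (_ * z)).
by apply/eqP; rewrite eq_complex /= addr0 eqxx /= mulrDr.
Qed.

Lemma qpow0 z : qpow z (0 : R) = 1.
Proof. by rewrite /qpow mulr0 mul0r cexp0. Qed.

Lemma qpowX z a n : qpow z (n%:R * a) = qpow z a ^+ n.
Proof.
elim: n => [|n IH]; first by rewrite mul0r qpow0.
by rewrite -natr1 mulrDl mul1r qpowD IH exprSr.
Qed.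

Lemma qpow_nat z n : qpow z (n%:R : R) = qpow z 1 ^+ n.
Proof. by rewrite -qpowX mulr1. Qed.

Lemma qpow_neq0 z a : qpow z a != 0.
Proof. exact: cexp_neq0. Qed.

Lemma nc_qpow z a : nc (qpow z a) = expR (- (2 * pi * a * complex.Im z)).
Proof. by rewrite /qpow nc_cexp; case: z => u v /=; rewrite mul0r add0r. Qed.

Lemma nc_qpow_lt1 z a : 0 < a -> 0 < complex.Im z -> nc (qpow z a) < 1.
Proof.
move=> a0 z0; rewrite nc_qpow expR_lt1 oppr_lt0.
by rewrite !mulr_gt0 ?pi_gt0.
Qed.

Lemma qpow_mul (k : nat) z a : qpow (k%:R * z) a = qpow z (k%:R * a).
Proof.
rewrite /qpow mulrA; congr (cexp (_ * z)).
rewrite -(rmorph_nat (real_complex R)).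
by apply/eqP; rewrite eq_complex /=; apply/andP; split; apply/eqP; ring.
Qed.

Lemma qpow_i (y a : R) : qpow (0 +i* y) a = (expR (- (2 * pi * a * y)))%:C.
Proof.
rewrite /qpow /cexp /= !mul0r !mulr0 sub0r addr0 cos0 sin0.
by rewrite (_ : 1 +i* 0 = 1) ?mulr1.
Qed.

End ComplexNorm.

(** * Lacunary series and infinite products *)

(** The number [n (n - 1) / 2], free of division. *)
Fixpoint tri (n : nat) : nat := if n is m.+1 then (tri m + m)%N else 0%N.

Lemma triE n : (2 * tri n = n * n.-1)%N.
Proof. by elim: n => [//|n IH] /=; case: n IH => [//|n] /=; lia. Qed.

Lemma triD m n : tri (m + n) = (tri m + tri n + m * n)%N.
Proof. by elim: n => [|n IH]; [rewrite !addn0 muln0|rewrite addnS /= IH]; lia. Qed.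

Section QBinomial.
Variables (K : fieldType) (Q : K).

Definition qpoch (n : nat) : K := \prod_(1 <= k < n.+1) (1 - Q ^+ k).

Lemma qpoch0 : qpoch 0 = 1.
Proof. by rewrite /qpoch big_geq. Qed.

Lemma qpochS n : qpoch n.+1 = qpoch n * (1 - Q ^+ n.+1).
Proof. by rewrite /qpoch big_nat_recr. Qed.

(** The Gaussian binomial coefficient by its Pascal rule, which avoids denominators that might
    vanish. *)
Fixpoint qbin (m j : nat) : K :=
  if j is j'.+1 then
    if m is m'.+1 then qbin m' j'.+1 + Q ^+ (m' - j') * qbin m' j' else 0
  else 1.

Lemma qbin_small m j : (m < j)%N -> qbin m j = 0.
Proof.
elim: m j => [|m IH] [|j] //= mj.
by rewrite !IH ?mulr0 ?addr0 // ltnW.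
Qed.

Lemma qbin0 m : qbin m 0 = 1. Proof. by case: m. Qed.

Lemma qbin_qpoch m j : (j <= m)%N -> qbin m j * qpoch j * qpoch (m - j) = qpoch m.
Proof.
elim: m j => [|m IH] [|j] //= jm; rewrite ?qpoch0 ?mulr1 ?mul1r //.
rewrite subSS mulrDl mulrDl ltnS in jm *.
have e2 : Q ^+ (m - j) * qbin m j * qpoch j.+1 * qpoch (m - j) =
    Q ^+ (m - j) * (1 - Q ^+ j.+1) * qpoch m.
  by rewrite -(IH j jm) qpochS; ring.
rewrite e2; move: jm; rewrite leq_eqVlt => /predU1P[->|jm].
  rewrite qbin_small // subnn !mul0r add0r expr0 mul1r mulrC.
  by rewrite [RHS]qpochS.
have mj : (m - j)%N = (m - j.+1).+1 by lia.
have -> : qbin m j.+1 * qpoch j.+1 * qpoch (m - j) = qpoch m * (1 - Q ^+ (m - j)).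
  have e3 : qpoch (m - j) = qpoch (m - j.+1) * (1 - Q ^+ (m - j)).
    by rewrite {1}mj qpochS -mj.
  by rewrite -(IH _ jm) e3 mulrA.
rewrite qpochS; have -> : Q ^+ m.+1 = Q ^+ (m - j) * Q ^+ j.+1.
  by rewrite -exprD; congr (_ ^+ _); lia.
by ring.
Qed.

(** The q-binomial theorem, by induction on the number of factors. *)
Lemma qbin_thm m (Y : K) : \prod_(k < m) (Y - Q ^+ k) =
  \sum_(j < m.+1) (-1) ^+ j * qbin m j * Q ^+ tri j * Y ^+ (m - j).
Proof.
elim: m => [|m IH].
  by rewrite big_ord0 big_ord_recl big_ord0 /= !mulr1 addr0.
rewrite big_ord_recr /= {}IH [in RHS]big_ord_recl /= expr0 !mul1r subn0.
under [X in _ = _ + X]eq_bigr => i _.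
  have im : (i <= m)%N by rewrite -ltnS ltn_ord.
  rewrite (_ : _ * _ = (-1) ^+ i.+1 * qbin m i.+1 * Q ^+ tri i.+1 * Y ^+ (m.+1 - i.+1)
     - Q ^+ m * ((-1) ^+ i * qbin m i * Q ^+ tri i * Y ^+ (m - i))); first over.
  rewrite /bump /= add1n subSS exprS.
  have -> : Q ^+ m = Q ^+ (m - i) * Q ^+ i by rewrite -exprD subnK.
  by rewrite /= exprD; ring.
rewrite big_split /= sumrN -mulr_sumr addrA mulrBr mulr_suml [_ * Q ^+ m]mulrC.
congr (_ - _).
have -> : Y ^+ m.+1 = (-1) ^+ 0 * qbin m 0 * Q ^+ tri 0 * Y ^+ (m.+1 - 0).
  by rewrite qbin0 /= !mul1r.
rewrite -(big_ord_recl _ (fun j : 'I_m.+2 =>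
  (-1) ^+ j * qbin m j * Q ^+ tri j * Y ^+ (m.+1 - j))).
rewrite [RHS]big_ord_recr /= qbin_small // mulr0 !mul0r addr0.
apply: eq_bigr => i _; rewrite subSn; last by rewrite -ltnS ltn_ord.
by rewrite exprSr mulrA.
Qed.

End QBinomial.

Lemma triple_exp (M e N a n : nat) : (a + n = N)%N -> (e <= M)%N -> (e <= M * N)%N ->
  (M * tri a + (M * N - e) * (N + n) =
   M * tri N + (M * N - e) * N + (M * tri n + (M - e) * n))%N.
Proof.
move=> <- eM eN; rewrite triD.
have h1 : ((M * (a + n) - e) * n + e * n = M * (a + n) * n)%N.
  by rewrite -mulnDl subnK.
have h2 : ((M - e) * n + e * n = M * n)%N by rewrite -mulnDl subnK.
rewrite mulnDr; have := triE n; case: n eN h1 h2 => [|n] eN h1 h2 /=; first by nia.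
by nia.
Qed.

Section FiniteTripleProduct.
Variables (K : fieldType) (q : K) (M e : nat).
Hypotheses (q0 : q != 0) (e0 : (0 < e < M)%N).

Definition thexp (M e n : nat) : nat := (M * tri n + e * n)%N.

Definition tprod (N : nat) : K :=
  \prod_(k < N) ((1 - q ^+ (M * k + (M - e))) * (1 - q ^+ (M * k + e))).

Lemma tprodS N : tprod N.+1 =
  tprod N * ((1 - q ^+ (M * N + (M - e))) * (1 - q ^+ (M * N + e))).
Proof. by rewrite /tprod big_ord_recr. Qed.

Lemma sum_split_mid (f : nat -> K) N : \sum_(j < (N + N).+1) f j =
  \sum_(n < N.+1) f (N + n)%N + \sum_(n < N) f (N.-1 - n)%N.
Proof.
rewrite -(big_mkord xpredT f) (@big_cat_nat _ _ _ N) //=; last by rewrite leqW ?leq_addr.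
rewrite addrC; congr (_ + _).
  rewrite -{1}[N]add0n big_addn big_mkord subSn ?leq_addr // addnK.
  by apply: eq_bigr => i _; rewrite addnC.
rewrite big_mkord (reindex_inj rev_ord_inj) /=; apply: eq_bigr => i _.
by congr f; lia.
Qed.

Lemma finite_triple_product N : tprod N =
  \sum_(n < N.+1) (-1) ^+ n * qbin (q ^+ M) (N + N) (N + n) * q ^+ thexp M e n
  - \sum_(n < N) (-1) ^+ n * qbin (q ^+ M) (N + N) (N.-1 - n)
       * q ^+ thexp M (M - e) n.+1.
Proof.
have /andP[e1 eM] := e0; case: N => [|N].
  by rewrite /tprod !big_ord0 big_ord_recl big_ord0 /= /thexp /= !muln0 !mulr1 addr0 subr0.
(* [N = 0] has been settled separately so that the subtraction [M * N' - e] is not truncated; [W] is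
   the exponent of the factor taken out of the [2 N'] factors. *)
set N' := N.+1; pose Y := q ^+ (M * N' - e).
pose W := (M * tri N' + (M * N' - e) * N')%N.
have MN : (e <= M * N')%N by rewrite /N'; nia.
have W0 : (-1) ^+ N' * q ^+ W != 0 by rewrite mulf_neq0 ?expf_neq0 // oppr_eq0 oner_eq0.
apply: (mulfI W0).
have -> : (-1) ^+ N' * q ^+ W * tprod N' = \prod_(k < N' + N') (Y - (q ^+ M) ^+ k).
  rewrite big_split_ord /=.
  have -> : \prod_(i < N') (Y - (q ^+ M) ^+ i) = (-1) ^+ N' * q ^+ (M * tri N') *
      \prod_(k < N') (1 - q ^+ (M * k + (M - e))).
    have -> : (-1) ^+ N' * q ^+ (M * tri N') = \prod_(k < N') (- q ^+ (M * k)).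
      rewrite prodrN card_ord; congr (_ * _).
      elim: (N') => [|n IH]; first by rewrite big_ord0 muln0.
      by rewrite big_ord_recr /= -IH -exprD mulnDr.
    rewrite [X in _ * X](reindex_inj rev_ord_inj) /= -big_split /=.
    apply: eq_bigr => k _; have kN := ltn_ord k.
    rewrite -exprM mulNr mulrBr mulr1 -exprD opprB /Y; congr (q ^+ _ - _).
    by rewrite /N' in kN *; nia.
  have -> : \prod_(i < N') (Y - (q ^+ M) ^+ (N' + i)) = q ^+ ((M * N' - e) * N') *
      \prod_(k < N') (1 - q ^+ (M * k + e)).
    have -> : q ^+ ((M * N' - e) * N') = \prod_(k < N') Y.
      by rewrite prodr_const card_ord exprM.
    rewrite -big_split /=; apply: eq_bigr => k _.
    rewrite mulrBr mulr1 -exprM -exprD; congr (_ - q ^+ _).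
    by nia.
  rewrite /tprod big_split /= /W exprD; ring.
rewrite qbin_thm (sum_split_mid (fun j => (-1) ^+ j * qbin (q ^+ M) (N' + N') j *
  (q ^+ M) ^+ tri j * Y ^+ (N' + N' - j))).
rewrite mulrBr; congr (_ + _).
  rewrite mulr_sumr; apply: eq_bigr => n _.
  have nN : (n <= N')%N by rewrite -ltnS ltn_ord.
  have eW : (q ^+ M) ^+ tri (N' + n) * Y ^+ (N' + N' - (N' + n)) =
      q ^+ W * q ^+ thexp M e n.
    rewrite -!exprM -!exprD; congr (q ^+ _); rewrite triD /W /thexp subnDl.
    have : ((M * N' - e) * (N' - n) + (M * N' - e) * n = (M * N' - e) * N')%N.
      by rewrite -mulnDr subnK.
    by nia.
  by rewrite -mulrA eW exprD; ring.
rewrite mulr_sumr -sumrN; apply: eq_bigr => n _; have nN := ltn_ord n.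
have s2 : (-1) ^+ n * (-1) ^+ n = 1 :> K by rewrite -expr2 sqrr_sign.
have sN : (-1) ^+ N' = (-1) ^+ (N'.-1 - n) * (-1) ^+ n * (-1) :> K.
  by rewrite -exprD -exprSr; congr (_ ^+ _); lia.
have eW : (q ^+ M) ^+ tri (N'.-1 - n) * Y ^+ (N' + N' - (N'.-1 - n)) =
    q ^+ W * q ^+ thexp M (M - e) n.+1.
  rewrite -!exprM -!exprD; congr (q ^+ _); rewrite /W /thexp.
  have -> : (N' + N' - (N'.-1 - n) = N' + n.+1)%N by lia.
  apply: triple_exp => //; lia.
by rewrite -mulrA eW sN; ring: s2.
Qed.

End FiniteTripleProduct.

Section InfiniteProducts.
Variable R : realType.
Local Notation C := R[i].
Local Notation nc := (@normc R).
Implicit Types (q : C) (r : R).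

Lemma qpoch_step_le (x : R) : 0 <= x < 1 -> expR (- (x / (1 - x))) <= 1 - x.
Proof.
move=> /andP[x0 x1]; have h : 0 < 1 - x by rewrite subr_gt0.
rewrite expRN -[X in _ <= X]invrK lef_pV2 ?posrE ?invr_gt0 ?expR_gt0 //.
by apply: le_trans (expR_ge1Dx _); apply: eq_ler; field; rewrite gt_eqF.
Qed.

Lemma nc_qpoch_le q r n : 0 <= r < 1 -> nc q <= r ->
  nc (qpoch q n) <= expR ((1 - r)^-1).
Proof.
move=> r01 qr; have /andP[r0 r1] := r01.
suff h : nc (qpoch q n) <= expR (\sum_(k < n) r ^+ k.+1).
  apply: le_trans h _; rewrite ler_expR.
  under eq_bigr do rewrite exprS; rewrite -mulr_sumr.
  by apply: le_trans (geom_sum_le n r01); rewrite ler_piMl ?(ltW r1) // sumr_ge0 // => i _; rewrite exprn_ge0.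
elim: n => [|n IH]; first by rewrite qpoch0 normc1 big_ord0 expR0.
rewrite qpochS normcM big_ord_recr /= expRD ler_pM ?nc_ge0 //.
apply: le_trans (ncB _ _) _; rewrite normc1 ncX.
apply: le_trans (expR_ge1Dx _); rewrite lerD2l.
by rewrite lerXn2r ?nnegrE ?nc_ge0.
Qed.

(** [1 - x >= exp (- x / (1 - x))] turns the product into a geometric sum. The bound is uniform in
    [n], so the infinite product is nonzero and the Gaussian binomials stay bounded. *)
Lemma nc_qpoch_ge q : nc q < 1 ->
  exists2 c : R, 0 < c & forall n, c <= nc (qpoch q n).
Proof.
set r := nc q => r1; have r0 : 0 <= r := nc_ge0 q.
have r01 : 0 <= r < 1 by rewrite r0.
have h : 0 < 1 - r by rewrite subr_gt0.
exists (expR (- ((1 - r)^-1 / (1 - r)))) => [|n]; first exact: expR_gt0.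
apply: le_trans (_ : expR (- ((\sum_(k < n) r ^+ k.+1) / (1 - r))) <= _).
  rewrite ler_expR lerN2 ler_wpM2r ?invr_ge0 ?(ltW h) //.
  under eq_bigr do rewrite exprS; rewrite -mulr_sumr.
  by apply: le_trans (geom_sum_le n r01); rewrite ler_piMl ?(ltW r1) // sumr_ge0 // => i _; rewrite exprn_ge0.
elim: n => [|n IH].
  by rewrite big_ord0 mul0r oppr0 expR0 qpoch0 normc1.
rewrite big_ord_recr /= mulrDl opprD expRD qpochS normcM ler_pM ?expR_ge0 //.
have rn : 0 <= r ^+ n.+1 < 1 by rewrite exprn_ge0 //= exprn_ilt1.
apply: le_trans (_ : 1 - r ^+ n.+1 <= _); last first.
  rewrite lerBlDr -ncX -[X in X <= _](@normc1 R) -{1}(subrK (q ^+ n.+1) 1).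
  exact: ncD.
apply: le_trans (qpoch_step_le rn); rewrite ler_expR lerN2.
rewrite ler_wpM2l ?exprn_ge0 // lef_pV2 ?posrE ?subr_gt0 //; last by case/andP: rn.
by rewrite lerD2l lerN2 exprS ler_piMr // exprn_ile1 // ltW.
Qed.

Definition euler q : C := infinite_prod (fun n => 1 - q ^+ n).

(** The rate depends on [r] only, as uniformity on the disc of radius [r] demands. *)
Lemma euler_spec q r n : 0 <= r < 1 -> nc q <= r ->
  nc (qpoch q n - euler q) <= 2 * expR ((1 - r)^-1) / (1 - r) * r ^+ n.
Proof.
move=> r01 qr; have /andP[r0 r1] := r01.
have [|m|l hl] := @geo_cvg R (qpoch q) (expR ((1 - r)^-1)) r _ r01.
- exact: expR_ge0.
- rewrite qpochS mulrBr mulr1 addrAC subrr add0r normcN normcM ncX.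
  rewrite ler_pM ?nc_ge0 ?exprn_ge0 ?nc_ge0 ?nc_qpoch_le //.
  apply: le_trans (_ : r ^+ m.+1 <= _); first by rewrite lerXn2r ?nnegrE ?nc_ge0.
  by rewrite exprS ler_piMl ?exprn_ge0 // ltW.
suff -> : euler q = l by [].
by apply: ctends_lim; apply: geo_ctends r01 hl.
Qed.

Lemma euler_ctends q : nc q < 1 -> ctends (qpoch q) (euler q).
Proof.
move=> q1; have r01 : 0 <= nc q < 1 by rewrite nc_ge0.
exact: (@geo_ctends R _ _ _ _ r01 (fun n => euler_spec n r01 (lexx _))).
Qed.

Lemma euler_neq0 q : nc q < 1 -> euler q != 0.
Proof.
move=> q1; have [c c0 hc] := nc_qpoch_ge q1; rewrite -nc_gt0.
have c2 : 0 < c / 2 by rewrite divr_gt0.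
have [N /(_ N (leqnn N)) h] := euler_ctends q1 c2.
rewrite (lt_le_trans c2) // -(subKr (qpoch q N) (euler q)).
have := hc N; rewrite -{1}(subrK (euler q) (qpoch q N)) => h'.
have := le_trans h' (ncD _ _); rewrite subKr; lra.
Qed.

Lemma hol_euler : hol euler.
Proof.
apply: hol_lim => r e r01 e0; have /andP[r0 r1] := r01.
set B := 2 * expR ((1 - r)^-1) / (1 - r).
have B0 : 0 < B by rewrite divr_gt0 ?mulr_gt0 ?expR_gt0 ?subr_gt0.
have [n hn] := exp_small r01 (divr_gt0 e0 B0).
exists (fun w => qpoch w n).
  by apply: hol_prod => k; apply: holD (hol_cst _) _; apply: holN; apply: holX; exact: hol_id.
move=> w wr; rewrite nc_dist; apply: le_trans (euler_spec n r01 wr) _.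
by rewrite -/B mulrC -ler_pdivlMr // ltW.
Qed.

Definition lac (e : nat -> nat) q : C :=
  lim (series (fun n => (-1) ^+ n * q ^+ e n : (R[i] : numFieldType)) @ \oo).

Lemma lac_spec (e : nat -> nat) q r n : (forall n, (n <= e n)%N) -> 0 <= r < 1 -> nc q <= r ->
  nc (\sum_(k < n) (-1) ^+ k * q ^+ e k - lac e q) <= 2 / (1 - r) * r ^+ n.
Proof.
move=> he r01 qr; have /andP[r0 r1] := r01.
pose u n := \sum_(k < n) (-1) ^+ k * q ^+ e k.
have [|m|l hl] := @geo_cvg R u 1 r _ r01; first exact: ler01.
- rewrite /u big_ord_recr /= addrAC subrr add0r normcM nc_sign ncX !mul1r.
  apply: le_trans (_ : r ^+ e m <= _); first by rewrite lerXn2r ?nnegrE ?nc_ge0.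
  by rewrite ler_wiXn2l // ltW.
suff -> : lac e q = l by have := hl n; rewrite mulr1.
apply: (@ctends_lim R (series (fun n => (-1) ^+ n * q ^+ e n))).
apply: (ctends_eq _ (geo_ctends r01 hl)) => k.
by rewrite /u /series /= big_mkord.
Qed.

Lemma lac_ctends (e : nat -> nat) q : (forall n, (n <= e n)%N) -> nc q < 1 ->
  ctends (fun n => \sum_(k < n) (-1) ^+ k * q ^+ e k) (lac e q).
Proof.
move=> he q1; have r01 : 0 <= nc q < 1 by rewrite nc_ge0.
exact: (@geo_ctends R _ _ _ _ r01 (fun n => lac_spec n he r01 (lexx _))).
Qed.

Lemma hol_lac (e : nat -> nat) : (forall n, (n <= e n)%N) -> hol (lac e).
Proof.
move=> he; apply: hol_lim => r d r01 d0; have /andP[r0 r1] := r01.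
have B0 : 0 < 2 / (1 - r) by rewrite divr_gt0 ?subr_gt0.
have [n hn] := exp_small r01 (divr_gt0 d0 B0).
exists (fun q => \sum_(k < n) (-1) ^+ k * q ^+ e k).
  by apply: hol_sum => k; apply: holM (hol_cst _) _; apply: holX; exact: hol_id.
move=> w wr; rewrite nc_dist; apply: le_trans (lac_spec n he r01 wr) _.
by rewrite mulrC -ler_pdivlMr // ltW.
Qed.

(** The bilateral series of [(-1) ^ n q ^ (M n (n - 1) / 2 + e n)]: the index [- (n + 1)] has the
    exponent [thexp M (M - e) n.+1] and the opposite sign. *)
Definition bilac (M e : nat) q : C :=
  lac (thexp M e) q - lac (fun n => thexp M (M - e) n.+1) q.

Lemma thexp_ge M e n : (0 < e)%N -> (n <= thexp M e n)%N.
Proof. by rewrite /thexp; nia. Qed.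

Lemma hol_bilac M e : (0 < e < M)%N -> hol (bilac M e).
Proof.
move=> /andP[e0 eM]; apply: holD; first by apply: hol_lac => n; apply: thexp_ge.
apply: holN; apply: hol_lac => n; apply: leq_trans (thexp_ge _ _ _); first exact: leqnSn.
by rewrite subn_gt0.
Qed.

Lemma bilac0 M e : (0 < e < M)%N -> bilac M e 0 = 1.
Proof.
move=> /andP[e0 eM].
have h0 : nc (0 : C) < 1 by rewrite normc0.
have h1 : lac (thexp M e) 0 = 1.
  apply: ctends_unique (lac_ctends (fun n => thexp_ge M n e0) h0) _.
  move=> d d0; exists 1%N => -[//|n] _.
  rewrite big_ord_recl /= /thexp muln0 muln0 expr0 mul1r big1 ?addr0 ?subrr ?normc0 ?ltW //.
  by move=> i _; rewrite /bump /= add1n expr0n /= (_ : (_ == 0)%N = false) ?mulr0 //; apply/negbTE; nia.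
have h2 : lac (fun n => thexp M (M - e) n.+1) 0 = 0.
  have he n : (n <= thexp M (M - e) n.+1)%N.
    by apply: leq_trans (thexp_ge _ _ _); rewrite ?leqnSn ?subn_gt0.
  apply: ctends_unique (lac_ctends he h0) _.
  move=> d d0; exists 0%N => n _; rewrite subr0 big1 ?normc0 ?ltW // => i _.
  by rewrite expr0n /= (_ : (_ == 0)%N = false) ?mulr0 //; apply/negbTE; rewrite /thexp; nia.
by rewrite /bilac h1 h2 subr0.
Qed.

Lemma ctendsV (u : nat -> C) l : l != 0 -> ctends u l ->
  ctends (fun n => (u n)^-1) l^-1.
Proof.
move=> l0 ul d d0; have nl : 0 < nc l by rewrite nc_gt0.
have l2 : 0 < nc l / 2 by rewrite divr_gt0.
have [N1 h1] := ul _ l2.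
have d' : 0 < d * (nc l / 2 * nc l) by rewrite !mulr_gt0.
have [N2 h2] := ul _ d'; exists (maxn N1 N2) => n; rewrite geq_max => /andP[/h1 k1 /h2 k2].
have un : nc l / 2 <= nc (u n).
  have := ncD (u n) (l - u n); rewrite subrKC nc_dist in k1 *; lra.
have u0 : u n != 0 by rewrite -nc_gt0 (lt_le_trans l2).
have -> : (u n)^-1 - l^-1 = (l - u n) / (u n * l) by field; rewrite u0 l0.
rewrite normcM normcV normcM ler_pdivrMr ?mulr_gt0 ?nc_gt0 // nc_dist.
by apply: le_trans k2 _; rewrite ler_pM2l // ler_pM2r.
Qed.

Lemma ctends_subseq (u : nat -> C) l (k : nat -> nat) :
  (forall n, exists N0, forall N, (N0 <= N)%N -> (n <= k N)%N) ->
  ctends u l -> ctends (fun n => u (k n)) l.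
Proof.
move=> hk h d /h[N hN]; have [N0 h0] := hk N; exists N0 => n /h0; exact: hN.
Qed.

Lemma ctends_eventually (u v : nat -> C) l N0 :
  (forall n, (N0 <= n)%N -> u n = v n) -> ctends u l -> ctends v l.
Proof.
move=> uv h d /h[N hN]; exists (maxn N0 N) => n; rewrite geq_max => /andP[/uv <- /hN]; exact.
Qed.

Lemma qpoch_neq0 q n : nc q < 1 -> qpoch q n != 0.
Proof.
by move=> /nc_qpoch_ge[c c0 hc]; rewrite -nc_gt0 (lt_le_trans c0).
Qed.

Lemma qbinE q m j : nc q < 1 -> (j <= m)%N ->
  qbin q m j = qpoch q m * ((qpoch q j)^-1 * (qpoch q (m - j))^-1).
Proof.
by move=> q1 jm; rewrite -(qbin_qpoch q jm); field; rewrite !qpoch_neq0.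
Qed.

Lemma qbin_bound q : nc q < 1 -> exists2 B : R, 0 <= B & forall m j, nc (qbin q m j) <= B.
Proof.
move=> q1; have [c c0 hc] := nc_qpoch_ge q1.
have r01 : 0 <= nc q < 1 by rewrite nc_ge0.
exists (expR ((1 - nc q)^-1) * (c^-1 * c^-1)) => [|m j].
  by rewrite !mulr_ge0 ?expR_ge0 ?invr_ge0 // ltW.
have [mj|jm] := ltnP m j.
  by rewrite qbin_small // normc0 !mulr_ge0 ?expR_ge0 ?invr_ge0 // ltW.
rewrite qbinE // !normcM !normcV ler_pM ?mulr_ge0 ?invr_ge0 ?nc_ge0 ?nc_qpoch_le //.
by rewrite ler_pM ?invr_ge0 ?nc_ge0 // lef_pV2 ?posrE ?nc_gt0 ?qpoch_neq0.
Qed.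

Lemma qbin_ctends q (k : nat -> nat) : nc q < 1 ->
  (forall n, exists N0, forall N, (N0 <= N)%N -> (n <= k N)%N) ->
  (forall n, exists N0, forall N, (N0 <= N)%N -> (n <= N + N - k N)%N) ->
  ctends (fun N => qbin q (N + N) (k N)) (euler q)^-1.
Proof.
move=> q1 k1 k2; have [N0 h0] := k2 1%N; have e0 := euler_neq0 q1.
have e := euler_ctends q1.
apply: (@ctends_eventually (fun N => qpoch q (N + N) *
  ((qpoch q (k N))^-1 * (qpoch q (N + N - k N))^-1)) _ _ N0).
  by move=> n /h0 h; rewrite -qbinE //; lia.
have -> : (euler q)^-1 = euler q * ((euler q)^-1 * (euler q)^-1) by field.
apply: ctendsM.
  by apply: (@ctends_subseq (qpoch q) _ (fun N => (N + N)%N)) e => n; exists n => N; lia.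
apply: ctendsM; apply: ctendsV => //.
  exact: (@ctends_subseq (qpoch q) _ k).
exact: (@ctends_subseq (qpoch q) _ (fun N => (N + N - k N)%N)).
Qed.

Lemma nc_lt1X q n : nc q < 1 -> (0 < n)%N -> nc (q ^+ n) < 1.
Proof. by move=> q1 n0; rewrite ncX exprn_ilt1 ?nc_ge0 // -lt0n. Qed.

(** The Jacobi triple product: in the finite identity every Gaussian binomial tends to the inverse
    of [euler (q ^+ M)], and Tannery's theorem applies on both sides of the middle. *)
Lemma tprod_ctends q M e : q != 0 -> nc q < 1 -> (0 < e < M)%N ->
  ctends (tprod q M e) (bilac M e q / euler (q ^+ M)).
Proof.
move=> q0 q1 eM; have /andP[e1 e2] := eM.
have Q1 : nc (q ^+ M) < 1 by apply: nc_lt1X => //; lia.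
have r01 : 0 <= nc q < 1 by rewrite nc_ge0.
have [B B0 hB] := qbin_bound Q1.
pose E := (euler (q ^+ M))^-1; pose B' := B + nc E.
have qe (x : nat -> nat) n : (n <= x n)%N -> nc (q ^+ x n) <= nc q ^+ n.
  by move=> h; rewrite ncX ler_wiXn2l ?nc_ge0 // ltW.
have main (x K : nat -> nat) (kk : nat -> nat -> nat) : (forall n, (n <= x n)%N) ->
    (forall n, (n <= K n)%N) ->
    (forall n m, exists N0, forall N, (N0 <= N)%N -> (m <= kk N n)%N) ->
    (forall n m, exists N0, forall N, (N0 <= N)%N -> (m <= N + N - kk N n)%N) ->
    ctends (fun N => \sum_(n < K N) (-1) ^+ n * qbin (q ^+ M) (N + N) (kk N n) * q ^+ x n)
      (E * lac x q).
  move=> hx hK h1 h2.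
  apply: (@tannery R (fun N n => (-1) ^+ n * qbin (q ^+ M) (N + N) (kk N n) * q ^+ x n)
    (fun n => E * ((-1) ^+ n * q ^+ x n)) K 0 B' (nc q)) => //.
  - move=> N n _ _; rewrite !normcM nc_sign mul1r.
    by rewrite ler_pM ?nc_ge0 ?qe // (le_trans (hB _ _)) // lerDl nc_ge0.
  - by move=> n; rewrite !normcM nc_sign mul1r ler_pM ?nc_ge0 ?qe // lerDr.
  - move=> n; have := ctendsMl ((-1) ^+ n * q ^+ x n) (@qbin_ctends (q ^+ M) (kk^~ n) Q1 (h1 n) (h2 n)).
    rewrite -/E [_ * E]mulrC; apply: ctends_eq => N; ring.
  - have := ctendsMl E (lac_ctends hx q1); apply: ctends_eq => N.
    by rewrite mulr_sumr.
have -> : bilac M e q / euler (q ^+ M) = E * lac (thexp M e) q +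
    (-1) * (E * lac (fun n => thexp M (M - e) n.+1) q) by rewrite /bilac -/E; ring.
apply: (ctends_eq (fun N => esym (finite_triple_product q0 eM N))).
have h1 := main (thexp M e) (fun N => N.+1) (fun N n => (N + n)%N).
have h2 := main (fun n => thexp M (M - e) n.+1) id (fun N n => (N.-1 - n)%N).
apply: (ctends_eq _ (ctendsD (h1 _ _ _ _) (ctendsMl (-1) (h2 _ _ _ _)))).
- by move=> N; rewrite /= mulN1r.
- by move=> n; apply: thexp_ge.
- by move=> n; apply: leqnSn.
- by move=> n m; exists m => N; lia.
- by move=> n m; exists (m + n)%N => N; lia.
- by move=> n; apply: leq_trans (thexp_ge _ _ _); rewrite ?leqnSn ?subn_gt0.
- by [].
- by move=> n m; exists (m + n).+1 => N; lia.
- by move=> n m; exists m => N; lia.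
Qed.

Lemma qpoch_add q m n : qpoch q (m + n) = qpoch q m * \prod_(k < n) (1 - q ^+ (m + k.+1)).
Proof.
elim: n => [|n IH]; first by rewrite addn0 big_ord0 mulr1.
by rewrite addnS qpochS IH big_ord_recr /= mulrA addnS.
Qed.

(** The factors are sorted by their exponents modulo [M = 2 h + 1]: the nonzero residues form [h]
    pairs of opposite classes, one [tprod] for each. *)
Lemma qpoch_tprod q h N : qpoch q ((h + h).+1 * N) =
  qpoch (q ^+ (h + h).+1) N * \prod_(i < h) tprod q (h + h).+1 (h.+1 + i) N.
Proof.
set M := (h + h).+1; elim: N => [|N IH].
  rewrite muln0 !qpoch0 mul1r big1 // => i _; by rewrite /tprod big_ord0.
rewrite mulnS addnC qpoch_add IH qpochS.
under [in RHS]eq_bigr do rewrite tprodS.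
rewrite big_split /= -exprM.
suff -> : \prod_(k < M) (1 - q ^+ (M * N + k.+1)) = (1 - q ^+ (M * N.+1)) *
    \prod_(i < h) ((1 - q ^+ (M * N + (M - (h.+1 + i)))) * (1 - q ^+ (M * N + (h.+1 + i)))).
  by ring.
rewrite big_ord_recr /= mulrC mulnS [(M + _)%N]addnC; congr (_ * _).
rewrite big_split_ord big_split /=; congr (_ * _).
  rewrite (reindex_inj rev_ord_inj) /=; apply: eq_bigr => i _.
  by congr (1 - q ^+ (_ + _)); have := ltn_ord i; rewrite /M; lia.
Qed.

Lemma prod_bilac q h : q != 0 -> nc q < 1 ->
  (\prod_(i < h) bilac (h + h).+1 (h.+1 + i) q) * euler (q ^+ (h + h).+1) =
  euler q * euler (q ^+ (h + h).+1) ^+ h.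
Proof.
move=> q0 q1; set M := (h + h).+1; have Q1 : nc (q ^+ M) < 1 by apply: nc_lt1X.
set E := euler (q ^+ M); have E0 : E != 0 := euler_neq0 Q1.
have h1 : ctends (fun N => qpoch q (M * N)) (euler q).
  by apply: (@ctends_subseq (qpoch q) _ (muln M)) (euler_ctends q1) => n; exists n => N; nia.
have h2 : ctends (fun N => qpoch q (M * N)) (E * \prod_(i < h) (bilac M (h.+1 + i) q / E)).
  apply: (ctends_eq (fun N => esym (qpoch_tprod q h N))).
  apply: ctendsM (euler_ctends Q1) _; apply: ctends_prod => i; apply: tprod_ctends => //.
  by have := ltn_ord i; rewrite /M; lia.
rewrite (ctends_unique h1 h2) big_split /= prodr_const card_ord exprVn.
by field; rewrite expf_neq0.
Qed.

(** The case [h = 1] of [prod_bilac]. It presents [eta] as a theta series, so that one inversion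
    theorem covers [eta] and the theta constants. *)
Lemma pentagonal q : q != 0 -> nc q < 1 -> bilac 3 2 q = euler q.
Proof.
move=> q0 q1; have := @prod_bilac q 1 q0 q1.
rewrite big_ord_recl big_ord0 mulr1 expr1; apply: mulIf.
by apply: euler_neq0; apply: nc_lt1X.
Qed.

Lemma prod_bilac13 q : q != 0 -> nc q < 1 ->
  bilac 13 12 q * bilac 13 10 q * bilac 13 9 q * bilac 13 8 q * bilac 13 11 q * bilac 13 7 q =
  euler q * euler (q ^+ 13) ^+ 5.
Proof.
move=> q0 q1; have := @prod_bilac q 6 q0 q1; have E0 := euler_neq0 (nc_lt1X q1 (isT : 0 < 13)%N).
rewrite !big_ord_recl big_ord0 /= => h; apply: (mulIf E0).
by rewrite -[RHS]mulrA -exprSr -h /bump /= !addnE /=; ring.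
Qed.

End InfiniteProducts.

(** * Inversion of theta series *)

Lemma sign_odd2 (K : pzRingType) n : (-1) ^+ (n + n).+1 = -1 :> K.
Proof. by rewrite exprS addnn -mul2n exprM sqrrN expr1n expr1n mulr1. Qed.

Lemma leq_sqr n : (n <= n ^ 2)%N.
Proof. by case: n => // n; rewrite expnS expn1 leq_pmulr. Qed.

Lemma odd_block M k i : ((M * k + i) + (M * k + i)).+1 = (2 * M * k + (i + i).+1)%N.
Proof. by lia. Qed.

Lemma odd_block_rev h k i (M := (h + h).+1) : (i < h)%N ->
  (2 * M * k.+1 = (M * k + (M.-1 - i) + (M * k + (M.-1 - i))).+1 + (i + i).+1)%N.
Proof. by rewrite /M; nia. Qed.

Section Polya.
Variable R : realType.
Local Notation C := R[i].
Local Notation nc := (@normc R).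

Definition cis (a : R) : C := cexp (0 +i* a).

Lemma cisD (a b : R) : cis (a + b) = cis a * cis b.
Proof. by rewrite /cis -cexpD; congr cexp; apply/eqP; rewrite eq_complex /= addr0 !eqxx. Qed.

Lemma cis_nat n (a : R) : cis (n%:R * a) = cis a ^+ n.
Proof.
rewrite /cis -cexpM_nat; congr cexp; rewrite -[n%:R in RHS](rmorph_nat (real_complex R)).
by apply/eqP; rewrite eq_complex /= !mulr0 !mul0r subrr addr0 !eqxx.
Qed.

Lemma cisDN (a : R) : cis a + cis (- a) = (2 * cos a)%:C.
Proof.
rewrite /cis !cexp_iE cosN sinN; apply/eqP; rewrite eq_complex /= subrr eqxx andbT.
by apply/eqP; ring.
Qed.

Lemma cis_pi : cis pi = -1.
Proof. by rewrite /cis cexp_iE cospi sinpi; apply/eqP; rewrite eq_complex /= oppr0 !eqxx. Qed.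

Lemma cos_addn (a : R) n : cos (a + n%:R * pi) = (-1) ^+ n * cos a.
Proof.
elim: n => [|n IH]; first by rewrite mul0r addr0 mul1r.
by rewrite -natr1 mulrDl mul1r addrA cosDpi IH exprS; ring.
Qed.

Lemma cos_subn (a : R) n : cos (a - n%:R * pi) = (-1) ^+ n * cos a.
Proof.
have := cos_addn (a - n%:R * pi) n; rewrite subrK => ->.
by rewrite mulrA -expr2 sqrr_sign mul1r.
Qed.

Lemma sum_ord_dvd (F : nat -> C) d n : (0 < d)%N ->
  \sum_(i < (d * n).+1 | (d %| i)%N) F i = \sum_(r < n.+1) F (d * r)%N.
Proof.
move=> d0; rewrite (reindex_onto (fun r : 'I_n.+1 => inord (d * r) : 'I_(d * n).+1)
   (fun i => inord (i %/ d) : 'I_n.+1)) /=.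
  apply: eq_big => [r|r _]; have rn : (d * r < (d * n).+1)%N.
  - by rewrite ltnS leq_pmul2l // -ltnS ltn_ord.
  - by rewrite inordK // dvdn_mulr // mulKn // inord_val eqxx.
  - by rewrite ltnS leq_pmul2l // -ltnS ltn_ord.
  - by rewrite inordK.
move=> i /dvdnP[k ik]; apply: val_inj => /=.
have kn : (k < n.+1)%N by have := ltn_ord i; rewrite ik ltnS mulnC leq_pmul2l // ltnS.
by rewrite ik mulnK // !inordK // mulnC // -ik ltn_ord.
Qed.

Lemma sum_split_half (f : nat -> C) N : \sum_(j < N + N) f j =
  \sum_(n < N) f (N + n)%N + \sum_(n < N) f (N.-1 - n)%N.
Proof.
rewrite big_split_ord /= addrC; congr (_ + _).
rewrite (reindex_inj rev_ord_inj) /=; apply: eq_bigr => i _.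
by congr f; lia.
Qed.

Lemma cos_pow_cis (x : R) n : (2 * cos x)%:C ^+ n =
  \sum_(i < n.+1) 'C(n, i)%:R * cis (i%:R * (2 * x) - n%:R * x).
Proof.
rewrite -cisDN addrC exprDn; apply: eq_bigr => i _.
have ni : (i <= n)%N by rewrite -ltnS ltn_ord.
rewrite -mulr_natl -!cis_nat -cisD; congr (_ * cis _).
by rewrite natrB //; ring.
Qed.

(* Polya's proof of the theta transformation: this finite form of Poisson
   summation results from expanding the powers of the cosine. *)
Lemma polya_identity N h (al : R) (m := (N * (h + h).+1)%N) : (0 < N)%N ->
  \sum_(j < N + N) (-1) ^+ (N + j) *
     ((cos (pi * (j%:R - N%:R + al) / (2 * N%:R)))%:C) ^+ (m + m) =
  (4 * N%:R / 4 ^+ m)%:C * \sum_(v < h.+1) 'C(m + m, m + N * (v + v).+1)%:R *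
     (cos ((v + v).+1%:R * (pi * al)))%:C.
Proof.
move=> N0; pose x (j : nat) : R := pi * (j%:R - N%:R + al) / (2 * N%:R).
have NR : N%:R != 0 :> R by rewrite pnatr_eq0 -lt0n.
have mN : m%:R = N%:R * (h%:R + h%:R + 1) :> R by rewrite /m natrM -natr1 natrD.
have four : (4 ^+ m : R) != 0 by rewrite expf_neq0 // pnatr_eq0.
have powE j : (cos (x j))%:C ^+ (m + m) = ((4 ^+ m)^-1)%:C *
    \sum_(i < (m + m).+1) 'C(m + m, i)%:R * cis (i%:R * (2 * x j) - (m + m)%:R * x j).
  rewrite -cos_pow_cis rmorphM exprMn mulrA.
  have -> : ((4 ^+ m)^-1)%:C * (2%:C) ^+ (m + m) = 1 :> C.
    rewrite -(rmorphXn (real_complex R)) -(rmorphM (real_complex R)) /= addnn -mul2n exprM (_ : 2 ^+ 2 = 4); last by ring.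
    by rewrite mulVf.
  by rewrite mul1r.
(* Since [m] is an odd multiple of [N], shifting [x 0] to [x j] multiplies the phase by [(-1) ^ j],
   which cancels the alternating sign. *)
have stepE i j : (-1) ^+ j * cis (i%:R * (2 * x j) - (m + m)%:R * x j) =
    cis (i%:R * (2 * x 0) - (m + m)%:R * x 0) * (unity_root R (N + N) ^+ i) ^+ j.
  have -> : (-1) ^+ j = cis (j%:R * ((h + h).+1%:R * pi)).
    by rewrite !cis_nat cis_pi sign_odd2.
  have -> : (unity_root R (N + N) ^+ i) ^+ j = cis (j%:R * (i%:R * (2 * pi / (N + N)%:R))).
    by rewrite !cis_nat.
  rewrite -!cisD; congr cis; rewrite /x !natrD mN -natr1 natrD.
  rewrite (_ : N%:R + N%:R = 2 * N%:R :> R); last by ring.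
  by field.
pose c : C := ((4 ^+ m)^-1)%:C * (-1) ^+ N.
pose F i : C := 'C(m + m, i)%:R * cis (i%:R * (2 * x 0) - (m + m)%:R * x 0).
transitivity (\sum_(j < N + N) \sum_(i < (m + m).+1)
    c * (F i * (unity_root R (N + N) ^+ i) ^+ j)).
  apply: eq_bigr => j _; rewrite -/(x j) powE exprD !mulr_sumr.
  apply: eq_bigr => i _; rewrite /F -[_ * _ * (unity_root _ _ ^+ i) ^+ j]mulrA -stepE /c; ring.
rewrite exchange_big /=.
(* Orthogonality of the roots of unity of order [2 N] retains the indices [i] divisible by [2 N]. *)
transitivity (\sum_(i < (m + m).+1 | (N + N %| i)%N) c * (F i * (N + N)%:R)).
  rewrite [RHS]big_mkcond; apply: eq_bigr => i _.
  rewrite -mulr_sumr -mulr_sumr sum_unity_root ?addn_gt0 ?N0 //.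
  by case: ifP => // _; rewrite !mulr0.
have mm : (m + m = (N + N) * (h + h).+1)%N by rewrite mulnDl.
rewrite [in LHS]mm (sum_ord_dvd (fun i => c * (F i * (N + N)%:R))) ?addn_gt0 ?N0 //.
have -> : ((h + h).+2 = h.+1 + h.+1)%N by rewrite addnS addSn.
rewrite (sum_split_half (fun r => c * (F ((N + N) * r)%N * (N + N)%:R))) -big_split /=.
rewrite mulr_sumr; apply: eq_bigr => v _.
have vh : (v <= h)%N by rewrite -ltnS ltn_ord.
pose B : C := 'C(m + m, m + N * (v + v).+1)%:R; pose th : R := (v + v).+1%:R * (pi * al) - ((v + v).+1 * N)%:R * pi.
(* The surviving indices are [m + N (2 v + 1)] and their mirror images [m - N (2 v + 1)], with equal
   binomials and conjugate phases, hence a cosine. *)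
have F1 : F ((N + N) * (h.+1 + v))%N = B * cis th.
  rewrite /F /B; congr ('C(_, _)%:R * cis _); first by rewrite /m; lia.
  by rewrite /th /x !natrM !natrD mN -!natr1 !natrD; field.
have F2 : F ((N + N) * (h - v))%N = B * cis (- th).
  rewrite /F /B; congr (_ * cis _).
    rewrite -[in RHS]bin_sub; last by rewrite /m; nia.
    by congr ('C(_, _)%:R); rewrite /m; nia.
  by rewrite /th /x !natrM !natrD mN natrB // -!natr1 !natrD; field.
have e1 : (2 * cos th)%:C = 2 * (-1) ^+ N * (cos ((v + v).+1%:R * (pi * al)))%:C.
  rewrite /th cos_subn exprM sign_odd2 !rmorphM rmorphXn rmorphN rmorph1 /= rmorph_nat; ring.
rewrite F1 F2 -/B (_ : c * _ + _ = c * (B * (cis th + cis (- th)) * (N + N)%:R)); last by ring.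
have s2 : (-1) ^+ N * (-1) ^+ N = 1 :> C by rewrite -expr2 sqrr_sign.
rewrite cisDN e1 /c !rmorphM rmorph_nat rmorph_nat natrD.
transitivity ((4 ^- m)%:C * (4 * N%:R) * ((-1) ^+ N * (-1) ^+ N) *
  (B * (cos ((v + v).+1%:R * (pi * al)))%:C)); first by ring.
by rewrite s2; ring.
Qed.

Lemma central_bin_ratio m k : (k < m)%N ->
  'C(m + m, m + k.+1)%:R * (m + k.+1)%:R = 'C(m + m, m + k)%:R * (m - k)%:R :> R.
Proof.
move=> km; rewrite -!natrM; congr _%:R.
have := mul_bin_left (m + m) (m + k); by rewrite subnDl addnS mulnC => ->; rewrite mulnC.
Qed.

(** Consecutive ratios are at most [1 - (2 k + 1) / (m + K)], and the odd numbers add up to [k ^ 2]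
    in the exponent. [bin_ratio_ge] is the matching lower bound, with [m - K]. *)
Lemma bin_ratio_le m K k : (k <= K <= m)%N -> (0 < m)%N ->
  'C(m + m, m + k)%:R <= 'C(m + m, m)%:R * expR (- (k%:R ^+ 2 / (m + K)%:R)) :> R.
Proof.
move=> /andP[kK Km] m0; elim: k kK => [|k IH] kK.
  by rewrite addn0 expr0n mul0r oppr0 expR0 mulr1.
have D0 : 0 < (m + k.+1)%:R :> R by rewrite ltr0n addnS.
have D1 : 0 < (m + K)%:R :> R by rewrite ltr0n; lia.
rewrite -(ler_pM2r D0) central_bin_ratio; last exact: leq_trans kK Km.
apply: le_trans (ler_wpM2r (ler0n _ _) (IH (ltnW kK))) _.
rewrite -[X in X <= _]mulrA -[X in _ <= X]mulrA ler_wpM2l ?ler0n // -ler_pdivrMr // -[X in X <= _]mulrA.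
have -> : (k.+1%:R : R) ^+ 2 / (m + K)%:R = k%:R ^+ 2 / (m + K)%:R + (k%:R + k%:R + 1) / (m + K)%:R.
  by rewrite -mulrDl; congr (_ / _); rewrite -natr1; ring.
rewrite opprD expRD ler_wpM2l ?expR_ge0 //.
apply: le_trans (expR_ge1Dx _); rewrite ler_pdivrMr // natrB; last by lia.
have : (k%:R + k%:R + 1) / (m + K)%:R * (m + k.+1)%:R <= k%:R + k%:R + 1 :> R.
  rewrite mulrAC -mulrA ler_piMr // ?addr_ge0 ?ler0n // ler_pdivrMr // mul1r ler_nat; lia.
rewrite mulrBl mul1r; move: (_ / _ * _) => u; rewrite natrD -natr1; lra.
Qed.

Lemma bin_ratio_ge m K k : (k <= K < m)%N ->
  'C(m + m, m)%:R * expR (- (k%:R ^+ 2 / (m - K)%:R)) <= 'C(m + m, m + k)%:R :> R.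
Proof.
move=> /andP[kK Km]; elim: k kK => [|k IH] kK.
  by rewrite addn0 expr0n mul0r oppr0 expR0 mulr1.
have D0 : 0 < (m + k.+1)%:R :> R by rewrite ltr0n addnS.
have D1 : 0 < (m - K)%:R :> R by rewrite ltr0n; lia.
have D2 : 0 < (m - k)%:R :> R by rewrite ltr0n; lia.
rewrite -(ler_pM2r D0) central_bin_ratio; last by lia.
apply: le_trans (ler_wpM2r (ler0n _ _) (IH (ltnW kK))).
rewrite -[X in X <= _]mulrA -[X in _ <= X]mulrA ler_wpM2l ?ler0n // -ler_pdivlMr // -[X in _ <= X]mulrA.
have -> : (k.+1%:R : R) ^+ 2 / (m - K)%:R = k%:R ^+ 2 / (m - K)%:R + (k%:R + k%:R + 1) / (m - K)%:R.
  by rewrite -mulrDl; congr (_ / _); rewrite -natr1; ring.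
rewrite opprD expRD ler_wpM2l ?expR_ge0 //.
pose t : R := (k%:R + k%:R + 1) / (m + k.+1)%:R.
have D0' := lt0r_neq0 D0; have D2' := lt0r_neq0 D2.
have tE : (m - k)%:R / (m + k.+1)%:R = 1 - t.
  apply: (mulIf D0'); rewrite divfK // mulrBl mul1r /t divfK // natrB; last by lia.
  by rewrite natrD -natr1; ring.
rewrite tE.
have t01 : 0 <= t < 1.
  rewrite /t divr_ge0 ?addr_ge0 ?ler0n //= ltr_pdivrMr // mul1r.
  by rewrite -!natrD natr1 ltr_nat; lia.
apply: le_trans (qpoch_step_le t01); rewrite ler_expR lerN2.
have -> : t / (1 - t) = (k%:R + k%:R + 1) / (m - k)%:R.
  rewrite -tE /t; move: (_ + _ + 1) (m - k)%:R (m + k.+1)%:R D0' D2' => u v w w0 v0.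
  by rewrite invf_div mulrA divfK.
rewrite ler_wpM2l ?addr_ge0 ?ler0n // lef_pV2 ?posrE // ler_nat; lia.
Qed.

Lemma ctends_real (u : nat -> R) (l : R) : u @ \oo --> l ->
  ctends (fun n => (u n)%:C) l%:C.
Proof.
move=> /cvgrPdist_le h e e0; have [N _ hN] := h e e0; exists N => n Nn.
by rewrite -rmorphB nc_real distrC; apply: hN.
Qed.

Lemma cvg_eventually (u v : nat -> R) (l : R) N0 :
  (forall n, (N0 <= n)%N -> u n = v n) -> u @ \oo --> l -> v @ \oo --> l.
Proof.
move=> uv; apply: cvg_trans; apply: near_eq_cvg; near=> n; apply: uv.
by near: n; exists N0.
Unshelve. all: by end_near. Qed.

Lemma cvg_squeeze (f g h : nat -> R) (l : R) N0 :
  (forall n, (N0 <= n)%N -> f n <= g n <= h n) ->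
  f @ \oo --> l -> h @ \oo --> l -> g @ \oo --> l.
Proof.
move=> fgh; apply: squeeze_cvgr; near=> n; apply: fgh.
by near: n; exists N0.
Unshelve. all: by end_near. Qed.

Lemma cvg_inv_nat : (fun n : nat => n%:R^-1 : R) @ \oo --> (0 : R).
Proof.
apply/cvgrPdist_le => e e0; have [N hN] := inv_small e0; exists N.+1 => // n /= Nn.
rewrite sub0r normrN ger0_norm ?invr_ge0 //; apply: le_trans (ltW hN).
by rewrite lef_pV2 ?posrE ?ltr0n ?ler_nat // (leq_trans _ Nn).
Qed.

Lemma cvg_expR (u : nat -> R) (l : R) : u @ \oo --> l ->
  (fun n => expR (u n)) @ \oo --> expR l.
Proof. by apply: continuous_cvg; apply: continuous_expR. Qed.

(** * Gaussian limits of powers of the cosine and of binomials *)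

Section Width.
Variables (s : R).
Hypothesis s0 : 0 < s.

(** Chosen so that [expo n] is an odd multiple of [n], as [polya_identity] requires, and grows like
    [s n ^ 2]. *)
Definition width (n : nat) : nat := Num.truncn (s * n%:R / 2).
Definition expo (n : nat) : nat := (n * (width n + width n).+1)%N.

Lemma width_bound n : s * n%:R - 1 <= (width n + width n).+1%:R <= s * n%:R + 1.
Proof.
have /andP[] : (width n)%:R <= s * n%:R / 2 < (width n).+1%:R.
  by apply: truncn_itv; rewrite divr_ge0 ?mulr_ge0 ?ler0n // ltW.
rewrite -[(width n).+1%:R]natr1 -[(_ + _).+1%:R]natr1 natrD => h1 h2; apply/andP; split; lra.
Qed.

Lemma cvg_width : (fun n => (width n + width n).+1%:R / n%:R : R) @ \oo --> s.
Proof.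
apply: (@cvg_squeeze (fun n => s - n%:R^-1) _ (fun n => s + n%:R^-1) _ 1).
- move=> n n0; have n1 : 0 < n%:R :> R by rewrite ltr0n.
  have /andP[h1 h2] := width_bound n.
  by rewrite ler_pdivlMr // ler_pdivrMr // mulrBl mulrDl mulVf ?gt_eqF // h1.
- rewrite -[X in _ --> X]subr0; apply: cvgB; [exact: cvg_cst|exact: cvg_inv_nat].
- rewrite -[X in _ --> X]addr0; apply: cvgD; [exact: cvg_cst|exact: cvg_inv_nat].
Qed.

Lemma expoE n : (0 < n)%N ->
  (expo n)%:R = (width n + width n).+1%:R / n%:R * n%:R ^+ 2 :> R.
Proof.
move=> n0; rewrite /expo natrM; have n1 : n%:R != 0 :> R by rewrite pnatr_eq0 -lt0n.
by move: (_.+1%:R) => w; field.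
Qed.

Lemma width_eventually : exists N0, forall n, (N0 <= n)%N ->
  s / 2 <= (width n + width n).+1%:R / n%:R <= 2 * s.
Proof.
have /cvgrPdist_le/(_ (s / 2)) [] := cvg_width; first by rewrite divr_gt0.
move=> N _ h; exists N => n /h /=; rewrite ler_norml => /andP[h1 h2].
by apply/andP; split; lra.
Qed.

Lemma expo_ge n : (n <= expo n)%N.
Proof. by rewrite /expo mulnS leq_addr. Qed.

Lemma cos_pow_bounds (x : R) m : x ^+ 2 <= 1 ->
  expR (- (m%:R * x ^+ 2 / (1 - x ^+ 2 / 2))) <= cos x ^+ (m + m) <=
  expR (- (m%:R * x ^+ 2) + m%:R * x ^+ 4 / 4).
Proof.
move=> x1; have x0 : 0 <= x ^+ 2 := sqr_ge0 x.
have c1 := cos_ge x.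
have api : `|x| <= pi.
  apply: le_trans (_ : 1 <= _); last by apply: le_trans (pi_ge2 R); rewrite ler1n.
  by rewrite -(@ler_pXn2r _ 2) ?nnegrE // expr1n real_normK ?num_real.
have c2 := cos_le_small api.
have c0 : 0 <= cos x by apply: le_trans c1; lra.
have t01 : 0 <= x ^+ 2 / 2 < 1 by apply/andP; split; lra.
have -> : cos x ^+ (m + m) = (cos x ^+ 2) ^+ m by rewrite -exprM mul2n addnn.
apply/andP; split.
  have -> : - (m%:R * x ^+ 2 / (1 - x ^+ 2 / 2)) = m%:R * (2 * - (x ^+ 2 / 2 / (1 - x ^+ 2 / 2))).
    by field; lra.
  rewrite expRM_natl lerXn2r ?nnegrE ?expR_ge0 ?sqr_ge0 //.
  rewrite expRM_natl lerXn2r ?nnegrE ?expR_ge0 //.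
  exact: le_trans (qpoch_step_le t01) c1.
have -> : - (m%:R * x ^+ 2) + m%:R * x ^+ 4 / 4 = m%:R * (2 * (- (x ^+ 2 / 2) + x ^+ 4 / 8)).
  by field.
rewrite expRM_natl lerXn2r ?nnegrE ?expR_ge0 ?sqr_ge0 //.
rewrite expRM_natl lerXn2r ?nnegrE ?expR_ge0 //.
by apply: le_trans c2 _; apply: le_trans (expR_ge1Dx _); rewrite addrA.
Qed.

Lemma cvg_cos_pow (a : R) :
  (fun n => cos (a / n%:R) ^+ (expo n + expo n)) @ \oo --> expR (- (s * a ^+ 2)).
Proof.
have [N1 hN1] : exists N, forall n, (N <= n)%N -> (a / n%:R) ^+ 2 <= 1.
  exists (Num.truncn (`|a|)).+1 => n hn.
  have n0 : 0 < n%:R :> R by rewrite ltr0n; lia.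
  rewrite -[X in X <= _]real_normK ?num_real // exprn_ile1 //.
  rewrite normrM normfV (ger0_norm (ltW n0)) ler_pdivrMr // mul1r.
  apply: le_trans (ltW (truncnS_gt _)) _; by rewrite ler_nat.
pose t n : R := (width n + width n).+1%:R / n%:R.
have ct : t @ \oo --> s := cvg_width.
have cx : (fun n : nat => (a / n%:R) ^+ 2 : R) @ \oo --> (0 : R).
  have c : (fun n : nat => a * n%:R^-1 : R) @ \oo --> (0 : R).
    rewrite -(mulr0 a); apply: cvgM; [exact: cvg_cst|exact: cvg_inv_nat].
  have cc : (fun n : nat => a * n%:R^-1 * (a * n%:R^-1) : R) @ \oo --> (0 * 0 : R) by apply: cvgM.
  rewrite mulr0 in cc; apply: (cvg_eventually (N0 := 0) _ cc) => n _.
  by rewrite expr2.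
apply: (@cvg_squeeze (fun n => expR (- (t n * a ^+ 2 / (1 - (a / n%:R) ^+ 2 / 2)))) _
  (fun n => expR (- (t n * a ^+ 2) + t n * a ^+ 2 * (a / n%:R) ^+ 2 / 4)) _ (maxn N1 1)).
- move=> n; rewrite geq_max => /andP[/hN1 x1 n1].
  have := cos_pow_bounds (expo n) x1; rewrite (expoE n1) -/(t n).
  have n0 : n%:R != 0 :> R by rewrite pnatr_eq0 -lt0n.
  have -> : t n * n%:R ^+ 2 * (a / n%:R) ^+ 2 = t n * a ^+ 2 by field.
  by have -> : t n * n%:R ^+ 2 * (a / n%:R) ^+ 4 = t n * a ^+ 2 * (a / n%:R) ^+ 2 by field.
- apply: cvg_expR; apply: cvgN.
  have -> : s * a ^+ 2 = s * a ^+ 2 * (1 - 0 / 2)^-1 by rewrite mul0r subr0 invr1 mulr1.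
  apply: cvgM; first by apply: cvgM => //; exact: cvg_cst.
  apply: cvgV; first by rewrite mul0r subr0 oner_neq0.
  by apply: cvgB; [exact: cvg_cst|apply: cvgM => //; exact: cvg_cst].
- apply: cvg_expR; rewrite -[X in _ --> X]addr0 -(mul0r (4^-1)) -(mulr0 (s * a ^+ 2)).
  have c1 : (fun n => t n * a ^+ 2) @ \oo --> s * a ^+ 2 by apply: cvgM => //; exact: cvg_cst.
  apply: cvgD; first exact: cvgN.
  by apply: cvgM; [apply: cvgM|exact: cvg_cst].
Qed.

(** The domination for Tannery's theorem; [b <= n] confines the angle to the first quadrant. *)
Lemma cos_pow_dom : exists2 N0, (0 < N0)%N & forall n k (b : R), (N0 <= n)%N ->
  k%:R <= b <= n%:R ->
  `|cos (pi * b / 2 / n%:R) ^+ (expo n + expo n)| <= expR (- (s * pi ^+ 2 / 16)) ^+ k.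
Proof.
have [N0 hN0] := width_eventually; exists N0.+1 => // n k b Nn /andP[kb bn].
have n1 : (0 < n)%N by lia.
have n0 : 0 < n%:R :> R by rewrite ltr0n.
have b0 : 0 <= b := le_trans (ler0n _ _) kb.
have p0 := pi_gt0 R; have p1 := ltW p0.
set x := pi * b / 2 / n%:R; set m := expo n.
have x0 : 0 <= x by rewrite /x !divr_ge0 ?mulr_ge0 // ltW.
have xpi : x <= pi / 2.
  rewrite /x ler_pdivrMr // [pi / 2 * _]mulrAC ler_pM2r ?invr_gt0 //.
  by rewrite ler_pM2l.
have c0 : 0 <= cos x by apply: cos_ge0_pihalf; rewrite xpi andbT (le_trans _ x0) // oppr_le0 divr_ge0.
have cx : cos x <= 1 - x ^+ 2 / 4 by apply: cos_le_dom; rewrite ger0_norm.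
rewrite ger0_norm ?exprn_ge0 //.
have -> : cos x ^+ (m + m) = (cos x ^+ 2) ^+ m by rewrite -exprM mul2n addnn.
apply: le_trans (_ : expR (m%:R * (2 * - (x ^+ 2 / 4))) <= _).
  rewrite expRM_natl lerXn2r ?nnegrE ?expR_ge0 ?sqr_ge0 //.
  rewrite expRM_natl lerXn2r ?nnegrE ?expR_ge0 //.
  exact: le_trans cx (expR_ge1Dx _).
rewrite -expRM_natl ler_expR /m expoE // !mulrN lerN2.
have /andP[t1 _] := hN0 n (ltnW Nn); move: t1; set t := _ / _ => t1.
have -> : k%:R * (s * pi ^+ 2 / 16) = s / 2 * (pi ^+ 2 / 8 * k%:R) by field.
have -> : t * n%:R ^+ 2 * (2 * (x ^+ 2 / 4)) = t * (pi ^+ 2 / 8 * b ^+ 2).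
  by rewrite /x; field; rewrite gt_eqF.
rewrite ler_pM //; first by rewrite divr_ge0 // ltW.
  by rewrite mulr_ge0 ?divr_ge0 ?sqr_ge0.
rewrite ler_wpM2l ?divr_ge0 ?sqr_ge0 //.
apply: le_trans (_ : k%:R ^+ 2 <= _); last by rewrite lerXn2r ?nnegrE.
by rewrite -natrX ler_nat leq_sqr.
Qed.

Definition binr (n k : nat) : R := 'C(expo n + expo n, expo n + k)%:R / 'C(expo n + expo n, expo n)%:R.

Lemma bin_mid_gt0 m : 0 < 'C(m + m, m)%:R :> R.
Proof. by rewrite ltr0n bin_gt0 leq_addr. Qed.

Lemma cvg_binr (mu : nat) :
  (fun n => binr n (n * mu)) @ \oo --> expR (- (mu%:R ^+ 2 / s)).
Proof.
have [N0 hN0] := width_eventually.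
pose t n : R := (width n + width n).+1%:R / n%:R.
have ct : t @ \oo --> s := cvg_width.
have cm : (fun n : nat => mu%:R * n%:R^-1 : R) @ \oo --> (0 : R).
  rewrite -(mulr0 (mu%:R)); apply: cvgM; [exact: cvg_cst|exact: cvg_inv_nat].
pose N1 := (Num.truncn (s^-1 * (mu%:R * 2))).+1.
have e1 (u : nat -> R) : u @ \oo --> s ->
    (fun n => expR (- (mu%:R ^+ 2 / u n))) @ \oo --> expR (- (mu%:R ^+ 2 / s)).
  move=> us; apply: cvg_expR; apply: cvgN; apply: cvgM; first exact: cvg_cst.
  by apply: cvgV => //; rewrite gt_eqF.
apply: (@cvg_squeeze (fun n => expR (- (mu%:R ^+ 2 / (t n - mu%:R * n%:R^-1)))) _
  (fun n => expR (- (mu%:R ^+ 2 / (t n + mu%:R * n%:R^-1)))) _ (maxn N0 N1)).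
- move=> n; rewrite geq_max => /andP[/hN0 /andP[t1 _] n1].
  have n0 : (0 < n)%N by lia.
  have nR : 0 < n%:R :> R by rewrite ltr0n.
  have nR' := lt0r_neq0 nR.
  have tE : (expo n)%:R = t n * n%:R ^+ 2 := expoE n0.
  have mt : mu%:R < t n * n%:R.
    apply: lt_le_trans (_ : s / 2 * n%:R <= _); last by rewrite ler_pM2r.
    rewrite mulrAC ltr_pdivlMr // mulrC -ltr_pdivrMl // mulrC.
    by apply: lt_le_trans (truncnS_gt _) _; rewrite ler_nat.
  have km : (n * mu < expo n)%N.
    by rewrite -(ltr_nat R) tE natrM expr2 mulrA mulrC ltr_pM2r.
  have B0 := bin_mid_gt0 (expo n).
  have h1 : (n * mu <= n * mu <= expo n)%N by rewrite leqnn ltnW.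
  have h2 : (n * mu <= n * mu < expo n)%N by rewrite leqnn.
  have e0 : (0 < expo n)%N by apply: leq_trans (expo_ge n).
  have := bin_ratio_le h1 e0; have := bin_ratio_ge h2.
  rewrite /binr ler_pdivlMr // ler_pdivrMr // ![_ * expR _]mulrC.
  rewrite natrB ?(ltnW km) // natrD natrM tE.
  have -> : (n%:R * mu%:R) ^+ 2 / (t n * n%:R ^+ 2 - n%:R * mu%:R) =
      mu%:R ^+ 2 / (t n - mu%:R * n%:R^-1).
    have d1 : t n * n%:R - mu%:R != 0 by rewrite gt_eqF // subr_gt0.
    have -> : t n * n%:R ^+ 2 - n%:R * mu%:R = n%:R * (t n * n%:R - mu%:R) by ring.
    have -> : t n - mu%:R * n%:R^-1 = (t n * n%:R - mu%:R) / n%:R by field.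
    by move: d1; move: (t n * _ - _) => d d1; field; rewrite ?d1 ?nR'.
  have -> : (n%:R * mu%:R) ^+ 2 / (t n * n%:R ^+ 2 + n%:R * mu%:R) =
      mu%:R ^+ 2 / (t n + mu%:R * n%:R^-1).
    have d1 : t n * n%:R + mu%:R != 0.
      by rewrite gt_eqF // ltr_pwDl // (le_lt_trans _ mt).
    have -> : t n * n%:R ^+ 2 + n%:R * mu%:R = n%:R * (t n * n%:R + mu%:R) by ring.
    have -> : t n + mu%:R * n%:R^-1 = (t n * n%:R + mu%:R) / n%:R by field.
    by move: d1; move: (t n * _ + _) => d d1; field; rewrite ?d1 ?nR'.
  by move=> -> ->.
- apply: e1; rewrite -[X in _ --> X]subr0; exact: cvgB.
- apply: e1; rewrite -[X in _ --> X]addr0; exact: cvgD.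
Qed.

Lemma binr_dom : exists2 N0, (0 < N0)%N & forall n v, (N0 <= n)%N ->
  `|binr n (n * (v + v).+1)| <= expR (- (1 / (4 * s))) ^+ v.
Proof.
have [N0 hN0] := width_eventually; exists N0.+1 => // n v Nn.
have n0 : (0 < n)%N by lia.
have nR : 0 < n%:R :> R by rewrite ltr0n.
have [km|mk] := leqP (n * (v + v).+1) (expo n); last first.
  by rewrite /binr bin_small ?mul0r ?normr0 ?exprn_ge0 ?expR_ge0 // ltn_add2l.
have B0 := bin_mid_gt0 (expo n).
have h1 : (n * (v + v).+1 <= n * (v + v).+1 <= expo n)%N by rewrite leqnn.
have e0 : (0 < expo n)%N by apply: leq_trans (expo_ge n).
rewrite ger0_norm ?divr_ge0 ?ler0n // /binr ler_pdivrMr // mulrC.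
apply: le_trans (bin_ratio_le h1 e0) _; rewrite ler_pM2l // -expRM_natl ler_expR.
rewrite mulrN lerN2.
have /andP[_ t2] := hN0 n (ltnW Nn).
have eR : 0 < (expo n)%:R :> R by rewrite ltr0n.
apply: le_trans (_ : (n * (v + v).+1)%:R ^+ 2 / (2 * (expo n)%:R) <= _); last first.
  rewrite ler_wpM2l ?sqr_ge0 // lef_pV2 ?posrE ?mulr_gt0 ?ltr0n //; last by lia.
  by rewrite -natrM ler_nat; lia.
rewrite natrM (expoE n0); move: t2; set t := _ / n%:R => t2.
have t0 : 0 < t by rewrite divr_gt0 ?ltr0n.
have -> : (n%:R * (v + v).+1%:R) ^+ 2 / (2 * (t * n%:R ^+ 2)) = (v + v).+1%:R ^+ 2 / (2 * t).
  by field; rewrite !gt_eqF.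
rewrite mul1r ler_pM ?ler0n ?invr_ge0 ?mulr_ge0 ?(ltW s0) //.
  by rewrite -natrX ler_nat; nia.
have h : 2 * t <= 4 * s by rewrite (_ : 4 * s = 2 * (2 * s)) ?ler_pM2l //; ring.
by rewrite lef_pV2 // posrE mulr_gt0.
Qed.

End Width.

Definition wal (m : nat) : R := 'C(m + m, m)%:R / 4 ^+ m.

Lemma walS m : wal m.+1 = wal m * ((m + m).+1%:R / (m + m).+2%:R).
Proof.
have h1 : (m.+1 * 'C(m.+1 + m.+1, m.+1) = (m + m).+2 * 'C((m + m).+1, m))%N.
  by rewrite addnS addSn -mul_bin_diag.
have h2 : ((m + m).+1 * 'C(m + m, m) = m.+1 * 'C((m + m).+1, m))%N.
  by have := mul_bin_down (m + m).+1 m; rewrite /= => ->; congr (_ * _)%N; lia.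
have h3 : m.+1%:R * 'C(m.+1 + m.+1, m.+1)%:R = 2 * (m + m).+1%:R * 'C(m + m, m)%:R :> R.
  rewrite -!natrM; congr _%:R; rewrite h1 -mulnA h2; lia.
have m1 : m.+1%:R != 0 :> R by rewrite pnatr_eq0.
have f4 : 4 ^+ m != 0 :> R by rewrite expf_neq0 ?pnatr_eq0.
have -> : (m + m).+2%:R = 2 * m.+1%:R :> R by rewrite -natrM; congr _%:R; lia.
apply: (mulfI m1); rewrite /wal exprS [LHS]mulrA h3.
move: m1 f4; move: m.+1%:R (4 ^+ m) (m + m).+1%:R 'C(m + m, m)%:R => u v w b u0 v0.
by field; rewrite u0 v0.
Qed.

(** The sequence increases and stays below 1. Its limit is left anonymous; [theta_inversion] shows
    that it is the inverse of [pi]. *)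
Lemma wallis_cvg : exists2 K : R, 0 <= K & (fun m => m%:R * wal m ^+ 2) @ \oo --> K.
Proof.
have w0 m : 0 <= wal m by rewrite divr_ge0 ?exprn_ge0.
have mono : nondecreasing_seq (fun m => m%:R * wal m ^+ 2).
  apply/nondecreasing_seqP => m; rewrite walS; move: (wal m) => w.
  rewrite exprMn [X in _ <= X]mulrCA [X in X <= _]mulrC.
  rewrite ler_wpM2l ?sqr_ge0 // expr_div_n mulrA ler_pdivlMr ?exprn_gt0 //.
  by rewrite -!natrX -!natrM ler_nat; nia.
have bnd m : (m + m).+1%:R * wal m ^+ 2 <= 1.
  elim: m => [|m IH]; first by rewrite /wal bin0 divr1 expr1n mulr1.
  apply: le_trans IH; rewrite walS; move: (wal m) => w.
  rewrite exprMn [X in X <= _]mulrCA [X in _ <= X]mulrC.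
  rewrite ler_wpM2l ?sqr_ge0 // expr_div_n mulrA ler_pdivrMr ?exprn_gt0 //.
  by rewrite -!natrX -!natrM ler_nat; nia.
have ub : has_ubound (range (fun m => m%:R * wal m ^+ 2)).
  exists 1 => _ [m _ <-]; apply: le_trans (bnd m); rewrite ler_wpM2r ?sqr_ge0 // ler_nat; lia.
exists (sup (range (fun m => m%:R * wal m ^+ 2))).
  by apply: ub_le_sup => //; exists 0%N; rewrite ?mul0r.
exact: nondecreasing_cvgn.
Qed.

Lemma cvg_wal (s K : R) : 0 < s -> (fun m => m%:R * wal m ^+ 2) @ \oo --> K ->
  (fun n => 4 * n%:R * wal (expo s n)) @ \oo --> Num.sqrt (16 * K / s).
Proof.
move=> s0 hK; pose t n : R := (width s n + width s n).+1%:R / n%:R.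
apply: (@cvg_eventually (fun n =>
  Num.sqrt (16 * ((expo s n)%:R * wal (expo s n) ^+ 2) / t n)) _ _ 1).
  move=> n n0; have nR : 0 < n%:R :> R by rewrite ltr0n.
  have nR' := lt0r_neq0 nR; have t0 : t n != 0.
    by rewrite gt_eqF // divr_gt0 ?ltr0n.
  have -> : 16 * ((expo s n)%:R * wal (expo s n) ^+ 2) / t n = (4 * n%:R * wal (expo s n)) ^+ 2.
    by rewrite (expoE _ n0) -/(t n); move: (wal _) (t n) t0 => w u u0; field.
  by rewrite sqrtr_sqr ger0_norm // !mulr_ge0 ?ler0n // invr_ge0 exprn_ge0.
apply: continuous_cvg; first exact: sqrt_continuous.
apply: cvgM; last by apply: cvgV; [rewrite gt_eqF|exact: cvg_width].
apply: cvgM; first exact: cvg_cst.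
have := cvg_comp _ _ (_ : (fun n => expo s n) @ \oo --> \oo) hK; apply.
move=> A [N _ hA]; exists N => // n /= Nn; apply: hA => /=.
exact: leq_trans Nn (expo_ge s n).
Qed.

Lemma cos_half_sum (s b : R) l : 0 < s -> 0 <= b <= 1 ->
  ctends (fun n => \sum_(k < n) (-1) ^+ k * (expR (- (s * (pi * (k%:R + b) / 2) ^+ 2)))%:C) l ->
  ctends (fun n => \sum_(k < n) (-1) ^+ k *
    (cos (pi * (k%:R + b) / 2 / n%:R) ^+ (expo s n + expo s n))%:C) l.
Proof.
move=> s0 /andP[b0 b1] hl; have p0 := pi_gt0 R.
have [N0 N00 hN0] := cos_pow_dom s0.
have ps : 0 < s * pi ^+ 2 / 16 by rewrite divr_gt0 ?mulr_gt0 ?exprn_gt0.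
apply: (@tannery R (fun n k => (-1) ^+ k *
    (cos (pi * (k%:R + b) / 2 / n%:R) ^+ (expo s n + expo s n))%:C)
  (fun k => (-1) ^+ k * (expR (- (s * (pi * (k%:R + b) / 2) ^+ 2)))%:C)
  id N0 1 (expR (- (s * pi ^+ 2 / 16)))) hl => //.
- by rewrite expR_ge0 expR_lt1 oppr_lt0.
- move=> n k Nn kn; rewrite normcM nc_sign nc_real !mul1r; apply: hN0 => //.
  rewrite lerDl b0 /=; apply: le_trans (_ : k.+1%:R <= _); last by rewrite ler_nat.
  by rewrite -[k.+1%:R]natr1 lerD2l.
- move=> k; rewrite normcM nc_sign nc_real !mul1r ger0_norm ?expR_ge0 //.
  rewrite -expRM_natl ler_expR mulrN lerN2.
  have -> : k%:R * (s * pi ^+ 2 / 16) = s * pi ^+ 2 / 16 * k%:R by ring.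
  have -> : s * (pi * (k%:R + b) / 2) ^+ 2 = s * pi ^+ 2 / 16 * (4 * (k%:R + b) ^+ 2) by field.
  rewrite ler_pM2l //; apply: le_trans (_ : k%:R ^+ 2 <= _).
    by rewrite -natrX ler_nat leq_sqr.
  have : k%:R ^+ 2 <= (k%:R + b) ^+ 2 by rewrite lerXn2r ?nnegrE ?addr_ge0 // lerDl.
  have := sqr_ge0 (k%:R + b); move: ((_ + b) ^+ 2) (k%:R ^+ 2) => u w; lra.
- move=> k; apply: ctendsMl; apply: ctends_real; exact: cvg_cos_pow.
Qed.

(** The limit of [polya_identity] for [N = n] and exponent [2 * expo s n]. The sum [la] comes from
    the indices [j >= N], and [lb] from those below, read backwards. *)
Lemma poisson : exists2 K : R, 0 <= K & forall (s al : R) la lb lc, 0 < s -> 0 <= al <= 1 ->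
  ctends (fun n => \sum_(k < n) (-1) ^+ k * (expR (- (s * (pi * (k%:R + al) / 2) ^+ 2)))%:C) la ->
  ctends (fun n => \sum_(k < n) (-1) ^+ k * (expR (- (s * (pi * (k%:R + (1 - al)) / 2) ^+ 2)))%:C) lb ->
  ctends (fun n => \sum_(v < n) (expR (- ((v + v).+1%:R ^+ 2 / s)))%:C *
     (cos ((v + v).+1%:R * (pi * al)))%:C) lc ->
  la - lb = (Num.sqrt (16 * K / s))%:C * lc.
Proof.
have [K K0 hK] := wallis_cvg; exists K => // s al la lb lc s0 al01 ha hb hc.
have /andP[al0 al1] := al01.
have bl01 : 0 <= 1 - al <= 1 by apply/andP; split; lra.
have h1 := ctendsD (cos_half_sum s0 al01 ha) (ctendsMl (-1) (cos_half_sum s0 bl01 hb)).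
have [N0 N00 hN0] := binr_dom s0.
(* The range is padded by [n] zero terms, since [tannery] asks for at least [n] terms; the extra
   binomials vanish. *)
have h2 : ctends (fun n => \sum_(v < (width s n).+1 + n) (binr s n (n * (v + v).+1))%:C *
     (cos ((v + v).+1%:R * (pi * al)))%:C) lc.
  apply: (@tannery R (fun n v => (binr s n (n * (v + v).+1))%:C *
     (cos ((v + v).+1%:R * (pi * al)))%:C)
     (fun v => (expR (- ((v + v).+1%:R ^+ 2 / s)))%:C * (cos ((v + v).+1%:R * (pi * al)))%:C)
     (fun n => (width s n).+1 + n)%N N0 1
     (expR (- (1 / (4 * s))))) hc.
  - by rewrite expR_ge0 expR_lt1 oppr_lt0 divr_gt0 ?mulr_gt0.
  - move=> n v Nn _; rewrite normcM !nc_real mul1r -[X in _ <= X]mulr1.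
    by rewrite ler_pM ?normr_ge0 ?hN0 // cos_max.
  - move=> v; rewrite normcM !nc_real mul1r -[X in _ <= X]mulr1.
    rewrite ler_pM ?normr_ge0 ?cos_max // ger0_norm ?expR_ge0 // -expRM_natl ler_expR.
    rewrite mulrN lerN2 div1r invfM mulrA ler_wpM2r ?invr_ge0 ?(ltW s0) //.
    apply: le_trans (_ : v%:R <= _); first by rewrite ler_pdivrMr // ler_peMr // ler1n.
    by rewrite -natrX ler_nat; nia.
  - move=> v; have := ctendsMl (cos ((v + v).+1%:R * (pi * al)))%:C (ctends_real (@cvg_binr s s0 (v + v).+1)).
    by rewrite [X in ctends _ X]mulrC; apply: ctends_eq => n; rewrite mulrC.
  - by move=> n; rewrite leq_addl.
have h3 := ctendsM (ctends_real (cvg_wal s0 hK)) h2.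
rewrite -mulN1r; apply: ctends_unique h1 _.
apply: (ctends_eventually (N0 := 1)) h3 => n n0; set m := expo s n.
have nR : n%:R != 0 :> R by rewrite pnatr_eq0 -lt0n.
have B0 := lt0r_neq0 (bin_mid_gt0 m).
have := @polya_identity n (width s n) al n0; rewrite /= -/(expo s n) -/m.
rewrite (sum_split_half (fun j => (-1) ^+ (n + j) *
  ((cos (pi * (j%:R - n%:R + al) / (2 * n%:R)))%:C) ^+ (m + m))) => e.
have -> : \sum_(k < n) (-1) ^+ k * (cos (pi * (k%:R + al) / 2 / n%:R) ^+ (m + m))%:C =
   \sum_(k < n) (-1) ^+ (n + (n + k)) *
     ((cos (pi * ((n + k)%:R - n%:R + al) / (2 * n%:R)))%:C) ^+ (m + m).
  apply: eq_bigr => k _; rewrite rmorphXn /=; congr (_ * (cos _)%:C ^+ _).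
    by rewrite addnA addnn -mul2n exprD exprM sqrrN expr1n expr1n mul1r.
  by rewrite natrD; field.
have -> : -1 * \sum_(k < n) (-1) ^+ k * (cos (pi * (k%:R + (1 - al)) / 2 / n%:R) ^+ (m + m))%:C =
   \sum_(k < n) (-1) ^+ (n + (n.-1 - k)) *
     ((cos (pi * ((n.-1 - k)%:R - n%:R + al) / (2 * n%:R)))%:C) ^+ (m + m).
  rewrite mulr_sumr; apply: eq_bigr => k _; have kn := ltn_ord k.
  rewrite mulrA rmorphXn /=; congr (_ * (_)%:C ^+ _).
    rewrite -exprS -signr_odd -[RHS]signr_odd; congr ((-1) ^+ nat_of_bool _); lia.
  rewrite -cosN; congr cos.
  have -> : ((n.-1 - k)%N%:R : R) = n%:R - 1 - k%:R.
    have -> : n%:R = (n.-1 - k)%:R + 1 + k%:R :> R by rewrite natr1 -natrD; congr _%:R; lia.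
    by ring.
  by field.
rewrite [RHS]e big_split_ord /= [X in _ + X]big1 ?addr0; last first.
  move=> v _; rewrite /binr bin_small ?mul0r ?mul0r //.
  by rewrite ltn_add2l /expo ltn_pmul2l //; lia.
have f4 : 4 ^+ m != 0 :> R by rewrite expf_neq0 ?pnatr_eq0.
have -> : 4 * n%:R / 4 ^+ m = 4 * n%:R * wal m / 'C(m + m, m)%:R.
  by rewrite /wal; move: 'C(m + m, m)%:R (4 ^+ m) B0 f4 => u v u0 v0; field; rewrite u0 v0.
rewrite (rmorphM (real_complex R) (4 * n%:R * wal m)) -[RHS]mulrA; congr (_ * _); rewrite mulr_sumr; apply: eq_bigr => v _.
rewrite [RHS]mulrA; congr (_ * _); rewrite /binr -/m.
by rewrite (rmorphM (real_complex R)) (rmorph_nat (real_complex R)) mulrC.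
Qed.

Lemma ctends_multiples (g : nat -> C) (M : nat) B r l : 0 <= r < 1 -> (0 < M)%N ->
  (forall k, nc (g k) <= B * r ^+ k) ->
  ctends (fun n => \sum_(k < M * n) g k) l -> ctends (fun n => \sum_(k < n) g k) l.
Proof.
move=> r01 M0 gB hl.
have B0 : 0 <= B by have := gB 0%N; rewrite expr0 mulr1; apply: le_trans; exact: nc_ge0.
have [|l' hl'] := @geo_cvg R (fun n => \sum_(k < n) g k) B r B0 r01.
  by move=> n; rewrite big_ord_recr /= addrAC subrr add0r.
have h := geo_ctends r01 hl'.
suff -> : l = l' by [].
apply: ctends_unique hl _.
by apply: (@ctends_sub R (fun n => \sum_(k < n) g k) l' (muln M)) => // n; nia.
Qed.

Lemma ctends_lac (x : nat -> nat) (c0 y : R) (E : nat -> R) : (forall n, (n <= x n)%N) ->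
  (forall k, E k = c0 + 2 * pi * y * (x k)%:R) -> 0 < y ->
  ctends (fun n => \sum_(k < n) (-1) ^+ k * (expR (- E k))%:C)
    ((expR (- c0))%:C * lac x (expR (- (2 * pi * y)))%:C).
Proof.
move=> hx EE y0; have p0 := pi_gt0 R.
have q1 : nc (expR (- (2 * pi * y)))%:C < 1.
  by rewrite nc_real ger0_norm ?expR_ge0 // expR_lt1 oppr_lt0 !mulr_gt0.
apply: (ctends_eq _ (ctendsMl _ (lac_ctends hx q1))) => n.
rewrite mulr_sumr; apply: eq_bigr => k _; rewrite mulrCA EE opprD expRD rmorphM /=.
by rewrite -(rmorphXn (real_complex R)) -expRM_natl mulrN [(x k)%:R * _]mulrC.
Qed.

Lemma triR n : (tri n)%:R = (n%:R ^+ 2 - n%:R) / 2 :> R.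
Proof.
elim: n => [|n IH] /=; first by rewrite expr0n subrr mul0r.
by rewrite natrD IH -natr1; field.
Qed.

Lemma thexpR M e n : (thexp M e n)%:R = M%:R * (n%:R ^+ 2 - n%:R) / 2 + e%:R * n%:R :> R.
Proof. by rewrite /thexp natrD !natrM triR mulrA. Qed.

(** * Theta values on the imaginary axis and their inversion *)

Section Inversion.
Variable h : nat.
Let M := (h + h).+1.

(** The exponential is [q ^ ((2 j + 1) ^ 2 / (8 M))] at [q = exp (- 2 pi y)]: with it the exponents
    of the series become complete squares. [M = 13] yields the theta constants up to sign, and
    [M = 3] yields [eta]. *)
Definition thv (j : nat) (y : R) : C :=
  (expR (- (pi * y * (j + j).+1%:R ^+ 2 / (4 * M%:R))))%:C *
  bilac M (h + j).+1 (expR (- (2 * pi * y)))%:C.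

Lemma thv_ctends j (y : R) : (j < h)%N -> 0 < y -> exists la lb, [/\ thv j y = la - lb,
  ctends (fun n => \sum_(k < n) (-1) ^+ k *
    (expR (- (pi * M%:R * y * (k%:R + (j + j).+1%:R / (2 * M%:R)) ^+ 2)))%:C) la &
  ctends (fun n => \sum_(k < n) (-1) ^+ k *
    (expR (- (pi * M%:R * y * (k%:R + (1 - (j + j).+1%:R / (2 * M%:R))) ^+ 2)))%:C) lb].
Proof.
move=> jh y0; rewrite /thv /bilac mulrBr.
have M0 : M%:R != 0 :> R by rewrite pnatr_eq0.
have ME : M%:R = h%:R + h%:R + 1 :> R by rewrite /M -natr1 natrD.
have jE : (j + j).+1%:R = j%:R + j%:R + 1 :> R by rewrite -natr1 natrD.
have eE : (h + j).+1%:R = (M%:R + (j + j).+1%:R) / 2 :> R.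
  by rewrite ME jE -natr1 natrD; field.
have fE : (M - (h + j).+1)%:R = (M%:R - (j + j).+1%:R) / 2 :> R.
  rewrite natrB ?eE; last by rewrite /M; lia.
  by field.
eexists; eexists; split; first reflexivity.
  apply: (@ctends_lac _ _ y (fun k => pi * M%:R * y * (k%:R + (j + j).+1%:R / (2 * M%:R)) ^+ 2)) => // [n|k].
    exact: thexp_ge.
  by rewrite thexpR eE; move: M%:R M0 (j + j).+1%:R => m m0 l; field.
apply: (@ctends_lac (fun n => thexp M (M - (h + j).+1) n.+1) _ y
  (fun k => pi * M%:R * y * (k%:R + (1 - (j + j).+1%:R / (2 * M%:R))) ^+ 2)) => // [n|k].
  by apply: leq_trans (thexp_ge _ _ _); rewrite ?leqnSn // subn_gt0 /M; lia.
rewrite thexpR fE -[k.+1%:R]natr1; move: M%:R M0 (j + j).+1%:R => m m0 l; field.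
exact: m0.
Qed.

(** The odd numbers [2 v + 1] are sorted modulo [2 M]: the residues [i] and [M - 1 - i] give
    opposite classes, and the middle one, [h], is the odd multiples of [M]. *)
Lemma sum_blocks (g : nat -> C) n : (forall k, g (M * k + h)%N = 0) ->
  \sum_(v < M * n) g v = \sum_(i < h) (\sum_(k < n) g (M * k + i)%N
    + \sum_(k < n) g (M * k + (M.-1 - i))%N).
Proof.
move=> g0; elim: n => [|n IH].
  by rewrite muln0 big_ord0 big1 // => i _; rewrite !big_ord0 addr0.
rewrite mulnS addnC big_split_ord /= {}IH.
under [RHS]eq_bigr do rewrite !big_ord_recr /= addrACA.
rewrite [RHS]big_split /=; congr (_ + _); rewrite [RHS]big_split /=.
have -> : \sum_(i < M) g (M * n + i)%N = \sum_(i < h + h.+1) g (M * n + i)%N.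
  by rewrite /M addnS.
rewrite big_split_ord big_ord_recl /= addn0 g0 add0r; congr (_ + _).
rewrite (reindex_inj rev_ord_inj) /=; apply: eq_bigr => i _.
by congr g; have := ltn_ord i; rewrite /bump /M /=; lia.
Qed.

Lemma theta_poisson (K : R) : (forall (s al : R) la lb lc, 0 < s -> 0 <= al <= 1 ->
  ctends (fun n => \sum_(k < n) (-1) ^+ k * (expR (- (s * (pi * (k%:R + al) / 2) ^+ 2)))%:C) la ->
  ctends (fun n => \sum_(k < n) (-1) ^+ k * (expR (- (s * (pi * (k%:R + (1 - al)) / 2) ^+ 2)))%:C) lb ->
  ctends (fun n => \sum_(v < n) (expR (- ((v + v).+1%:R ^+ 2 / s)))%:C *
     (cos ((v + v).+1%:R * (pi * al)))%:C) lc ->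
  la - lb = (Num.sqrt (16 * K / s))%:C * lc) -> forall j (y : R), (j < h)%N -> 0 < y ->
  thv j y = (Num.sqrt (4 * (K * pi) / (M%:R * y)))%:C * \sum_(i < h)
    (cos (pi * ((j + j).+1%:R * (i + i).+1%:R) / (2 * M%:R)))%:C * thv i y^-1.
Proof.
move=> hK j y jh y0; have p0 := pi_gt0 R.
have M1 : 0 < M%:R :> R by rewrite ltr0n.
have M0 := lt0r_neq0 M1; have y1 := lt0r_neq0 y0; have p1 := lt0r_neq0 p0.
(* This value turns the Gaussian of [poisson] into that of [thv_ctends] at [y], and the dual
   Gaussian into the one at [y^-1]. *)
pose s : R := 4 * M%:R * y / pi; have s0 : 0 < s by rewrite divr_gt0 ?mulr_gt0.
have s1 := lt0r_neq0 s0.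
have sE (x : R) : s * (pi * x / 2) ^+ 2 = pi * M%:R * y * x ^+ 2.
  by rewrite /s; move: M%:R M0 (pi : R) p1 => m m0 p p1; field.
pose al : R := (j + j).+1%:R / (2 * M%:R).
have al01 : 0 <= al <= 1.
  rewrite /al divr_ge0 ?mulr_ge0 ?ler0n //= ler_pdivrMr ?mulr_gt0 // mul1r.
  by rewrite -natrM ler_nat /M; lia.
have [la [lb [-> ha hb]]] := thv_ctends jh y0.
have -> : 4 * (K * pi) / (M%:R * y) = 16 * K / s.
  by rewrite /s; move: M%:R M0 (pi : R) p1 => m m0 p p1; field; rewrite ?m0 ?y1 ?p1.
apply: (hK s al) => //.
- by apply: ctends_eq ha => n; apply: eq_bigr => k _; rewrite sE.
- by apply: ctends_eq hb => n; apply: eq_bigr => k _; rewrite sE.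
pose g v : C := (expR (- ((v + v).+1%:R ^+ 2 / s)))%:C * (cos ((v + v).+1%:R * (pi * al)))%:C.
have jj : (-1) ^+ (j + j).+1 = -1 :> R by rewrite sign_odd2.
have vE (k i : nat) : ((M * k + i) + (M * k + i)).+1%:R = 2 * M%:R * k%:R + (i + i).+1%:R :> R.
  by rewrite -natrM -natrM -natrD odd_block.
have vE2 (k i : nat) : (i < h)%N ->
    ((M * k + (M.-1 - i)) + (M * k + (M.-1 - i))).+1%:R = 2 * M%:R * k.+1%:R - (i + i).+1%:R :> R.
  move=> ih; apply/eqP; rewrite eq_sym subr_eq -natrM -natrM -natrD; apply/eqP.
  by rewrite (odd_block_rev k ih).
have cosE (a : R) (k : nat) : cos (a + (j + j).+1%:R * k%:R * pi) = (-1) ^+ k * cos a.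
  by rewrite -natrM cos_addn exprM sign_odd2.
pose th i : R := pi * ((j + j).+1%:R * (i + i).+1%:R) / (2 * M%:R).
have g1 k i : g (M * k + i)%N = (cos (th i))%:C * ((-1) ^+ k *
    (expR (- (pi * M%:R * y^-1 * (k%:R + (i + i).+1%:R / (2 * M%:R)) ^+ 2)))%:C).
  rewrite /g vE.
  have -> : (2 * M%:R * k%:R + (i + i).+1%:R) * (pi * al) = th i + (j + j).+1%:R * k%:R * pi.
    by rewrite /th /al; move: M%:R M0 (j + j).+1%:R (i + i).+1%:R => m m0 u v; field.
  have -> : (2 * M%:R * k%:R + (i + i).+1%:R) ^+ 2 / s =
      pi * M%:R * y^-1 * (k%:R + (i + i).+1%:R / (2 * M%:R)) ^+ 2.
    rewrite /s; move: M%:R M0 (pi : R) p1 (i + i).+1%:R => m m0 p p1 u; field; by rewrite ?m0 ?y1 ?p1.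
  by rewrite cosE rmorphM rmorphXn rmorphN1 /=; ring.
have g2 k i : (i < h)%N -> g (M * k + (M.-1 - i))%N = - ((cos (th i))%:C * ((-1) ^+ k *
    (expR (- (pi * M%:R * y^-1 * (k%:R + (1 - (i + i).+1%:R / (2 * M%:R))) ^+ 2)))%:C)).
  move=> ih; rewrite /g vE2 //.
  have -> : (2 * M%:R * k.+1%:R - (i + i).+1%:R) * (pi * al) = - th i + (j + j).+1%:R * k.+1%:R * pi.
    by rewrite /th /al; move: M%:R M0 (j + j).+1%:R (i + i).+1%:R k.+1%:R => m m0 u v w; field.
  have -> : (2 * M%:R * k.+1%:R - (i + i).+1%:R) ^+ 2 / s =
      pi * M%:R * y^-1 * (k%:R + (1 - (i + i).+1%:R / (2 * M%:R))) ^+ 2.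
    rewrite /s -[k.+1%:R]natr1; move: M%:R M0 (pi : R) p1 (i + i).+1%:R => m m0 p p1 u; field; by rewrite ?m0 ?y1 ?p1.
  by rewrite cosE cosN [(-1) ^+ k.+1]exprS rmorphM rmorphM rmorphXn rmorphN1 /=; ring.
(* For [2 v + 1] an odd multiple of [M] the angle is an odd multiple of [pi / 2]. *)
have g0 k : g (M * k + h)%N = 0.
  rewrite g1 (_ : th h = pi / 2 + j%:R * pi).
    by rewrite cos_addn cos_pihalf mulr0 mul0r.
  by rewrite /th -/M -[(j + j).+1%:R]natr1 natrD; move: M%:R M0 => m m0; field.
have es : 0 < s^-1 by rewrite invr_gt0.
apply: (@ctends_multiples g M 1 (expR (- s^-1))) => //.
- by rewrite expR_ge0 expR_lt1 oppr_lt0.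
- move=> v; rewrite /g normcM !nc_real mul1r -[X in _ <= X]mulr1.
  rewrite ler_pM ?normr_ge0 ?cos_max // ger0_norm ?expR_ge0 // -expRM_natl ler_expR.
  rewrite mulrN lerN2 ler_wpM2r ?(ltW es) //.
  by rewrite -natrX ler_nat (leq_trans _ (leq_sqr _)) // leqW ?leq_addr.
apply: (ctends_eq (fun n => esym (sum_blocks n g0))).
apply: ctends_sum => i; have yi : 0 < y^-1 by rewrite invr_gt0.
have [a [b [-> hia hib]]] := thv_ctends (ltn_ord i) yi.
rewrite -/(th i).
have -> : (cos (th i))%:C * (a - b) = (cos (th i))%:C * a + -1 * ((cos (th i))%:C * b) by ring.
apply: (ctends_eq _ (ctendsD (ctendsMl _ hia) (ctendsMl _ (ctendsMl _ hib)))) => n.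
rewrite mulN1r !mulr_sumr -sumrN; congr (_ + _).
  by apply: eq_bigr => k _; rewrite g1.
by apply: eq_bigr => k _; rewrite g2.
Qed.

End Inversion.

Lemma thv_eta_neq0 (y : R) : 0 < y -> thv 1 0 y != 0.
Proof.
move=> y0; have p0 := pi_gt0 R.
have q1 : nc (expR (- (2 * pi * y)))%:C < 1.
  by rewrite nc_real ger0_norm ?expR_ge0 // expR_lt1 oppr_lt0 !mulr_gt0.
have e0 (x : R) : (expR x)%:C != 0 :> C.
  by rewrite -nc_gt0 nc_real normr_gt0 gt_eqF ?expR_gt0.
by rewrite /thv mulf_neq0 // pentagonal // euler_neq0.
Qed.

Lemma cos_pi6 : cos (pi / 6) = Num.sqrt 3 / 2 :> R.
Proof.
have p0 := pi_gt0 R; set c : R := cos (pi / 6).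
have c0 : 0 < c by apply: cos_gt0_pihalf; apply/andP; split; lra.
have e : cos (pi / 2 : R) = 4 * c ^+ 3 - 3 * c.
  have -> : pi / 2 = (pi / 6) *+ 2 + pi / 6 :> R by rewrite mulr2n; field.
  rewrite cosD cos_mulr2n sin_mulr2n -/c.
  have := cos2Dsin2 (pi / 6 : R); rewrite -/c; move: (sin _) => t ht.
  have -> : (c * t *+ 2) * t = 2 * c * (t ^+ 2) by rewrite mulr2n; ring.
  have -> : t ^+ 2 = 1 - c ^+ 2 by rewrite -ht; ring.
  by rewrite mulr2n; ring.
have c2 : c ^+ 2 = 3 / 4.
  move: e; rewrite cos_pihalf => /esym/eqP.
  have -> : 4 * c ^+ 3 - 3 * c = c * (4 * c ^+ 2 - 3) by ring.
  rewrite mulf_eq0 gt_eqF //= subr_eq0 => /eqP <-.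
  by field.
rewrite -[c]ger0_norm ?(ltW c0) // -sqrtr_sqr c2 sqrtrM //.
rewrite sqrtrV // (_ : 4 = 2 ^+ 2 :> R) ?sqrtr_sqr ?ger0_norm //; ring.
Qed.

(** The unknown constant is found at [h = 1], [y = 1]: there inversion maps the nonzero value
    [thv 1 0 1] to itself, so the factor, which contains [cos (pi / 6)], must be 1. *)
Lemma theta_inversion h j (y : R) : (j < h)%N -> 0 < y ->
  thv h j y = (Num.sqrt (4 / ((h + h).+1%:R * y)))%:C * \sum_(i < h)
    (cos (pi * ((j + j).+1%:R * (i + i).+1%:R) / (2 * (h + h).+1%:R)))%:C * thv h i y^-1.
Proof.
have [K K0 hK] := poisson; have p0 := pi_gt0 R; move=> jh y0.
suff Kpi : K * pi = 1 by have := theta_poisson hK jh y0; rewrite Kpi mulr1.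
have := @theta_poisson 1 K hK 0 1 (ltn0Sn 0) ltr01.
rewrite big_ord_recl big_ord0 addr0 invr1 /=.
have -> : 4 * (K * pi) / ((1 + 1).+1%:R * 1) = 4 * (K * pi) / 3 by rewrite mulr1.
have -> : pi * ((0 + 0).+1%:R * (0 + 0).+1%:R) / (2 * (1 + 1).+1%:R) = pi / 6 :> R.
  by rewrite !mulr1 -natrM.
move=> e.
have : (Num.sqrt (4 * (K * pi) / 3))%:C * (cos (pi / 6))%:C = 1 :> C.
  by apply: (mulIf (thv_eta_neq0 ltr01)); rewrite mul1r -[LHS]mulrA -e.
rewrite cos_pi6 -rmorphM /= => -[] /(congr1 (fun x => x ^+ 2)).
rewrite expr1n exprMn expr_div_n !sqr_sqrtr ?ler0n //; last first.
  by rewrite divr_ge0 ?mulr_ge0 // ltW.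
by move=> h1; lra.
Qed.

End Polya.

(** * The cusp form Phi12(a) - eta^12 *)

Section ThetaConstants.
Variable R : realType.
Local Notation C := R[i].
Local Notation nc := (@normc R).
Implicit Types z : C.

Lemma quad_intr (n l : int) :
  (13 * n ^+ 2 + l * n)%:~R = 13 * n%:~R ^+ 2 + l%:~R * n%:~R :> R.
Proof. by rewrite !expr2 intrD !intrM. Qed.

Lemma theta_bilac (e l : int) j z : l = Posz (j + j).+1 -> (j < 6)%N -> 0 < complex.Im z ->
  theta e l z = qpow z (e%:~R / 104) * bilac 13 (6 + j).+1 (qpow z 1).
Proof.
move=> -> j6 z0; rewrite /theta; congr (_ * _); rewrite /bilateral_sum /bilac.
have jE : (j + j).+1%:R = j%:R + j%:R + 1 :> R by rewrite -natr1 natrD.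
have q1 : nc (qpow z 1) < 1 by apply: nc_qpow_lt1.
congr (_ + _).
  apply: (@ctends_lim R (series (fun n => (-1) ^ (Posz n) *
    qpow z (1 / 2 * (13 * (Posz n) ^+ 2 + Posz (j + j).+1 * Posz n)%:~R)))).
  have he n : (n <= thexp 13 (6 + j).+1 n)%N by apply: thexp_ge.
  apply: (ctends_eq _ (lac_ctends he q1)) => n.
  rewrite /series /= big_mkord; apply: eq_bigr => k _; congr (_ * _).
  rewrite -qpow_nat; congr qpow; rewrite thexpR quad_intr.
  by rewrite -!pmulrn jE -[(6 + j).+1%:R]natr1 natrD; field.
apply: (@ctends_lim R (series (fun n => (-1) ^ (Negz n) *
  qpow z (1 / 2 * (13 * (Negz n) ^+ 2 + Posz (j + j).+1 * Negz n)%:~R)))).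
have he n : (n <= thexp 13 (13 - (6 + j).+1) n.+1)%N.
  by apply: leq_trans (thexp_ge _ _ _); rewrite ?leqnSn // subn_gt0; lia.
rewrite -[- lac _ _]mulN1r; apply: (ctends_eq _ (ctendsMl (-1) (lac_ctends he q1))) => n.
rewrite /series /= big_mkord mulr_sumr; apply: eq_bigr => k _; rewrite mulrA; congr (_ * _).
  by rewrite -[(-1) ^ Negz k]/(((-1) ^+ k.+1)^-1) -exprVn invrN1 exprS.
rewrite -qpow_nat; congr qpow; rewrite thexpR quad_intr NegzE rmorphN /=.
rewrite -!pmulrn jE natrB; last by lia.
by rewrite -[(6 + j).+1%:R]natr1 natrD -[k.+1%:R]natr1; field.
Qed.

Lemma eta_euler z : eta z = qpow z (1 / 24) * euler (qpow z 1).
Proof.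
rewrite /eta /euler; congr (_ * infinite_prod _); apply/funext => n.
by rewrite qpow_nat.
Qed.

(** The linear coefficient in the exponents of the theta constant at position [i] is
    [2 * tidx i + 1]. *)
Definition tidx (i : nat) : nat := nth 0%N [:: 5; 3; 2; 1; 4; 0]%N i.

Lemma theta13E z (i : 'I_6) : 0 < complex.Im z -> theta13 z i =
  (-1) ^+ (i == 3 :> nat) * (qpow z ((tidx i + tidx i).+1%:R ^+ 2 / 104) *
    bilac 13 (6 + tidx i).+1 (qpow z 1)).
Proof.
move=> z0; rewrite /theta13 (tnth_nth 0).
have th (e l : int) j : l = Posz (j + j).+1 -> e = Posz ((j + j).+1 ^ 2) -> (j < 6)%N ->
    theta e l z = qpow z ((j + j).+1%:R ^+ 2 / 104) * bilac 13 (6 + j).+1 (qpow z 1).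
  by move=> lE -> j6; rewrite (theta_bilac _ lE) // -pmulrn natrX.
case: i => -[|[|[|[|[|[|//]]]]]] ilt; rewrite /= ?mul1r ?mulN1r ?expr0 ?expr1 ?mul1r ?mulN1r.
- exact: th.
- exact: th.
- exact: th.
- by congr (- _); apply: th.
- exact: th.
- exact: th.
Qed.

Definition psi (q : C) : C := FormsTheory.Psi (bilac 13 12 q) (bilac 13 10 q)
  (bilac 13 9 q) (bilac 13 8 q) (bilac 13 11 q) (bilac 13 7 q) q.

(** The defect without its factor [q^(1/2)], as a function of [q] on the whole disc, the cusp
    [q = 0] included. *)
Definition cusp (q : C) : C := psi q - euler q ^+ 12.

Definition defect z : C := Forms.eval (theta13 z) (Forms.Phi12 C) - eta z ^+ 12.

Lemma defectE z : 0 < complex.Im z ->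
  defect z = qpow z (1 / 2) * cusp (qpow z 1).
Proof.
move=> z0; rewrite /defect /cusp mulrBr eta_euler exprMn -qpowX; congr (_ - _ * _); last first.
  by congr qpow; field.
pose u := qpow z (1 / 104).
have uX n : u ^+ n = qpow z (n%:R / 104) by rewrite -qpowX mul1r.
have -> : qpow z (1 / 2) = u ^+ 52 by rewrite uX; congr qpow; field.
apply: FormsTheory.Phi12_scaled; rewrite ?theta13E //= ?mul1r ?mulN1r ?uX.
- by congr qpow; field.
- by congr (qpow _ _ * _); rewrite -natrX.
- by congr (qpow _ _ * _); rewrite -natrX.
- by congr (qpow _ _ * _); rewrite -natrX.
- by congr (- (qpow _ _ * _)); rewrite -natrX.
- by congr (qpow _ _ * _); rewrite -natrX.
- by rewrite expr1n.
Qed.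

Lemma hol_cusp : hol cusp.
Proof.
apply: holD; last by apply: holN; apply: holX; exact: hol_euler.
apply: (@FormsTheory.Psi_closed C C (@hol R)).
- exact: hol_cst.
- exact: holD.
- exact: holM.
- exact: holN.
all: try by apply: hol_bilac.
exact: hol_id.
Qed.

Lemma euler0 : euler (0 : C) = 1.
Proof.
have h0 : nc (0 : C) < 1 by rewrite normc0.
apply: ctends_unique (euler_ctends h0) _; apply: (ctends_eq _ (ctends_cst 1)) => n.
by elim: n => [|n IH]; rewrite ?qpoch0 // qpochS -IH expr0n subr0 mulr1.
Qed.

Lemma cusp0 : cusp 0 = 0.
Proof.
rewrite /cusp /psi !bilac0 // euler0 expr1n FormsTheory.Psi_cusp ?subrr //.
Qed.

Definition cos26 (n : nat) : R := cos (pi * n%:R / 26).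

Lemma cos26_modn n : cos26 n = cos26 (n %% 52).
Proof.
rewrite {1}(divn_eq n 52); move: (n %/ 52)%N (n %% 52)%N => a b; elim: a => [//|a <-].
rewrite /cos26 mulSn -addnA addnC natrD mulrDr mulrDl.
have -> : pi * 52%:R / 26 = pi *+ 2 :> R by rewrite mulr2n; field.
by rewrite cosD2pi.
Qed.

Lemma cos26_opp n : (n <= 52)%N -> cos26 (52 - n) = cos26 n.
Proof.
move=> n52; rewrite /cos26 natrB // -[RHS]cosN -[RHS]cosD2pi; congr cos.
by rewrite mulr2n; field.
Qed.

Lemma cos26_half n : cos26 (n + 26) = - cos26 n.
Proof.
by rewrite /cos26 natrD -cosDpi; congr cos; field.
Qed.

(** Decides an equality up to sign of two values of [cos26] from the period 52, the evenness, and
    the change of sign under a shift by 26. *)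
Definition same_cos26 (s : bool) (a b : nat) : bool :=
  let r := (a %% 52)%N in let r' := ((b + 26 * s) %% 52)%N in
  (r == r') || (r + r' == 52)%N.

Lemma cos26_eq s a b : same_cos26 s a b -> cos26 a = (-1) ^+ s * cos26 b.
Proof.
have sE : (-1) ^+ s * cos26 b = cos26 (b + 26 * s).
  by case: s; rewrite ?muln1 ?muln0 ?addn0 ?mul1r // cos26_half mulN1r.
rewrite sE (cos26_modn a) (cos26_modn (_ + _)) => /orP[/eqP->//|/eqP].
move: (a %% 52)%N ((b + 26 * s) %% 52)%N => r r' e.
have -> : r' = (52 - r)%N by lia.
by rewrite cos26_opp //; lia.
Qed.

(** The sine is a cosine shifted by 13 steps of [pi / 26]; 39 is [52 - 13], which keeps the index a
    natural number. *)
Lemma sin13_cos26 e : sin (2 * pi * e%:R / 13) = cos26 (4 * e + 39) :> R.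
Proof.
rewrite -cosBpihalf -[LHS]cosD2pi /cos26 natrD natrM; congr cos.
by rewrite mulr2n; field.
Qed.

Lemma zeta13_sub e : (e <= 13)%N ->
  zeta13 R ^+ e - zeta13 R ^+ (13 - e) = 0 +i* (2 * sin (2 * pi * e%:R / 13)).
Proof.
move=> e13; rewrite -[zeta13 R]/(unity_root R 13) !unity_rootX natrB // mulrBl.
have -> : 13%:R * (2 * pi / 13%:R) = pi *+ 2 :> R by rewrite mulr2n; field.
rewrite [pi *+ 2 + _]addrC cosD2pi sinD2pi cosN sinN.
have -> : e%:R * (2 * pi / 13%:R) = 2 * pi * e%:R / 13 :> R by ring.
apply/eqP; rewrite eq_complex /= subrr eqxx /=; apply/eqP; ring.
Qed.

Lemma theta13_imag (y : R) (i : 'I_6) : 0 < y ->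
  theta13 (0 +i* y) i = (-1) ^+ (i == 3 :> nat) * thv 6 (tidx i) y.
Proof.
move=> y0; have z0 : 0 < complex.Im (0 +i* y) by [].
rewrite (theta13E _ z0) /thv; move: (tidx i) => j.
rewrite [qpow _ 1]qpow_i [qpow _ (_ / 104)]qpow_i mulr1.
have -> : 2 * pi * ((j + j).+1%:R ^+ 2 / 104) * y = pi * y * (j + j).+1%:R ^+ 2 / (4 * (6 + 6).+1%:R).
  by move: (j + j).+1%:R (pi : R) => l p; field.
by [].
Qed.

Lemma sum_tidx (f : nat -> C) : \sum_(k < 6) f k = \sum_(j < 6) f (tidx j).
Proof. by rewrite !big_ord_recr !big_ord0 /= /tidx /=; ring. Qed.

(** Identifies [S13] with the cosine kernel of [theta_inversion], reordered by [tidx] and with the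
    sign of the fourth coordinate; the 36 index comparisons are computed. *)
Lemma S13_cos26 (i j : 'I_6) : S13 R i j = (0 +i* (- (2 / Num.sqrt 13))) *
  ((-1) ^+ ((i == 3 :> nat) (+) (j == 3 :> nat)) *
    cos26 ((tidx i + tidx i).+1 * (tidx j + tidx j).+1))%:C.
Proof.
have chk : all6 (fun i j => same_cos26 ((i == 3) (+) (j == 3))
    ((tidx i + tidx i).+1 * (tidx j + tidx j).+1) (4 * nth 0 (nth [::] S_exp i) j + 39)
  && (nth 0 (nth [::] S_exp i) j <= 13))%N by vm_compute.
have /andP[/cos26_eq -> e13] := all6P chk i j.
rewrite mulrA -expr2 sqrr_sign mul1r -sin13_cos26.
rewrite -[S13 R]/(Smx (zeta13 R) (Num.sqrt 13)%:C) /Smx !mxE.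
rewrite (nth_map [::]) ?ltn_ord //.
rewrite (nth_map 0%N); last by case: i j {e13} => -[|[|[|[|[|[|//]]]]]] ? [[|[|[|[|[|[|//]]]]]] ?].
rewrite zeta13_sub // div1r -fmorphV /=.
apply/eqP; rewrite eq_complex /=; apply/andP; split; apply/eqP; ring.
Qed.

Lemma theta13_inversion (y : R) (i : 'I_6) : 0 < y -> theta13 (0 +i* y^-1) i =
  (0 +i* Num.sqrt y) * \sum_(j < 6) S13 R i j * theta13 (0 +i* y) j.
Proof.
move=> y0; have yi : 0 < y^-1 by rewrite invr_gt0.
have ti : (tidx i < 6)%N by case: i => -[|[|[|[|[|[|]]]]]].
rewrite theta13_imag // (theta_inversion ti yi) invrK.
rewrite (sum_tidx (fun k => (cos (pi * ((tidx i + tidx i).+1%:R * (k + k).+1%:R) /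
  (2 * (6 + 6).+1%:R)))%:C * thv 6 k y)) !mulr_sumr; apply: eq_bigr => j _.
rewrite theta13_imag // S13_cos26.
have -> : cos (pi * ((tidx i + tidx i).+1%:R * (tidx j + tidx j).+1%:R) / (2 * (6 + 6).+1%:R)) =
    cos26 ((tidx i + tidx i).+1 * (tidx j + tidx j).+1).
  by rewrite /cos26 natrM; congr (cos (_ / _)); rewrite -natrM.
have -> : Num.sqrt (4 / ((6 + 6).+1%:R * y^-1)) = 2 * Num.sqrt y / Num.sqrt 13.
  have -> : 4 / ((6 + 6).+1%:R * y^-1) = 2 ^+ 2 * (y * 13^-1).
    by field; rewrite gt_eqF.
  rewrite sqrtrM ?sqr_ge0 // sqrtr_sqr ger0_norm // sqrtrM ?(ltW y0) // sqrtrV //.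
  by rewrite mulrA.
have -> : (2 * Num.sqrt y / Num.sqrt 13)%:C = (0 +i* Num.sqrt y) * (0 +i* (- (2 / Num.sqrt 13))).
  apply/eqP; rewrite eq_complex /=; apply/andP; split; apply/eqP; ring.
have -> : (-1) ^+ ((i == 3 :> nat) (+) (j == 3 :> nat)) =
    (-1) ^+ (i == 3 :> nat) * (-1) ^+ (j == 3 :> nat) :> R by rewrite signr_addb.
rewrite !rmorphM !rmorphXn !rmorphN1 /=.
have s2 : (-1) ^+ (j == 3 :> nat) * (-1) ^+ (j == 3 :> nat) = 1 :> C by rewrite -expr2 sqrr_sign.
by ring: s2.
Qed.

Lemma eta_imag (y : R) : 0 < y -> eta (0 +i* y) = thv 1 0 y.
Proof.
move=> y0; have p0 := pi_gt0 R; rewrite eta_euler /thv !qpow_i mulr1.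
have q1 : nc (expR (- (2 * pi * y)))%:C < 1.
  by rewrite nc_real ger0_norm ?expR_ge0 // expR_lt1 oppr_lt0 !mulr_gt0.
have q0 : (expR (- (2 * pi * y)))%:C != 0 :> C.
  by rewrite -nc_gt0 nc_real normr_gt0 gt_eqF ?expR_gt0.
by rewrite pentagonal //; congr ((expR _)%:C * _); field.
Qed.

Lemma eta_inversion (y : R) : 0 < y ->
  eta (0 +i* y^-1) = (Num.sqrt y)%:C * eta (0 +i* y).
Proof.
move=> y0; have yi : 0 < y^-1 by rewrite invr_gt0.
rewrite !eta_imag // (theta_inversion (ltn0Sn 0) yi) invrK big_ord_recl big_ord0 addr0 /=.
have -> : pi * ((0 + 0).+1%:R * (0 + 0).+1%:R) / (2 * (1 + 1).+1%:R) = pi / 6 :> R.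
  by rewrite !mulr1 -natrM.
rewrite cos_pi6 mulrA -rmorphM /=; congr (_%:C * _).
have -> : 4 / ((1 + 1).+1%:R * y^-1) = (2 ^+ 2 / 3) * y by field; rewrite gt_eqF.
rewrite sqrtrM ?divr_ge0 // sqrtrM ?sqr_ge0 // sqrtr_sqr ger0_norm // sqrtrV //.
by field; rewrite gt_eqF // sqrtr_gt0.
Qed.

End ThetaConstants.

Section InvariantDecomposition.
Variable R : realType.
Local Notation C := R[i].
Local Notation nc := (@normc R).
Implicit Types z : C.

Lemma zeta13_unity : zeta13 R ^+ 13 = 1.
Proof. exact: (@unity_rootN R 13). Qed.

Lemma zeta13_sum : \sum_(k < 13) zeta13 R ^+ k = 0.
Proof. by have := @sum_unity_root R 13 1 isT; rewrite expr1. Qed.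

Lemma nat_neq0C n : n.+1%:R != 0 :> C.
Proof. by rewrite pnatr_eq0. Qed.

Lemma zeta13_add e : (e <= 13)%N ->
  zeta13 R ^+ e + zeta13 R ^+ (13 - e) = (2 * cos (2 * pi * e%:R / 13))%:C.
Proof.
move=> e13; rewrite -[zeta13 R]/(unity_root R 13) !unity_rootX natrB // mulrBl.
have -> : 13%:R * (2 * pi / 13%:R) = pi *+ 2 :> R by rewrite mulr2n; field.
rewrite [pi *+ 2 + _]addrC cosD2pi sinD2pi cosN sinN.
have -> : e%:R * (2 * pi / 13%:R) = 2 * pi * e%:R / 13 :> R by ring.
apply/eqP; rewrite eq_complex /= subrr eqxx andbT; apply/eqP; ring.
Qed.

(** Conjugate powers combine to [1 + 4 (cos (2 pi / 13) + cos (6 pi / 13) + cos (8 pi / 13))], whose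
    square is 13. Only the last cosine is negative, and the first one outweighs it. *)
Lemma gauss_sqrt13 : (Num.sqrt 13)%:C = ev (zeta13 R) gauss.
Proof.
have p0 := pi_gt0 R.
pose r : R := 1 + 4 * (cos (2 * pi * 1%:R / 13) + cos (2 * pi * 3%:R / 13)
  + cos (2 * pi * 4%:R / 13)).
have evE : ev (zeta13 R) gauss = r%:C.
  have h1 := @zeta13_add 1 isT; have h3 := @zeta13_add 3 isT; have h4 := @zeta13_add 4 isT.
  rewrite /ev !big_cons big_nil /=.
  have -> : r%:C = 1 + 2 * ((2 * cos (2 * pi * 1%:R / 13))%:C
     + (2 * cos (2 * pi * 3%:R / 13))%:C + (2 * cos (2 * pi * 4%:R / 13))%:C).
    rewrite /r; move: (cos _) (cos _) (cos _) => x y t.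
    rewrite !(rmorphD (real_complex R)) !(rmorphM (real_complex R)) !(rmorphD (real_complex R)).
    by rewrite !(rmorph1 (real_complex R)); ring.
  rewrite -h1 -h3 -h4 /= !subSS !subn0.
  rewrite -[1%:~R]/(1 : C) -[2%:~R]/(2 : C).
  ring.
have r2 : r ^+ 2 = 13.
  have := gauss_sqr zeta13_unity zeta13_sum (erefl _); rewrite evE -rmorphXn /=.
  by move=> [].
have r0 : 0 <= r.
  have c3 : 0 <= cos (2 * pi * 3%:R / 13) :> R.
    by apply: cos_ge0_pihalf; apply/andP; split; lra.
  have c4 : 0 <= cos (2 * pi * 1%:R / 13) + cos (2 * pi * 4%:R / 13) :> R.
    have -> : cos (2 * pi * 4%:R / 13) = - cos (5 * pi / 13) :> R.
      rewrite -[RHS]cosDpi -[RHS]cosN -[RHS]cosD2pi; congr cos.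
      by rewrite mulr2n; field.
    rewrite subr_ge0 ltW // ltr_cos ?in_itv /=; [lra| |]; apply/andP; split; lra.
  by rewrite /r; lra.
by rewrite evE -r2 sqrtr_sqr ger0_norm.
Qed.

Lemma weil13 : exists rho : mx_representation C SL2_13 6,
  [/\ rho sl2_s = S13 R /\ rho sl2_t = T13 R,
      forall g, g \in 'Z(SL2_13)%g -> is_scalar_mx (rho g),
      forall g, g \in SL2_13 -> Forms.invariant_under (rho g) (Forms.Phi12 C) &
      forall g, g \in borel_SL2_13 ->
        Forms.invariant_under (rho g) (Forms.coord_prod_sq C)].
Proof.
exact: (weil_representation zeta13_unity zeta13_sum gauss_sqrt13 (nat_neq0C 25)).
Qed.

Lemma Phi12_S13 : Forms.invariant_under (S13 R) (Forms.Phi12 C).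
Proof.
exact: (FormsTheory.Phi12_Smx zeta13_unity zeta13_sum gauss_sqrt13 (nat_neq0C 25)).
Qed.

(** The scalar factor in the law of the theta vector is the imaginary number with imaginary part
    [Num.sqrt y]; its 12th power is [y ^+ 6], the same factor as for [eta ^+ 12]. *)
Lemma defect_imag (y : R) : 0 < y ->
  defect (0 +i* y^-1) = (y ^+ 6)%:C * defect (0 +i* y).
Proof.
move=> y0; rewrite /defect mulrBr eta_inversion // exprMn.
rewrite -rmorphXn (_ : Num.sqrt y ^+ 12 = y ^+ 6); last first.
  by rewrite -[12%N]/(2 * 6)%N exprM sqr_sqrtr // ltW.
congr (_ - _).
rewrite (FormsTheory.eval_ext _ (fun i => theta13_inversion i y0)).
rewrite (FormsTheory.eval_homog _ _ (FormsTheory.Phi12_homog C)) -FormsTheory.eval_subst_mx Phi12_S13.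
congr (_ * _); rewrite -[12%N]/(2 * 6)%N exprM.
have -> : (0 +i* Num.sqrt y) ^+ 2 = - y%:C.
  rewrite expr2; apply/eqP; rewrite eq_complex /= !mulr0 !mul0r sub0r addr0 oppr0 eqxx andbT.
  by rewrite -expr2 sqr_sqrtr // ltW.
by rewrite exprNn -signr_odd mul1r rmorphXn.
Qed.

(** * From the imaginary axis to the half-plane through the Cayley disc *)

Definition imagu : C := 0 +i* 1.

Lemma imagu_sqr : imagu ^+ 2 = -1.
Proof. by rewrite expr2; apply/eqP; rewrite eq_complex /= !mulr0 !mul0r mulr1 sub0r addr0 oppr0 !eqxx. Qed.

Lemma imagu_neq0 : imagu != 0.
Proof. by rewrite eq_complex /= oner_eq0 andbF. Qed.

Definition cayley (w : C) : C := imagu * ((1 + w) * (1 - w)^-1).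

Lemma one_sub_neq0 (w : C) : nc w < 1 -> 1 - w != 0.
Proof. by move=> w1; rewrite subr_eq0; apply: contraTneq w1 => <-; rewrite normc1 ltxx. Qed.

Lemma nc_sqr (w : C) : nc w ^+ 2 = complex.Re w ^+ 2 + complex.Im w ^+ 2.
Proof. by case: w => a b /=; rewrite sqr_sqrtr // addr_ge0 ?sqr_ge0. Qed.

(** The imaginary part is [(1 - |w| ^ 2) / |1 - w| ^ 2]. The bound shows that [q] sends a closed
    subdisc into a closed subdisc, as [hol_comp] demands. *)
Lemma cayley_Im (w : C) : nc w < 1 -> (1 - nc w) / 4 <= complex.Im (cayley w).
Proof.
move=> w1; have w0 := nc_ge0 w; have := one_sub_neq0 w1; have := nc_sqr w.
have := nc_sqr (1 - w); have : nc (1 - w) <= 2.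
  by apply: le_trans (ncB _ _) _; rewrite normc1; lra.
have := nc_ge0 (1 - w); rewrite -nc_gt0; move: (nc (1 - w)) => m.
case: w w1 w0 => a b; move: (nc _) => n n1 n0 m0 m2 mE nE m1 /=.
move: mE nE; rewrite /= => mE nE.
have d0 : 0 < (1 - a) ^+ 2 + (0 - b) ^+ 2 by rewrite -mE exprn_gt0.
rewrite mul0r add0r mul1r -mE.
have mm := lt0r_neq0 m1.
have -> : (1 + a) * ((1 - a) / m ^+ 2) - (0 + b) * - ((0 - b) / m ^+ 2) = (1 - n ^+ 2) / m ^+ 2.
  by rewrite nE; move: m mm {m0 m2 mE m1} => m mm; field.
rewrite ler_pdivlMr ?exprn_gt0 //.
have m4 : m ^+ 2 <= 4 by nra.
nra.
Qed.

Lemma hol_qpow_cayley (a : R) : hol (fun w => qpow (cayley w) a).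
Proof.
apply: hol_cexp; apply: holM (hol_cst _) _; apply: holM (hol_cst _) _.
apply: holM; last exact: hol_geom.
by apply: holD; [exact: hol_cst|exact: hol_id].
Qed.

Lemma cayley_gt0 (w : C) : nc w < 1 -> 0 < complex.Im (cayley w).
Proof.
by move=> w1; apply: lt_le_trans (cayley_Im w1); rewrite divr_gt0 // subr_gt0.
Qed.

(** Under [z = cayley w], inversion is [w |-> - w] and [z / i] is [(1 + w) / (1 - w)]; the factor
    [(1 - w) ^ -6] absorbs the weight, so that the law becomes evenness. *)
Definition disc_defect (w : C) : C := (1 - w)^-1 ^+ 6 * defect (cayley w).

Lemma hol_disc_defect : hol disc_defect.
Proof.
apply: (@hol_ext R (fun w => (1 - w)^-1 ^+ 6 *
    (qpow (cayley w) (1 / 2) * cusp (qpow (cayley w) 1)))).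
  by move=> w w1; rewrite /disc_defect defectE // cayley_gt0.
apply: holM; first by apply: holX; exact: hol_geom.
apply: holM; first exact: hol_qpow_cayley.
apply: hol_comp (@hol_cusp R) (@hol_qpow_cayley 1) _ => r /andP[r0 r1].
have p0 := pi_gt0 R.
exists (expR (- (2 * pi * 1 * ((1 - r) / 4)))).
  by rewrite expR_ge0 expR_lt1 oppr_lt0 !mulr_gt0 ?invr_gt0 ?subr_gt0.
move=> w wr; rewrite nc_qpow ler_expR lerN2 ler_pM2l ?mulr_gt0 //.
have w1 : nc w < 1 := le_lt_trans wr r1.
by apply: le_trans (cayley_Im w1); rewrite ler_pM2r ?invr_gt0 // lerD2l lerN2.
Qed.

Lemma cayley_real (a : R) : 0 < 1 - a -> cayley a%:C = 0 +i* ((1 + a) / (1 - a)).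
Proof.
move=> a1; have a2 := lt0r_neq0 a1; rewrite /cayley /imagu.
have -> : (1 + a%:C) * (1 - a%:C)^-1 = ((1 + a) / (1 - a))%:C :> C.
  by rewrite (rmorphM (real_complex R)) (fmorphV (real_complex R)) rmorphD rmorphB rmorph1.
by apply/eqP; rewrite eq_complex /= !mul0r mulr0 subrr mul1r add0r !eqxx.
Qed.

Lemma disc_defect_even (w : C) : nc w < 1 -> disc_defect (- w) = disc_defect w.
Proof.
move=> w1; apply/eqP; rewrite -subr_eq0; apply/eqP; move: w w1.
apply: (@hol_identity R (fun w => disc_defect (- w) - disc_defect w)).
  apply: holD; first by apply: hol_opp; exact: hol_disc_defect.
  by apply: holN; exact: hol_disc_defect.
move=> a /andP[a0 a1]; apply/eqP; rewrite subr_eq0; apply/eqP.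
have h1 : 0 < 1 - a by lra.
have h2 : 0 < 1 + a by lra.
have h1' := lt0r_neq0 h1; have h2' := lt0r_neq0 h2.
have h3 : 0 < 1 - - a by rewrite opprK.
rewrite /disc_defect; have -> : - a%:C = (- a)%:C :> C by rewrite rmorphN.
rewrite !cayley_real // opprK.
have -> : (1 - a) / (1 + a) = ((1 + a) / (1 - a))^-1 by rewrite invf_div.
rewrite defect_imag ?divr_gt0 // mulrA; congr (_ * _).
have -> : 1 - (- a)%:C = (1 + a)%:C :> C by rewrite rmorphN opprK rmorphD rmorph1.
have -> : 1 + (- a)%:C = (1 - a)%:C :> C by rewrite rmorphD rmorph1.
rewrite -!(fmorphV (real_complex R)) -!(rmorphXn (real_complex R)) -(rmorphM (real_complex R)).
congr (real_complex R _); rewrite -exprMn; congr (_ ^+ 6).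
by field; rewrite h1'.
Qed.

Lemma nc_imagu : nc imagu = 1.
Proof. by rewrite /= expr0n expr1n add0r sqrtr1. Qed.

Lemma Im_gt0_neq0 z : 0 < complex.Im z -> z != 0.
Proof. by apply: contraTneq => ->; rewrite ltxx. Qed.

Lemma nc_defect_inv z : 0 < complex.Im z ->
  nc (defect (- z^-1)) = nc z ^+ 6 * nc (defect z).
Proof.
move=> z0; have zi : z + imagu != 0.
  by apply: Im_gt0_neq0; case: z z0 => a b /= b0; rewrite addr_gt0.
have zn := Im_gt0_neq0 z0.
pose w := (z - imagu) / (z + imagu).
have i0 := imagu_neq0.
have two : 2 != 0 :> C := nat_neq0C 1.
have p1 : 1 + w = 2 * z / (z + imagu) by rewrite /w; field.
have p2 : 1 - w = 2 * imagu / (z + imagu) by rewrite /w; field.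
have w1 : nc w < 1.
  rewrite /w normcM normcV ltr_pdivrMr ?nc_gt0 // mul1r.
  rewrite -(@ltr_pXn2r _ 2) ?nnegrE ?nc_ge0 // !nc_sqr.
  by case: z z0 {zi zn w p1 p2} => a b /= b0; nra.
have c1 : cayley w = z.
  by rewrite /cayley p1 p2; field; rewrite i0 zi.
have c2 : cayley (- w) = - z^-1.
  rewrite /cayley opprK p1 p2; transitivity (imagu ^+ 2 * z^-1); last by rewrite imagu_sqr mulN1r.
  by field; rewrite zn zi.
have := disc_defect_even w1; rewrite /disc_defect c1 c2 opprK p1 p2 => e.
have -> : defect (- z^-1) = (z / imagu) ^+ 6 * defect z.
  have k0 : (2 * z / (z + imagu))^-1 ^+ 6 != 0.
    by rewrite expf_neq0 // invr_eq0 !mulf_neq0 ?invr_eq0.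
  apply: (mulfI k0); rewrite e mulrA -exprMn; congr (_ ^+ 6 * _).
  by field; rewrite zn i0 zi.
by rewrite normcM ncX normcM normcV nc_imagu invr1 mulr1.
Qed.

(** * Invariance, boundedness and contraction of [mu] *)

Lemma qpow_shift z (n : nat) : qpow (z + n%:R) 1 = qpow z 1.
Proof.
elim: n => [|n IH]; first by rewrite addr0.
rewrite -natr1 addrA -[RHS]IH; move: (z + n%:R) => w.
rewrite /qpow mulrDr cexpD.
have -> : cexp ((0 +i* (2 * pi * 1)) * 1) = 1 :> C.
  rewrite (mulr1 (0 +i* (2 * pi * 1))) cexp_iE (mulr1 (2 * pi)) mulr_natl.
  by rewrite cos2pi sin2pi.
by rewrite (mulr1 (cexp _)).
Qed.

Lemma Im_shift z (n : nat) : complex.Im (z + n%:R) = complex.Im z.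
Proof. by rewrite -(rmorph_nat (real_complex R)); case: z => a b /=; rewrite addr0. Qed.

Lemma Re_shift z (n : nat) : complex.Re (z + n%:R) = complex.Re z + n%:R.
Proof. by rewrite -(rmorph_nat (real_complex R)); case: z. Qed.

Definition mu z : R := nc (defect z) * complex.Im z ^+ 3.

Lemma nc_cusp z : 0 < complex.Im z ->
  mu z = complex.Im z ^+ 3 * expR (- (pi * complex.Im z)) * nc (cusp (qpow z 1)).
Proof.
move=> z0; rewrite /mu (defectE z0) normcM nc_qpow.
have -> : 2 * pi * (1 / 2) * complex.Im z = pi * complex.Im z by field.
by rewrite mulrC mulrA.
Qed.

Lemma mu_shift z n : 0 < complex.Im z -> mu (z + n%:R) = mu z.
Proof.
move=> z0; have z1 : 0 < complex.Im (z + n%:R) by rewrite Im_shift.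
by rewrite (nc_cusp z1) (nc_cusp z0) qpow_shift Im_shift.
Qed.

Lemma Im_opp_inv z : complex.Im (- z^-1) = complex.Im z / nc z ^+ 2.
Proof. by rewrite nc_sqr; case: z => a b /=; rewrite opprK. Qed.

Lemma mu_inv z : 0 < complex.Im z -> mu (- z^-1) = mu z.
Proof.
move=> z0; rewrite /mu nc_defect_inv // Im_opp_inv.
have zn : nc z != 0 by rewrite nc_eq0 Im_gt0_neq0.
by move: (nc z) zn (nc (defect z)) (complex.Im z) => u u0 v t; field.
Qed.

(** When [|Re z| <= 1/2] and [Im z ^ 2 < 1/2], one has [|z| ^ 2 <= 3/4], so inversion multiplies the
    imaginary part by at least [4/3]. The threshold 1/2, below the 3/4 of the usual fundamental
    domain, secures this fixed gain, and [n] bounds the number of inversions. *)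
Lemma mu_reduce (B : R) : (forall z, 0 < complex.Im z -> 1 / 2 <= complex.Im z ^+ 2 -> mu z <= B) ->
  forall z, 0 < complex.Im z -> mu z <= B.
Proof.
move=> hB z z0; have r01 : 0 <= (3 / 4 : R) < 1 by apply/andP; split; lra.
have [n hn] := exp_small r01 z0; elim: n z z0 hn => [|n IH] z z0 hn.
  by apply: hB => //; rewrite expr0 in hn; nra.
have [x [xz x1 xm]] : exists x : C, [/\ complex.Im x = complex.Im z,
    complex.Re x ^+ 2 <= 1 / 4 & mu x = mu z].
  (* The integer nearest to [|Re z|]; the sign of [Re z] decides the direction of the shift. *)
  pose k := Num.truncn (`|complex.Re z| + 1 / 2).
  have /andP[k1 k2] : k%:R <= `|complex.Re z| + 1 / 2 < k.+1%:R.
    by apply: truncn_itv; rewrite addr_ge0 // divr_ge0.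
  have [x0|x0] := leP 0 (complex.Re z).
    exists (z - k%:R); rewrite -[X in mu _ = mu X](subrK (k%:R : C) z).
    have imE : complex.Im (z - k%:R) = complex.Im z by rewrite -[in RHS](subrK (k%:R : C) z) Im_shift.
    split=> //; last by rewrite mu_shift // imE.
    have -> : complex.Re (z - k%:R) = complex.Re z - k%:R.
      by rewrite -[in RHS](subrK (k%:R : C) z) Re_shift addrK.
    by rewrite ger0_norm // -[k.+1%:R]natr1 in k1 k2; nra.
  exists (z + k%:R); rewrite Im_shift mu_shift // Re_shift; split=> //.
  by rewrite ltr0_norm // -[k.+1%:R]natr1 in k1 k2; nra.
rewrite -xm; rewrite -xz in z0 hn; have [h|h] := leP (1 / 2) (complex.Im x ^+ 2).
  exact: hB.
rewrite -mu_inv //; have n0 : 0 < nc x ^+ 2 by rewrite nc_sqr; nra.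
have n1 : nc x ^+ 2 <= 3 / 4 by rewrite nc_sqr; lra.
apply: IH; rewrite Im_opp_inv; first by rewrite divr_gt0.
rewrite ltr_pdivlMr //; rewrite exprS in hn.
have p0 : 0 <= (3 / 4 : R) ^+ n by rewrite exprn_ge0 //; lra.
by nra.
Qed.

Lemma pi_ge3 : 3 <= pi :> R.
Proof.
have p0 := pi_gt0 R; have s1 : sin (pi / 6) = 1 / 2 :> R.
  have s0 : 0 < sin (pi / 6 : R) by apply: sin_gt0_pi; apply/andP; split; lra.
  have := cos2Dsin2 (pi / 6 : R); rewrite cos_pi6 expr_div_n sqr_sqrtr ?ler0n // => h.
  have /eqP : sin (pi / 6 : R) ^+ 2 = (1 / 2) ^+ 2 by rewrite expr_div_n; lra.
  by rewrite eqrXn2 ?(ltW s0) ?divr_ge0 // => /eqP.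
by have := @sin_le_id R (pi / 6); rewrite s1 => h; lra.
Qed.

(** 7/10 is a rational lower bound for the square root of 1/2. *)
Lemma Im_sqr_ge (y : R) : 0 < y -> 1 / 2 <= y ^+ 2 -> 7 / 10 <= y.
Proof. by move=> y0; apply: contraTT; rewrite -!ltNge => h; nra. Qed.

Lemma mu_bounded : exists2 B : R, 0 <= B & forall z, 0 < complex.Im z -> mu z <= B.
Proof.
have r01 : 0 <= expR (- 1 : R) < 1 by rewrite expR_ge0 expR_lt1 oppr_lt0 ltr01.
have [B [B0 hB]] := hol_bounded (@hol_cusp R) r01.
exists B => //; apply: mu_reduce => z z0 z1; rewrite (nc_cusp z0).
have y7 := Im_sqr_ge z0 z1; have p3 := pi_ge3; set y := complex.Im z in z0 z1 y7 *.
(* At height at least 7/10 the modulus of [q] is at most [exp (-1)], the radius for which [cusp] was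
   bounded. *)
have cB : nc (cusp (qpow z 1)) <= B.
  by apply: hB; rewrite nc_qpow ler_expR lerN2 -/y; nra.
move: (nc (cusp _)) (nc_ge0 (cusp (qpow z 1))) cB => c c0 cB.
rewrite -[X in _ <= X]mul1r ler_pM ?mulr_ge0 ?exprn_ge0 ?expR_ge0 ?(ltW z0) //.
rewrite expRN ler_pdivrMr ?expR_gt0 // mul1r.
apply: le_trans (_ : expR y ^+ 3 <= _).
  rewrite lerXn2r ?nnegrE ?expR_ge0 ?(ltW z0) //.
  by apply: le_trans (expR_ge1Dx _); lra.
by rewrite -expRM_natl ler_expR ler_pM2r.
Qed.

Lemma argument_exists (a b : R) : a ^+ 2 + b ^+ 2 = 1 -> exists t, cos t = a /\ sin t = b.
Proof.
move=> ab; have a1 : -1 <= a <= 1 by have hb := sqr_ge0 b; apply/andP; split; nra.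
have s : sin (acos a) = `|b|.
  by rewrite sin_acos // -sqrtr_sqr; congr Num.sqrt; rewrite -ab; ring.
have [b0|b0] := leP 0 b.
  by exists (acos a); rewrite acosK // s ger0_norm.
by exists (- acos a); rewrite cosN sinN acosK // s ltr0_norm // opprK.
Qed.

Lemma qpow_surj (v : C) (y : R) : nc v = expR (- (2 * pi * y)) ->
  exists2 z, complex.Im z = y & qpow z 1 = v.
Proof.
case: v => a b; set r := expR _ => vr; have r0 : 0 < r := expR_gt0 _.
have r1 := lt0r_neq0 r0; have p1 := lt0r_neq0 (pi_gt0 R).
have [t [ct st]] : exists t, cos t = a / r /\ sin t = b / r.
  apply: argument_exists; have := nc_sqr (a +i* b); rewrite vr /= => h.
  by rewrite !expr_div_n -mulrDl -h mulfV // expf_neq0.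
exists ((t / (2 * pi)) +i* y) => //; rewrite /qpow /cexp /= !mul0r mulr1 sub0r add0r -/r.
have -> : 2 * pi * (t / (2 * pi)) = t by move: (pi : R) p1 => p p1; field.
rewrite ct st; apply/eqP; rewrite eq_complex /= !mul0r subr0 addr0.
by rewrite ![r * _]mulrC !divfK // !eqxx.
Qed.

(** For [E = exp (- pi s)] the hypothesis is [exp (3 s / 4) >= 1 + 3 s / 4] combined with [pi >= 3].
    It gives [(4 s + 1) E <= 9/10] and [E <= 1/3], and [(9/10) ^ 3 / (8/9)] is below [5/6]. *)
Lemma contraction_bound (s E : R) : 45 / 100 <= s -> 0 < E -> (1 + 3 * s / 4) ^+ 4 * E <= 1 ->
  ((4 * s + 1) * E) ^+ 3 / (1 - E ^+ 2) <= 5 / 6.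
Proof.
move=> s1 E0 hE; set u := (1 + 3 * s / 4) ^+ 4 in hE *.
have u3 : 3 <= u.
  apply: le_trans (_ : (1 + 3 * (45 / 100) / 4) ^+ 4 <= _); first lra.
  by rewrite lerXn2r ?nnegrE; lra.
have us : 4 * s + 1 <= 9 / 10 * u.
  (* [a] is the excess of [3 s / 4] over its least value 27/80; in powers of [a >= 0] the claim
     holds coefficient by coefficient. *)
  rewrite /u; pose a := 3 * s / 4 - 27 / 80; have a0 : 0 <= a by rewrite /a; lra.
  have -> : s = 4 / 3 * a + 45 / 100 by rewrite /a; field.
  have -> : (1 + 3 * (4 / 3 * a + 45 / 100) / 4) ^+ 4 =
     (107 / 80) ^+ 4 + 4 * (107 / 80) ^+ 3 * a + 6 * (107 / 80) ^+ 2 * a ^+ 2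
     + 4 * (107 / 80) * a ^+ 3 + a ^+ 4 by field.
  have a2 : 0 <= a ^+ 2 by apply: exprn_ge0.
  have a3 : 0 <= a ^+ 3 by apply: exprn_ge0.
  have a4 : 0 <= a ^+ 4 by apply: exprn_ge0.
  lra.
have E3 : E <= 1 / 3 by nra.
have x1 : (4 * s + 1) * E <= 9 / 10 by nra.
have x0 : 0 <= (4 * s + 1) * E by rewrite mulr_ge0 ?(ltW E0) //; lra.
have x3 : ((4 * s + 1) * E) ^+ 3 <= (9 / 10) ^+ 3 by rewrite lerXn2r ?nnegrE //; lra.
have e2 : E ^+ 2 <= 1 / 9 by nra.
rewrite ler_pdivrMr; last by lra.
by apply: le_trans x3 _; lra.
Qed.

Lemma mu_contract (M : R) : 0 <= M -> (forall z, 0 < complex.Im z -> mu z <= M) ->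
  forall z, 0 < complex.Im z -> mu z <= 5 / 6 * M.
Proof.
move=> M0 hM; apply: mu_reduce => z z0 z1; have y7 := Im_sqr_ge z0 z1.
have p3 := pi_ge3; have p0 := pi_gt0 R.
(* The circle [|q| = r] corresponds to the height 1/4, well below the heights [y >= 7/10] to be
   estimated; the distance [s >= 45/100] makes the Schwarz bound a contraction. *)
set y := complex.Im z in z0 z1 y7 *; pose r := expR (- (2 * pi * (1 / 4 : R))).
have r01 : 0 < r < 1 by rewrite expR_gt0 expR_lt1 oppr_lt0 !mulr_gt0.
(* At height 1/4 the bound [mu <= M] is a bound for [cusp], with [64 = 4 ^ 3] from the weight and
   [exp (pi / 4)] from [|q^(1/2)|]. *)
have bnd v : nc v = r -> nc (cusp v) <= M * (64 * expR (pi / 4)).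
  move=> /qpow_surj[x xy <-]; have x0 : 0 < complex.Im x by rewrite xy; lra.
  have := hM x x0; rewrite (nc_cusp x0) xy => h.
  have -> : M * (64 * expR (pi / 4)) = M / ((1 / 4) ^+ 3 * expR (- (pi * (1 / 4)))).
    rewrite expRN (_ : pi * (1 / 4) = pi / 4) ?mul1r //.
    by have := expR_gt0 (pi / 4 : R); move: (expR _) => e /lt0r_neq0 e0; field.
  by rewrite ler_pdivlMr 1?mulrC // !mulr_gt0 ?exprn_gt0 ?expR_gt0 ?divr_gt0.
pose s := y - 1 / 4; pose E := expR (- (pi * s)).
have s1 : 45 / 100 <= s by rewrite /s; lra.
have E0 : 0 < E := expR_gt0 _.
have tE : nc (qpow z 1) / r = E ^+ 2.
  rewrite nc_qpow -/y /r -expRN -expRD /E -expRM_natl; congr expR; rewrite /s; ring.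
have hE : (1 + 3 * s / 4) ^+ 4 * E <= 1.
  rewrite /E expRN ler_pdivrMr ?expR_gt0 // mul1r.
  apply: le_trans (_ : expR (3 * s / 4) ^+ 4 <= _).
    by rewrite lerXn2r ?nnegrE ?expR_ge0 ?expR_ge1Dx //; lra.
  by rewrite -expRM_natl ler_expR; nra.
have E1 : E ^+ 2 < 1 by rewrite exprn_ilt1 ?(ltW E0) // expR_lt1 oppr_lt0 mulr_gt0 //; lra.
have qr : nc (qpow z 1) < r by rewrite -[X in _ < X]mul1r -ltr_pdivrMr ?tE //; case/andP: r01.
have := hol_schwarz (@hol_cusp R) (cusp0 R) r01 bnd qr; rewrite tE => h.
rewrite (nc_cusp z0) -/y; have k0 : 0 <= y ^+ 3 * expR (- (pi * y)).
  by rewrite mulr_ge0 ?expR_ge0 ?exprn_ge0 // ltW.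
apply: le_trans (ler_wpM2l k0 h) _.
have -> : expR (- (pi * y)) = E * expR (- (pi / 4)).
  by rewrite /E -expRD; congr expR; rewrite /s; field.
have -> : y ^+ 3 * (E * expR (- (pi / 4))) * (M * (64 * expR (pi / 4)) * (E ^+ 2 / (1 - E ^+ 2))) =
    M * (((4 * s + 1) * E) ^+ 3 / (1 - E ^+ 2)).
  have : expR (- (pi / 4)) * expR (pi / 4) = 1 :> R by rewrite -expRD addNr expR0.
  move: (expR _) (expR _) => e1 e2 e12.
  transitivity (M * (((4 * y) * E) ^+ 3 / (1 - E ^+ 2)) * (e1 * e2)); first by ring.
  by rewrite [e1 * e2]mulrC e12 mulr1 /s; congr (_ * ((_ * _) ^+ 3 / _)); field.
by rewrite mulrC ler_wpM2r // contraction_bound.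
Qed.

Lemma Phi12_eta z : 0 < complex.Im z ->
  Forms.eval (theta13 z) (Forms.Phi12 C) = eta z ^+ 12.
Proof.
move=> z0; have [B B0 hB] := mu_bounded.
have hn n : forall x, 0 < complex.Im x -> mu x <= (5 / 6) ^+ n * B.
  elim: n => [|n IH]; first by move=> x x0; rewrite mul1r hB.
  move=> x x0; rewrite exprS -mulrA; apply: mu_contract => //.
  by rewrite mulr_ge0 // exprn_ge0 //; lra.
have mu0 : mu z <= 0.
  apply: ler_eps => e e0; rewrite add0r.
  have r01 : 0 <= (5 / 6 : R) < 1 by apply/andP; split; lra.
  have B1 : 0 < B + 1 by lra.
  have [n h] := exp_small r01 (divr_gt0 e0 B1).
  apply: le_trans (hn n z z0) _; apply: le_trans (_ : (5 / 6) ^+ n * (B + 1) <= _).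
    by rewrite ler_wpM2l ?exprn_ge0 ?divr_ge0 // lerDl.
  by rewrite -ler_pdivlMr // ltW.
apply/eqP; rewrite -subr_eq0 -[_ - _]/(defect z) -nc_eq0 eq_le nc_ge0 andbT.
by rewrite -(ler_pM2r (exprn_gt0 3 z0)) mul0r.
Qed.

Lemma eta_neq0 z : 0 < complex.Im z -> eta z != 0.
Proof.
by move=> z0; rewrite eta_euler mulf_neq0 ?qpow_neq0 // euler_neq0 // nc_qpow_lt1.
Qed.

Lemma Im_13 z : complex.Im (13 * z) = 13 * complex.Im z.
Proof. by rewrite -(rmorph_nat (real_complex R)); case: z => a b /=; rewrite mul0r addr0. Qed.

(** The squares 121, 49, 25, 9, 81, 1 add up to 286, and [286 / 104 = 1 / 24 + 65 / 24] matches the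
    powers of [q] in [eta z * eta (13 * z) ^+ 5]. The sign is that of the fourth theta constant. *)
Lemma prod_theta13 z : 0 < complex.Im z ->
  \prod_(i < 6) theta13 z i = - (eta z * eta (13 * z) ^+ 5).
Proof.
move=> z0; have q1 : nc (qpow z 1) < 1 by apply: nc_qpow_lt1.
have q0 := qpow_neq0 z 1.
have qE : qpow (13 * z) 1 = qpow z 1 ^+ 13 by rewrite qpow_mul -qpowX.
have uE : qpow (13 * z) (1 / 24) ^+ 5 = qpow z (65 / 24).
  by rewrite -qpowX qpow_mul; congr qpow; field.
rewrite !eta_euler qE exprMn uE {uE}.
under eq_bigr => i _ do rewrite (theta13E _ z0).
rewrite !big_ord_recr big_ord0 /= /tidx /= !addnE /=.
have := prod_bilac13 q0 q1; move: (euler (qpow z 1)) (euler (qpow z 1 ^+ 13)) => e1 e13.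
move: (bilac 13 12 _) (bilac 13 10 _) (bilac 13 9 _) (bilac 13 8 _) (bilac 13 11 _)
  (bilac 13 7 _) => b1 b2 b3 b4 b5 b6 bE.
have uX n : qpow z (n%:R ^+ 2 / 104) = qpow z (1 / 104) ^+ (n ^ 2).
  by rewrite -qpowX natrX mul1r.
have -> : qpow z (1 / 24) * e1 * (qpow z (65 / 24) * e13 ^+ 5) =
   qpow z (1 / 104) ^+ 286 * (e1 * e13 ^+ 5).
  by rewrite -qpowX mulrACA -qpowD; congr (qpow _ _ * _); field.
by rewrite -bE !uX; ring.
Qed.

End InvariantDecomposition.

Theorem theorem1p1 (R : realType) :
  [/\ (* PSL(2,13) is a simple group of order 1092 *)
      simple PSL2_13 /\ #|PSL2_13| = 1092%N,

      (* the matrices S and T define an action of PSL(2,13) on P^5, for which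
         Phi12 is an invariant of degree 12, and (z1 z2 z3 z4 z5 z6)^2 is
         invariant under a Borel subgroup, maximal of order 78 *)
      exists rho : mx_representation R[i] SL2_13 6,
        [/\ rho sl2_s = S13 R /\ rho sl2_t = T13 R,
            forall g, g \in 'Z(SL2_13)%g -> is_scalar_mx (rho g),
            Forms.homogeneous 12 (Forms.Phi12 R[i]) /\
            (forall g, g \in SL2_13 ->
               Forms.invariant_under (rho g) (Forms.Phi12 R[i])) &
            [/\ maximal borel PSL2_13, #|borel| = 78%N &
                forall g, g \in SL2_13 -> coset 'Z(SL2_13) g \in borel ->
                  Forms.invariant_under (rho g) (Forms.coord_prod_sq R[i])]] &

      forall z : R[i], 0 < complex.Im z ->
        (eta z ^+ 2 / eta (13 * z) ^+ 2) ^+ 5 =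
        Forms.eval (theta13 z) (Forms.Phi12 R[i])
          / (\prod_(i < 6) theta13 z i) ^+ 2].
Proof.
split; first by split; [exact: simple_PSL|exact: card_PSL].
  have [rho [rST rZ rPhi rB]] := weil13 R; exists rho; split=> //.
    by split=> //; exact: FormsTheory.Phi12_homog.
  split; [exact: borel_maximal|exact: card_borel|].
  by move=> g gS gB; apply: rB; apply: (coset_borel2 (F := 'F_13)).
move=> z z0; rewrite Phi12_eta // prod_theta13 // sqrrN.
have e0 := eta_neq0 z0; have e1 : eta (13 * z) != 0.
  by apply: eta_neq0; rewrite Im_13 mulr_gt0.
by move: (eta z) (eta _) e0 e1 => u v u0 v0; field; rewrite u0 v0.
Qed.
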